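(* Let $S\subseteq\{1,\dots,n\}$ with $|S|=s$, let $x\in\mathbb{R}^n$ or $\mathbb{C}^n$ be supported on $S$ and satisfy the random sign assumption, and let $A$ be the random sensing matrix of the setting with parameter $\Theta(S,F)$. Let $y=Ax+\epsilon$ with $\|\epsilon\|_2\le\eta$ for a given $\eta>0$. There exist numerical constants $C_1,C_2>0$ such that for every $0<\varepsilon<1$, if $$m\ge 889\,\Theta(S,F)\,\ln^2\!\left(\tfrac{6n}{\varepsilon}\right),$$ then with probability at least $1-\varepsilon$ every minimizer $x^\sharp$ of (qBP) satisfies $\|x-x^\sharp\|_2\le (C_1+C_2\sqrt s)\,\eta$.
   Context: Setting: Let $n,m\ge 1$. For $\ell=1,\dots,m$ let $F_\ell$ be a probability distribution on $\mathbb{C}^{p_\ell\times n}$ ($p_\ell\ge1$), $F=(F_\ell)_{\ell=1}^m$, let $B_1,\dots,B_m$ be independent random matrices with $B_\ell\sim F_\ell$, and $A=\frac{1}{\sqrt m}\begin{pmatrix}B_1\\ \vdots\\ B_m\end{pmatrix}$. Isotropy is assumed: $\mathbb{E}(A^*A)=\frac1m\sum_{\ell=1}^m\mathbb{E}(B_\ell^*B_\ell)=\mathrm{Id}_n$. For $S\subseteq\{1,\dots,n\}$, $P_S$ is the restriction $P_Sx=x_S$ and $M_S:=MP_S^*$; $B_{\ell,S}=B_\ell P_S^*$. $\|M\|_{p\to q}=\sup_{\|v\|_p\le1}\|Mv\|_q$; in particular $\|M\|_{\infty\to\infty}$ is the maximal $\ell^1$ norm of a row of $M$. $\Theta(S,F)$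 denotes any positive real number such that almost surely $\|B_\ell^*B_{\ell,S}\|_{\infty\to\infty}\le\Theta(S,F)$ for all $\ell$. Random sign assumption: the vector $(x_i/|x_i|)_{i\in S}$ is a Rademacher sequence (independent uniform $\pm1$ entries) if $x$ is real, or a Steinhaus sequence (independent entries uniform on the complex unit circle) if $x$ is complex, independent of $A$. (qBP) is the problem $\min_{z\in\mathbb{C}^n}\|z\|_1$ subject to $\|y-Az\|_2\le\eta$. *)

(* Defs.v *)
From HB Require Import structures.
From mathcomp Require Import all_boot all_order all_algebra.
From mathcomp Require Import all_classical all_reals all_analysis.
From mathcomp Require Import complex.

Set Implicit Arguments.
Unset Strict Implicit.
Unset Printing Implicit Defensive.

Import Order.TTheory GRing.Theory Num.Theory.
Local Open Scope classical_set_scope.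
Local Open Scope ring_scope.
Local Open Scope complex_scope.

Section Defs.
Variable R : realType.

Definition cabs (z : R[i]) : R := Num.sqrt (complex.Re z ^+ 2 + complex.Im z ^+ 2).

(* phase z / |z| (with the MathComp convention 0^-1 = 0) *)
Definition csgn (z : R[i]) : R[i] := z * ((cabs z)^-1)%:C.

Definition adjmx (p q : nat) (M : 'M[R[i]]_(p, q)) : 'M[R[i]]_(q, p) :=
  (map_mx (@conjc R) M)^T.

(* ||M||_{oo->oo} = maximal l^1 norm of a row *)
Definition infnorm (p q : nat) (M : 'M[R[i]]_(p, q)) : R :=
  \big[Num.max/0]_(i < p) \sum_(j < q) cabs (M i j).

Definition colS (p n : nat) (S : {set 'I_n}) (M : 'M[R[i]]_(p, n))
  : 'M[R[i]]_(p, #|S|) :=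
  colsub (fun k : 'I_#|S| => (enum_val k : 'I_n)) M.

Definition norm1 (n : nat) (v : 'cV[R[i]]_n) : R := \sum_(i < n) cabs (v i 0).
Definition norm2 (n : nat) (v : 'cV[R[i]]_n) : R :=
  Num.sqrt (\sum_(i < n) cabs (v i 0) ^+ 2).

Definition qBP_minimizer (N n : nat) (A : 'M[R[i]]_(N, n)) (y : 'cV[R[i]]_N)
  (eta : R) (z : 'cV[R[i]]_n) : Prop :=
  norm2 (y - A *m z) <= eta /\
  forall w : 'cV[R[i]]_n, norm2 (y - A *m w) <= eta -> norm1 z <= norm1 w.

Definition sensing (m n : nat) (p : 'I_m -> nat)
  (B : forall l : 'I_m, 'M[R[i]]_(p l, n)) : 'M[R[i]]_(\sum_(l < m) p l, n) :=
  ((Num.sqrt (m%:R : R))^-1)%:C *: \mxcol_(l < m) B l.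

Section Prob.
Context {d : measure_display} {T : measurableType d}.

Definition sigmaC (K : Type) (f : K -> T -> R[i]) : set (set T) :=
  <<s [set A | exists k (B : set R), measurable B /\
        (A = (fun t => complex.Re (f k t)) @^-1` B \/ A = (fun t => complex.Im (f k t)) @^-1` B)] >>.

Definition cmeasurable (f : T -> R[i]) : Prop :=
  measurable_fun setT (fun t => complex.Re (f t)) /\ measurable_fun setT (fun t => complex.Im (f t)).

Definition mindep (P : probability T R) (I : finType) (G : I -> set (set T)) : Prop :=
  forall (J : {set I}) (A : I -> set T),
    (forall i, i \in J -> G i (A i)) ->
    fine (P [set t | forall i, i \in J -> A i t]) = \prod_(i in J) fine (P (A i)).

Definition rademacher (P : probability T R) (I : finType) (xi : I -> T -> R[i]) : Prop :=
  mindep P (fun i => sigmaC (fun _ : unit => xi i)) /\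
  forall i, P [set t | xi i t = 1] = (2^-1)%:E /\ P [set t | xi i t = -1] = (2^-1)%:E.

(* uniform distribution on the unit circle: the law of xi is the image of the
   normalised Lebesgue measure on [0, 2 pi) under theta |-> e^{i theta} *)
Definition unif_circle (P : probability T R) (xi : T -> R[i]) : Prop :=
  forall B : set R, measurable B ->
    P [set t | exists theta : R, B theta /\ (0 <= theta < 2 * pi)%R /\
                 xi t = (cos theta +i* sin theta)%C] =
    (lebesgue_measure (B `&` [set theta : R | (0 <= theta < 2 * pi)%R]) * ((2 * pi)^-1)%:E)%E.

Definition steinhaus (P : probability T R) (I : finType) (xi : I -> T -> R[i]) : Prop :=
  mindep P (fun i => sigmaC (fun _ : unit => xi i)) /\
  forall i, unif_circle P (xi i).

End Prob.
End Defs.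

(* Main.v *)
Require Import Defs.
From HB Require Import structures.
From mathcomp Require Import all_boot all_order all_algebra.
From mathcomp Require Import all_classical all_reals all_analysis.
From mathcomp Require Import measurable_realfun complex ring lra.
Set Implicit Arguments.
Unset Strict Implicit.
Unset Printing Implicit Defensive.
Import Order.TTheory GRing.Theory Num.Theory.
Import numFieldNormedType.Exports.
Local Open Scope classical_set_scope.
Local Open Scope ring_scope.

(** Put L = ln (6 n / eps), K = Theta / m <= 1 / (889 L^2), and let a_j be the
    columns of A and A_S its restriction to the columns in S.  A minimizer is
    compared with x through the dual certificate A^* A_S (A_S^* A_S)^-1 sgn x_S;
    three estimates are needed, each failing with probability O(e^-L).

    - A_S^* A_S is within 1/4 of the identity.  Instead of a matrix Bernstein
      inequality, the moments E tr Y^(2N) of Y = A_S^* A_S - Id are bounded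
      recursively with N close to L: exposing one block and symmetrising it with
      an independent copy gives E tr Y^(2N+2) <= O(N K) E tr Y^(2N).
    - For j outside S, the sum A_S^* a_j of m independent centered vectors is
      short, by Pinelis' argument for E cosh of the norm of a sum.
    - For j outside S, the certificate < (A_S^* A_S)^-1 A_S^* a_j, sgn x_S > is
      at most 3/4 in modulus: given A it is a sum of independent centered terms
      (the signs), so the same inequality applies.

    The bound by Theta is only almost sure, so the blocks are first truncated to
    zero where it fails. *)

(** * Bounded random variables and independence *)

(** The square of the logarithm comes from the third estimate. For signs to have tail [e^-L], their
    coefficient vector must have squared length [O(1/L)], so each [A_S^* a_j] has to be as short as
    [1 / (8 sqrt L)]; its variance is at most [K], and a Gaussian-type tail at that length is [e^-L]
    once [K L^2] is small. The first estimate asks only that [K L] be small. Its 1/4 bounds the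
    square of the operator norm: the distance to the identity is 1/2.

    Conditioning is never a conditional expectation. A quantity built from two independent parts of
    the sample is written [f (t, t)] with [f] measurable on the product of two sub-sigma-algebras of
    the same space, and an inequality proved for each frozen second argument is integrated
    ([decouple_le]). Hence measurability is tracked for the sigma-algebra of each block, and every
    variable is kept bounded for every outcome. The inverse of [A_S^* A_S] has no such bound off the
    good event, so both sides of the certificate bound are multiplied by the determinant. *)

Section BoundedMeasurable.
Context {R : realType}.

(** Boundedness is required everywhere, not almost everywhere: the class is then stable under
    products and under freezing an argument, and its members are integrable for every
    probability. *)
Definition bmeas {d} {U : measurableType d} (f : U -> R) : Prop :=
  measurable_fun setT f /\ exists M : R, forall u, `|f u| <= M.

Context {d} {U : measurableType d}.
Implicit Types f g : U -> R.

Lemma eq_bmeas f g : bmeas f -> f =1 g -> bmeas g.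
Proof. by move=> bf /funext <-. Qed.

Lemma bmeas_cst (c : R) : bmeas (fun _ : U => c).
Proof. by split; [exact: measurable_cst | exists `|c|]. Qed.

Lemma bmeasD f g : bmeas f -> bmeas g -> bmeas (fun u => f u + g u).
Proof.
move=> [mf [M fM]] [mg [N gN]]; split; first exact: measurable_funD.
exists (M + N) => u; apply: (le_trans (ler_normD _ _)); exact: lerD.
Qed.

Lemma bmeasN f : bmeas f -> bmeas (fun u => - f u).
Proof.
move=> [mf [M fM]]; split; first exact: measurableT_comp.
by exists M => u; rewrite normrN.
Qed.

Lemma bmeasB f g : bmeas f -> bmeas g -> bmeas (fun u => f u - g u).
Proof. by move=> bf bg; apply: bmeasD => //; exact: bmeasN. Qed.

Lemma bmeasM f g : bmeas f -> bmeas g -> bmeas (fun u => f u * g u).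
Proof.
move=> [mf [M fM]] [mg [N gN]]; split; first exact: measurable_funM.
by exists (M * N) => u; rewrite normrM ler_pM.
Qed.

Lemma bmeas_sum (I : Type) (r : seq I) (Q : pred I) (F : I -> U -> R) :
  (forall i, Q i -> bmeas (F i)) -> bmeas (fun u => \sum_(i <- r | Q i) F i u).
Proof.
move=> bF; elim: r => [|i r IH].
  by apply: (eq_bmeas (bmeas_cst 0)) => u; rewrite big_nil.
apply: (@eq_bmeas (fun u => (if Q i then F i u else 0) + \sum_(j <- r | Q j) F j u)).
  by apply: bmeasD => //; case E: (Q i); [exact: bF|exact: bmeas_cst].
by move=> u; rewrite big_cons; case: ifP; rewrite ?add0r.
Qed.

Lemma bmeas_expR_scale f (c : R) : bmeas f -> bmeas (fun u => expR (c * f u)).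
Proof.
move=> bf; have [mf [M fM]] := bmeasM (bmeas_cst c) bf.
split; first exact: measurableT_comp.
exists (expR M) => u; rewrite ger0_norm ?expR_ge0// ler_expR.
exact: le_trans (ler_norm _) (fM u).
Qed.

Lemma bmeas_indic (A : set U) : measurable A -> bmeas (\1_A : U -> R).
Proof.
move=> mA; split; first exact: measurable_indic.
by exists 1 => u; rewrite indicE; case: (_ \in _); rewrite ?normr1 ?normr0 ?ler01.
Qed.

Lemma measurable_superlevel f (a : R) : bmeas f -> measurable [set u | a <= f u].
Proof.
move=> [mf _]; have -> : [set u | a <= f u] = f @^-1` `[a, +oo[%classic.
  by apply/seteqP; split => u /=; rewrite in_itv/= andbT.
by rewrite -[X in measurable X]setTI; exact: mf.
Qed.

End BoundedMeasurable.

Section BoundedIntegral.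
Context {R : realType} {d} {T : measurableType d} (P : probability T R).
Implicit Types f g : T -> R.

Lemma bmeas_integrable f : bmeas f -> P.-integrable setT (EFin \o f).
Proof.
move=> [mf [M fM]]; apply: measurable_bounded_integrable => //.
  by apply: (@le_lt_trans _ _ 1%E); [exact: probability_le1|exact: ltry].
exists M; split; first exact: num_real.
by move=> x Mx y _; apply: le_trans (fM y) _; exact: ltW.
Qed.

Lemma bRintegralD f g : bmeas f -> bmeas g ->
  \int[P]_t (f t + g t) = \int[P]_t f t + \int[P]_t g t.
Proof. by move=> bf bg; apply: RintegralD => //; exact: bmeas_integrable. Qed.

Lemma bRintegralB f g : bmeas f -> bmeas g ->
  \int[P]_t (f t - g t) = \int[P]_t f t - \int[P]_t g t.
Proof. by move=> bf bg; apply: RintegralB => //; exact: bmeas_integrable. Qed.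

Lemma bRintegralZl f c : bmeas f -> \int[P]_t (c * f t) = c * \int[P]_t f t.
Proof. by move=> bf; apply: RintegralZl => //; exact: bmeas_integrable. Qed.

Lemma probability_Rintegral_cst (c : R) : \int[P]_t c = c.
Proof. rewrite Rintegral_cst// [X in fine X](_ : _ = 1%E) ?mulr1//; exact: probability_setT. Qed.

Lemma bRintegral_sum (I : Type) (r : seq I) (F : I -> T -> R) :
  (forall i, bmeas (F i)) ->
  \int[P]_t (\sum_(i <- r) F i t) = \sum_(i <- r) \int[P]_t F i t.
Proof.
move=> bF; elim: r => [|i r IH].
  rewrite big_nil; under eq_Rintegral do rewrite big_nil.
  exact: probability_Rintegral_cst.
rewrite big_cons -IH -bRintegralD//; last exact: bmeas_sum.
by apply: eq_Rintegral => t _; rewrite big_cons.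
Qed.

Lemma le_bRintegral f g : bmeas f -> bmeas g -> (forall t, f t <= g t) ->
  \int[P]_t f t <= \int[P]_t g t.
Proof. by move=> bf bg fg; apply: le_Rintegral => //; exact: bmeas_integrable. Qed.

Lemma Rintegral_indic (A : set T) : measurable A ->
  \int[P]_t (\1_A t : R) = fine (P A).
Proof. by move=> mA; rewrite /Rintegral integral_indic// setIT. Qed.

Lemma bmarkov f (A : set T) (a : R) : measurable A -> bmeas f ->
  (forall t, 0 <= f t) -> 0 < a -> (forall t, A t -> a <= f t) ->
  fine (P A) <= a^-1 * \int[P]_t f t.
Proof.
move=> mA bf f0 a0 Af.
rewrite -Rintegral_indic// -bRintegralZl//; apply: le_bRintegral.
- exact: bmeas_indic.
- by apply: bmeasM => //; exact: bmeas_cst.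
- move=> t; rewrite indicE; case: (boolP (t \in _)) => [|_].
    by rewrite inE => /Af; rewrite mulrC ler_pdivlMr ?mul1r.
  by rewrite mulr_ge0// invr_ge0 ltW.
Qed.

End BoundedIntegral.

(** * Independence of sigma-algebras and freezing of one argument *)

Section Independence.
Context {R : realType} {d} {T : measurableType d} (P : probability T R).

Definition indep2 (G1 G2 : set (set T)) : Prop :=
  forall A B, G1 A -> G2 B -> P (A `&` B) = (P A * P B)%E.

(** Dynkin's argument: for fixed [A], the events [B] on which the product rule holds form a
    lambda-system; it contains the pi-system [H], hence the sigma-algebra that [H] generates. *)
Lemma indep2_sigma (G H : set (set T)) :
  G `<=` measurable -> H `<=` measurable -> setI_closed H ->
  indep2 G H -> indep2 G <<s H>>.
Proof.
move=> Gm Hm HI GH A B GA.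
pose L := [set B | measurable B /\ P (A `&` B) = (P A * P B)%E].
have mA := Gm _ GA.
suff : <<s H>> `<=` L by move=> + sB => /(_ _ sB)[].
apply: (lambda_system_subset HI) => //; last first.
  by move=> C HC; split; [exact: Hm | exact: GH].
split.
- by [].
- by split => //; rewrite setIT (probability_setT P) mule1.
- move=> C D DC [mC AC] [mD AD]; split; first exact: measurableD.
  have fP E : measurable E -> P E \is a fin_num by exact: fin_num_measure.
  have -> : A `&` (C `\` D) = (A `&` C) `\` (A `&` D).
    by apply/seteqP; split=> t /=; [tauto|move=> [[At Ct] nD]; tauto].
  have mAC : measurable (A `&` C) by exact: measurableI.
  have mAD : measurable (A `&` D) by exact: measurableI.
  have fAC : (P (A `&` C) < +oo)%E by rewrite ltey_eq fP.
  have fC : (P C < +oo)%E by rewrite ltey_eq fP.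
  rewrite (measureD mAC mAD fAC) (measureD mC mD fC).
  have -> : A `&` C `&` (A `&` D) = A `&` D.
    by apply/seteqP; split=> t /=; [tauto|move=> [At Dt]; have := DC _ Dt; tauto].
  have -> : C `&` D = D by apply/setIidPr.
  rewrite muleBr; [|exact: fP|by apply: fin_num_adde_defr; exact: fP].
  by congr (_ - _)%E; [exact: AC|exact: AD].
move=> F ndF LF.
have mF n : measurable (F n) by have [] := LF n.
have mU : measurable (\bigcup_n F n) by exact: bigcupT_measurable.
split => //; rewrite setI_bigcupr.
have c1 := nondecreasing_cvg_mu (mu := P) mF mU ndF.
have c2 : P \o (fun n => A `&` F n) @ \oo --> P (\bigcup_n (A `&` F n)).
  apply: nondecreasing_cvg_mu => [n||m n mn].
  - exact: measurableI.
  - by apply: bigcupT_measurable => n; exact: measurableI.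
  - by apply/subsetPset; apply: setIS; apply/subsetPset; exact: ndF.
apply/esym; apply: (cvg_unique _ _ c2) => //.
rewrite (_ : P \o _ = (fun n => P A * P (F n))%E); last first.
  by apply/funext => n /=; have [] := LF n.
by apply: cvgeZl => //; exact: fin_num_measure.
Qed.

Lemma mindep_setI (I : finType) (G : I -> set (set T)) (J : {set I}) (A : I -> set T) :
  (forall i, G i `<=` measurable) -> mindep P G ->
  (forall i, i \in J -> G i (A i)) ->
  P [set t | forall i, i \in J -> A i t] = (\prod_(i in J) P (A i))%E.
Proof.
move=> Gm GP GA.
have mA i : i \in J -> measurable (A i) by move=> /GA/Gm.
have mJ : measurable [set t | forall i, i \in J -> A i t].
  rewrite (_ : mkset _ = \bigcap_(i in [set` J]) A i)//.
  by apply: fin_bigcap_measurable.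
have fP E : measurable E -> P E \is a fin_num by exact: fin_num_measure.
rewrite -[LHS]fineK ?fP// GP//.
have {GA GP mJ}: forall r : seq I, (forall i, i \in r -> i \in J) ->
   ((\prod_(i <- r) fine (P (A i)))%:E = \prod_(i <- r) P (A i))%E.
  elim=> [|i r IH] rJ; first by rewrite !big_nil.
  rewrite !big_cons EFinM IH ?fineK ?fP//.
    by apply: mA; apply: rJ; rewrite mem_head.
  by move=> k kr; apply: rJ; rewrite in_cons kr orbT.
move=> /(_ (enum J)); rewrite !big_enum; apply => i; by rewrite mem_enum.
Qed.

(** The pi-system consists of the intersections of one event of [G j] for each [j] in [J]; on it,
    independence from [G i] is [mindep] for the index set [i |: J]. *)
Lemma mindep_group (I : finType) (G : I -> set (set T)) (J : {set I}) (i : I) :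
  (forall i, sigma_algebra setT (G i)) -> (forall i, G i `<=` measurable) ->
  mindep P G -> i \notin J ->
  indep2 (G i) <<s [set A | exists2 j, j \in J & G j A]>>.
Proof.
move=> Gs Gm GP iJ.
pose H := [set B | exists2 C : I -> set T, (forall j, j \in J -> G j (C j)) &
  B = [set t | forall j, j \in J -> C j t]].
have GI k : setI_closed (G k).
  move=> A B GA GB; have := Gs k; rewrite -(measurable_g_measurableTypeE (Gs k)) => _.
  apply: (@measurableI _ (g_sigma_algebraType (G k))); by rewrite measurable_g_measurableTypeE.
have GT k : G k setT.
  rewrite -(measurable_g_measurableTypeE (Gs k)).
  exact: (@measurableT _ (g_sigma_algebraType (G k))).
have Hm : H `<=` measurable.
  move=> _ [C GC ->].
  rewrite (_ : mkset _ = \bigcap_(i in [set` J]) C i)//.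
  by apply: fin_bigcap_measurable => // k /= /GC; exact: Gm.
have HI : setI_closed H.
  move=> _ _ [C GC ->] [D GD ->]; exists (fun j => C j `&` D j).
    by move=> j jJ; apply: GI; [exact: GC|exact: GD].
  apply/seteqP; split => t /=.
    by move=> [Ct Dt] j jJ; split; [exact: Ct|exact: Dt].
  by move=> CDt; split => j jJ; have [] := CDt j jJ.
have GH : indep2 (G i) <<s H>>.
  apply: indep2_sigma => //.
  move=> A _ GA [C GC ->].
  pose C' j := if j == i then A else C j.
  have C'j j : j \in J -> C' j = C j.
    by rewrite /C'; case: eqP => // -> ji; rewrite ji in iJ.
  have GC' j : j \in (i |: J) -> G j (C' j).
    rewrite in_setU1 /C'; case: eqP => [->//|_ /=]; exact: GC.
  rewrite [X in P X](_ : _ = [set t | forall j, j \in (i |: J) -> C' j t]); last first.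
    apply/seteqP; split => t /=.
      move=> [At Ct] j; rewrite in_setU1 /C'; case: eqP => //= _; exact: Ct.
    move=> h; split; first by have := h i (setU11 _ _); rewrite /C' eqxx.
    by move=> j jJ; have := h j (setU1r _ jJ); rewrite C'j.
  rewrite (mindep_setI Gm GP GC') (mindep_setI Gm GP GC) big_setU1//=.
  by rewrite {1}/C' eqxx; congr (_ * _)%E; apply: eq_bigr => j jJ; rewrite C'j.
move=> A B GA sB; apply: GH GA _; move: B sB; apply: sub_sigma_algebra2.
(* A single event of [G j] is such an intersection, with the full space at the other indices. *)
move=> B [j jJ GB]; exists (fun k => if k == j then B else setT).
  by move=> k kJ; case: eqP => [->//|_].
apply/seteqP; split => t /=; first by move=> Bt k _; case: eqP.
by move=> /(_ j jJ); rewrite eqxx.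
Qed.

Section Decoupling.
Variables G1 G2 : set (set T).
Hypothesis mG1 : <<s G1>> `<=` measurable.
Hypothesis mG2 : <<s G2>> `<=` measurable.
Hypothesis G12 : indep2 <<s G1>> <<s G2>>.
Let T1 := g_sigma_algebraType G1.
Let T2 := g_sigma_algebraType G2.

Let id1 : T -> T1 := idfun.
Let id2 : T -> T2 := idfun.
Let mid1 : measurable_fun setT id1.
Proof. by move=> _ A mA; rewrite setTI; exact: mG1. Qed.
Let mid2 : measurable_fun setT id2.
Proof. by move=> _ A mA; rewrite setTI; exact: mG2. Qed.
Let diag : T -> T1 * T2 := fun t => (t, t).
Let mdiag : measurable_fun setT diag.
Proof. exact: (measurable_fun_pair mid1 mid2). Qed.

Let X1 : {mfun T >-> T1} := mfun_Sub (mem_set mid1).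
Let X2 : {mfun T >-> T2} := mfun_Sub (mem_set mid2).
Let XX : {mfun T >-> (T1 * T2)%type} := mfun_Sub (mem_set mdiag).

Local Open Scope ereal_scope.

(** [T1] and [T2] are [T] itself with smaller sigma-algebras, and independence says that the law of
    the diagonal map into [T1 * T2] is the product of its marginals. Tonelli's theorem then replaces
    [(t, t)] by two independent arguments. *)
Lemma ge0_integral_decouple (f : T1 * T2 -> \bar R) :
  measurable_fun setT f -> (forall u, 0 <= f u) ->
  \int[P]_t f (t, t) = \int[P]_t2 \int[P]_t1 f (t1, t2).
Proof.
move=> mf f0.
have -> : \int[P]_t f (t, t) = \int[distribution P XX]_u f u.
  by rewrite ge0_integral_distribution.
have -> : \int[distribution P XX]_u f u =
          \int[distribution P X1 \x distribution P X2]_u f u.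
  apply: eq_measure_integral => A mA _.
  by apply/esym; apply: product_measure_unique.
rewrite fubini_tonelli2// ge0_integral_distribution//; last first.
- by move=> y; apply: integral_ge0.
- exact: measurable_fun_fubini_tonelli_G.
apply: eq_integral => t2 _; rewrite /= /fubini_G ge0_integral_distribution//.
exact: measurableT_comp.
Qed.

Local Close Scope ereal_scope.

Lemma decouple_le (f g : T1 * T2 -> R) :
  bmeas f -> bmeas g ->
  (forall t2, \int[P]_t1 f (t1, t2) <= \int[P]_t1 g (t1, t2)) ->
  \int[P]_t f (t, t) <= \int[P]_t g (t, t).
Proof.
move=> bf bg fg.
have bslice (h : T1 * T2 -> R) t2 : bmeas h -> bmeas (fun t1 : T => h (t1, t2)).
  move=> [mh [M hM]]; split; last by exists M.
  apply: (@measurableT_comp _ _ _ _ _ _ (fun t1 : T1 => h (t1, t2)) _ id1) => //.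
  exact: measurableT_comp.
have bdiag (h : T1 * T2 -> R) : bmeas h -> bmeas (fun t : T => h (t, t)).
  move=> [mh [M hM]]; split; last by exists M.
  exact: (@measurableT_comp _ _ _ _ _ _ h _ diag).
(* After a shift by a common bound [M] both functions are nonnegative, as Tonelli's theorem asks. *)
have [M [M0 [fM gM]]] : exists M : R, 0 <= M /\ (forall u, - M <= f u) /\ (forall u, - M <= g u).
  have [_ [M fM]] := bf; have [_ [N gN]] := bg.
  exists (`|M| + `|N|); split; first by rewrite addr_ge0.
  split=> u; rewrite lerNl; apply: le_trans (ler_norm _) _; rewrite normrN.
    apply: le_trans (fM u) _; apply: le_trans (ler_norm _) _; by rewrite lerDl.
  apply: le_trans (gN u) _; apply: le_trans (ler_norm _) _; by rewrite lerDr.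
have eM (k : T -> R) : bmeas k -> ((\int[P]_t k t + M)%:E = \int[P]_t (k t + M)%:E)%E.
  move=> bk; rewrite -[X in _ + X](probability_Rintegral_cst P M) -bRintegralD//; last first.
    exact: bmeas_cst.
  rewrite /Rintegral fineK//; apply: integrable_fin_num => //.
  by apply: bmeas_integrable; apply: bmeasD => //; exact: bmeas_cst.
have key (h : T1 * T2 -> R) : bmeas h -> (forall u, - M <= h u) ->
    (\int[P]_t h (t, t) + M)%:E =
    (\int[P]_t2 (\int[P]_t1 h (t1, t2) + M)%:E)%E.
  move=> bh hM; have bhM : bmeas (fun u => h u + M) by apply: bmeasD => //; exact: bmeas_cst.
  rewrite eM; last exact: bdiag.
  have := @ge0_integral_decouple (fun u => (h u + M)%:E).
  move=> /= ->.
  - by apply: eq_integral => t2 _; rewrite eM//; exact: bslice.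
  - by apply/measurable_EFinP; have [] := bhM.
  - by move=> u; rewrite lee_fin -lerBlDr sub0r.
rewrite -(lerD2r M) -lee_fin (key f)// (key g)//.
have mint (h : T1 * T2 -> R) : bmeas h -> (forall u, - M <= h u) ->
   measurable_fun [set: T] (fun t2 : T => (\int[P]_t1 h (t1, t2) + M)%:E).
  move=> bh hM.
  have mhM : measurable_fun setT (fun u => (h u + M)%:E).
    apply/measurable_EFinP; have [] := bmeasD bh (bmeas_cst M); by [].
  have := @measurable_fun_fubini_tonelli_G _ _ _ _ R (distribution P X1) _ mhM.
  have hM0 (u : T1 * T2) : (0 <= (h u + M)%:E)%E by rewrite lee_fin -lerBlDr sub0r.
  move=> /(_ hM0) mG.
  apply: (eq_measurable_fun (fubini_G (distribution P X1) (fun u => (h u + M)%:E) \o id2)).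
    move=> t2 _ /=; rewrite eM//; last exact: bslice.
    rewrite /fubini_G ge0_integral_distribution//.
    have mh1 : measurable_fun [set: T1] (fun t1 : T1 => h (t1, id2 t2)).
      by have [mh _] := bh; exact: measurableT_comp.
    by apply/measurable_EFinP; exact: (measurable_funD mh1 (measurable_cst M)).
  exact: (@measurable_comp _ _ _ T T2 _ setT _ _ id2).
apply: ge0_le_integral => //.
- move=> t2 _; rewrite lee_fin -lerBlDr sub0r -(probability_Rintegral_cst P (- M)).
  apply: le_bRintegral => //; [exact: bmeas_cst|exact: bslice].
- exact: mint.
- exact: mint.
- by move=> t2 _; rewrite lee_fin lerD2r.
Qed.
End Decoupling.

End Independence.

(** * Complex matrices *)

Section ComplexParts.
Context {R : realType}.
Implicit Types z w : R[i].
Local Notation Re := (@complex.Re R).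
Local Notation Im := (@complex.Im R).

Lemma cReD z w : Re (z + w) = Re z + Re w. Proof. by case: z; case: w. Qed.
Lemma cImD z w : Im (z + w) = Im z + Im w. Proof. by case: z; case: w. Qed.
Lemma cReN z : Re (- z) = - Re z. Proof. by case: z. Qed.
Lemma cImN z : Im (- z) = - Im z. Proof. by case: z. Qed.
Lemma cReM z w : Re (z * w) = Re z * Re w - Im z * Im w.
Proof. by case: z; case: w. Qed.
Lemma cImM z w : Im (z * w) = Re z * Im w + Im z * Re w.
Proof. by case: z; case: w => a b c d /=; rewrite addrC [d * a]mulrC addrC mulrC. Qed.
Lemma cReJ z : Re (conjc z) = Re z. Proof. by case: z. Qed.
Lemma cImJ z : Im (conjc z) = - Im z. Proof. by case: z. Qed.

Lemma cRe_sum (I : Type) (r : seq I) (Q : pred I) (F : I -> R[i]) :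
  Re (\sum_(i <- r | Q i) F i) = \sum_(i <- r | Q i) Re (F i).
Proof. by apply: (big_morph Re cReD). Qed.
Lemma cIm_sum (I : Type) (r : seq I) (Q : pred I) (F : I -> R[i]) :
  Im (\sum_(i <- r | Q i) F i) = \sum_(i <- r | Q i) Im (F i).
Proof. by apply: (big_morph Im cImD). Qed.

Lemma complex_eq z w : Re z = Re w -> Im z = Im w -> z = w.
Proof. by case: z; case: w => ? ? ? ? /= -> ->. Qed.

End ComplexParts.

Section HilbertSchmidt.
Context {R : realType}.
Local Notation C := R[i].
Local Notation Re := (@complex.Re R).
Local Notation Im := (@complex.Im R).

Lemma adjmxE p q (A : 'M[C]_(p, q)) i j : adjmx A i j = conjc (A j i).
Proof. by rewrite /adjmx !mxE. Qed.

Lemma adjmxK p q (A : 'M[C]_(p, q)) : adjmx (adjmx A) = A.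
Proof. by apply/matrixP => i j; rewrite !adjmxE conjcK. Qed.

Lemma adjmx_mul p q r (A : 'M[C]_(p, q)) (B : 'M[C]_(q, r)) :
  adjmx (A *m B) = adjmx B *m adjmx A.
Proof. by rewrite /adjmx map_mxM trmx_mul. Qed.

Lemma adjmxD p q (A B : 'M[C]_(p, q)) : adjmx (A + B) = adjmx A + adjmx B.
Proof. by apply/matrixP => i j; rewrite !(adjmxE, mxE) rmorphD. Qed.

Lemma adjmxN p q (A : 'M[C]_(p, q)) : adjmx (- A) = - adjmx A.
Proof. by apply/matrixP => i j; rewrite !(adjmxE, mxE) rmorphN. Qed.

Lemma adjmxB p q (A B : 'M[C]_(p, q)) : adjmx (A - B) = adjmx A - adjmx B.
Proof. by rewrite adjmxD adjmxN. Qed.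

Lemma adjmx_sum p q (I : Type) (r : seq I) (Q : pred I) (F : I -> 'M[C]_(p, q)) :
  adjmx (\sum_(i <- r | Q i) F i) = \sum_(i <- r | Q i) adjmx (F i).
Proof.
apply: (big_morph _ (@adjmxD _ _)); apply/matrixP => i j.
by rewrite adjmxE !mxE rmorph0.
Qed.

Lemma adjmxZ p q (a : R) (A : 'M[C]_(p, q)) : adjmx (a%:C%C *: A) = a%:C%C *: adjmx A.
Proof. by apply/matrixP => i j; rewrite !(adjmxE, mxE) rmorphM /= oppr0. Qed.

Lemma adjmx1 n : adjmx (1%:M : 'M[C]_n) = 1%:M.
Proof. by rewrite /adjmx map_mx1 trmx1. Qed.

Definition hermmx n (A : 'M[C]_n) : Prop := adjmx A = A.

Fixpoint mxpow n (A : 'M[C]_n) k : 'M[C]_n :=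
  if k is k'.+1 then A *m mxpow A k' else 1%:M.

Arguments mxpow : simpl never.

Lemma mxpow0 n (A : 'M[C]_n) : mxpow A 0 = 1%:M. Proof. by []. Qed.

Lemma mxpowS n (A : 'M[C]_n) k : mxpow A k.+1 = A *m mxpow A k.
Proof. by []. Qed.

Lemma mxpowD n (A : 'M[C]_n) k l : mxpow A (k + l) = mxpow A k *m mxpow A l.
Proof. by elim: k => [|k IH]; rewrite ?mul1mx// addSn !mxpowS -mulmxA -IH. Qed.

Lemma mxpowSr n (A : 'M[C]_n) k : mxpow A k.+1 = mxpow A k *m A.
Proof. by rewrite -addn1 mxpowD mxpowS mxpow0 mulmx1. Qed.

Lemma hermmx_pow n (A : 'M[C]_n) k : hermmx A -> hermmx (mxpow A k).
Proof.
rewrite /hermmx => hA; elim: k => [|k IH]; first by rewrite adjmx1.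
by rewrite {1}mxpowS adjmx_mul hA IH mxpowSr.
Qed.

Lemma hermmxD n (A B : 'M[C]_n) : hermmx A -> hermmx B -> hermmx (A + B).
Proof. by rewrite /hermmx adjmxD => -> ->. Qed.

Lemma hermmxB n (A B : 'M[C]_n) : hermmx A -> hermmx B -> hermmx (A - B).
Proof. by rewrite /hermmx adjmxB => -> ->. Qed.

Lemma hermmx_sum n (I : Type) (r : seq I) (Q : pred I) (F : I -> 'M[C]_n) :
  (forall i, hermmx (F i)) -> hermmx (\sum_(i <- r | Q i) F i).
Proof. by move=> hF; rewrite /hermmx adjmx_sum; apply: eq_bigr => i _; exact: hF. Qed.

Lemma hermmx_gram p n (A : 'M[C]_(p, n)) : hermmx (adjmx A *m A).
Proof. by rewrite /hermmx adjmx_mul adjmxK. Qed.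

Definition retr n (A : 'M[C]_n) : R := Re (\tr A).

(** Real part of the Hilbert-Schmidt inner product, see [rdotE]; [nsq] below is the squared norm
    that belongs to it. *)
Definition rdot p q (A B : 'M[C]_(p, q)) : R :=
  \sum_i \sum_j (Re (A i j) * Re (B i j) + Im (A i j) * Im (B i j)).

Definition nsq p q (A : 'M[C]_(p, q)) : R :=
  \sum_i \sum_j (Re (A i j) ^+ 2 + Im (A i j) ^+ 2).

Lemma retrE n (A : 'M[C]_n) : retr A = \sum_i Re (A i i).
Proof. by rewrite /retr /mxtrace cRe_sum. Qed.

Lemma retrD n (A B : 'M[C]_n) : retr (A + B) = retr A + retr B.
Proof. by rewrite /retr mxtraceD cReD. Qed.

Lemma retrN n (A : 'M[C]_n) : retr (- A) = - retr A.
Proof. by rewrite !retrE -sumrN; apply: eq_bigr => i _; rewrite mxE cReN. Qed.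

Lemma retrB n (A B : 'M[C]_n) : retr (A - B) = retr A - retr B.
Proof. by rewrite retrD retrN. Qed.

Lemma retr_sum n (I : Type) (r : seq I) (Q : pred I) (F : I -> 'M[C]_n) :
  retr (\sum_(i <- r | Q i) F i) = \sum_(i <- r | Q i) retr (F i).
Proof.
apply: (big_morph _ (@retrD n)).
by rewrite retrE big1// => i _; rewrite mxE.
Qed.

Lemma retr_mulC p q (A : 'M[C]_(p, q)) (B : 'M[C]_(q, p)) :
  retr (A *m B) = retr (B *m A).
Proof. by rewrite /retr mxtrace_mulC. Qed.

Lemma rdotE p q (A B : 'M[C]_(p, q)) : rdot A B = retr (adjmx A *m B).
Proof.
rewrite retrE /rdot exchange_big /=; apply: eq_bigr => j _.
rewrite mxE cRe_sum; apply: eq_bigr => i _.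
by rewrite adjmxE cReM cReJ cImJ mulNr opprK.
Qed.

Lemma rdot_nsq p q (A : 'M[C]_(p, q)) : rdot A A = nsq A.
Proof. by apply: eq_bigr => i _; apply: eq_bigr => j _; rewrite !expr2. Qed.

Lemma nsq_retr p q (A : 'M[C]_(p, q)) : nsq A = retr (adjmx A *m A).
Proof. by rewrite -rdot_nsq rdotE. Qed.

Lemma rdotC p q (A B : 'M[C]_(p, q)) : rdot A B = rdot B A.
Proof. by apply: eq_bigr => i _; apply: eq_bigr => j _; congr (_ + _); rewrite mulrC. Qed.

Lemma rdotDl p q (A B D : 'M[C]_(p, q)) : rdot (A + B) D = rdot A D + rdot B D.
Proof.
rewrite /rdot -big_split; apply: eq_bigr => i _; rewrite -big_split.
by apply: eq_bigr => j _; rewrite mxE cReD cImD /=; ring.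
Qed.

Lemma rdotDr p q (A B D : 'M[C]_(p, q)) : rdot D (A + B) = rdot D A + rdot D B.
Proof. by rewrite rdotC rdotDl !(rdotC D). Qed.

Lemma rdotNl p q (A D : 'M[C]_(p, q)) : rdot (- A) D = - rdot A D.
Proof.
rewrite /rdot -sumrN; apply: eq_bigr => i _; rewrite -sumrN.
by apply: eq_bigr => j _; rewrite mxE cReN cImN /=; ring.
Qed.

Lemma rdotNr p q (A D : 'M[C]_(p, q)) : rdot D (- A) = - rdot D A.
Proof. by rewrite rdotC rdotNl rdotC. Qed.

Lemma rdotZl p q (a : R) (A D : 'M[C]_(p, q)) : rdot (a%:C%C *: A) D = a * rdot A D.
Proof.
rewrite /rdot mulr_sumr; apply: eq_bigr => i _; rewrite mulr_sumr.
by apply: eq_bigr => j _; rewrite mxE cReM cImM /=; ring.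
Qed.

Lemma nsq_ge0 p q (A : 'M[C]_(p, q)) : 0 <= nsq A.
Proof.
by apply: sumr_ge0 => i _; apply: sumr_ge0 => j _; rewrite addr_ge0// sqr_ge0.
Qed.

Lemma nsqD p q (A B : 'M[C]_(p, q)) : nsq (A + B) = nsq A + 2 * rdot A B + nsq B.
Proof. by rewrite -!rdot_nsq rdotDl !rdotDr (rdotC B A); ring. Qed.

Lemma nsqB p q (A B : 'M[C]_(p, q)) : nsq (A - B) = nsq A - 2 * rdot A B + nsq B.
Proof. by rewrite nsqD rdotNr -(rdot_nsq (- B)) rdotNr rdotNl opprK rdot_nsq; ring. Qed.

Lemma rdot_le_avg p q (A B : 'M[C]_(p, q)) : 2 * rdot A B <= nsq A + nsq B.
Proof. by have := nsq_ge0 (A - B); rewrite nsqB; lra. Qed.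

Lemma nsqB_le p q (A B : 'M[C]_(p, q)) : nsq (A - B) <= 2 * nsq A + 2 * nsq B.
Proof. by have := nsq_ge0 (A + B); rewrite nsqD nsqB; lra. Qed.

Lemma nsqZ p q (a : R) (A : 'M[C]_(p, q)) : nsq (a%:C%C *: A) = a ^+ 2 * nsq A.
Proof. by rewrite -!rdot_nsq rdotZl rdotC rdotZl; ring. Qed.

Lemma rdot_cauchy p q (A B : 'M[C]_(p, q)) : rdot A B ^+ 2 <= nsq A * nsq B.
Proof.
have [B0|B0] := eqVneq (nsq B) 0.
  have h (t : R) : 0 <= nsq A + t * 2 * rdot A B.
    have := nsq_ge0 (A + t%:C%C *: B).
    by rewrite nsqD rdotC rdotZl (rdotC B) nsqZ B0; lra.
  have -> : rdot A B = 0; last by rewrite B0 mulr0 expr0n.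
  apply/eqP; rewrite -sqrf_eq0; apply/eqP.
  have [//|r0] := eqVneq (rdot A B ^+ 2) 0.
  (* A [t] at which the affine function in [h] would take the value [-1]. *)
  have := h (- (nsq A + 1) / (2 * rdot A B)).
  have r1 : rdot A B != 0 by move: r0; rewrite sqrf_eq0.
  have -> : - (nsq A + 1) / (2 * rdot A B) * 2 * rdot A B = - (nsq A + 1) by field.
  lra.
have B1 : 0 < nsq B by rewrite lt_def B0 nsq_ge0.
(* This factor minimises the quadratic [t |-> nsq (A + t B)]. *)
have := nsq_ge0 (A + (- rdot A B / nsq B)%:C%C *: B).
rewrite nsqD rdotC rdotZl (rdotC B) nsqZ.
have -> : nsq A + 2 * (- rdot A B / nsq B * rdot A B) +
  (- rdot A B / nsq B) ^+ 2 * nsq B = (nsq A * nsq B - rdot A B ^+ 2) / nsq B by field.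
by rewrite pmulr_lge0 ?invr_gt0// subr_ge0.
Qed.

Lemma nsq_adj p q (A : 'M[C]_(p, q)) : nsq (adjmx A) = nsq A.
Proof. by rewrite !nsq_retr adjmxK retr_mulC. Qed.

Lemma rdotMl p q r (M : 'M[C]_(p, q)) (A : 'M[C]_(q, r)) B :
  rdot (M *m A) B = rdot A (adjmx M *m B).
Proof. by rewrite !rdotE adjmx_mul mulmxA. Qed.

Lemma nsq_col p q (A : 'M[C]_(p, q)) : nsq A = \sum_j nsq (col j A).
Proof.
rewrite /nsq exchange_big /=; apply: eq_bigr => j _; apply: eq_bigr => i _.
by rewrite big_ord1 !mxE.
Qed.

Lemma nsq_isometry p q r (U : 'M[C]_(p, q)) (A : 'M[C]_(q, r)) :
  adjmx U *m U = 1%:M -> nsq (U *m A) = nsq A.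
Proof. by move=> UU; rewrite -!rdot_nsq rdotMl mulmxA UU mul1mx. Qed.

(** [K] bounds the square of the operator norm: the condition is [M^* M <= K] as quadratic forms. *)
Definition opbound p q (M : 'M[C]_(p, q)) (K : R) : Prop :=
  forall v : 'cV[C]_q, nsq (M *m v) <= K * nsq v.

Lemma opbound_mx p q r (M : 'M[C]_(p, q)) (K : R) (A : 'M[C]_(q, r)) :
  opbound M K -> nsq (M *m A) <= K * nsq A.
Proof.
move=> MK; rewrite !nsq_col mulr_sumr; apply: ler_sum => j _.
by rewrite colE -mulmxA -colE; exact: MK.
Qed.

(** [|M^* v|^2 = <v, M M^* v>]; by Cauchy-Schwarz its square is at most [|v|^2 K |M^* v|^2], and one
    factor [|M^* v|^2] cancels. *)
Lemma opbound_adj p q (M : 'M[C]_(p, q)) K : 0 <= K -> opbound M K -> opbound (adjmx M) K.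
Proof.
move=> K0 MK v; set a := nsq _.
have aE : a = rdot v (M *m (adjmx M *m v)) by rewrite /a -rdot_nsq rdotMl adjmxK.
have : a ^+ 2 <= nsq v * (K * a).
  rewrite {1}aE; apply: le_trans (rdot_cauchy _ _) _.
  by apply: ler_wpM2l; [exact: nsq_ge0|exact: MK].
have a0 : 0 <= a := nsq_ge0 _.
have [->|an0] := eqVneq a 0; first by rewrite mulr_ge0// nsq_ge0.
by rewrite expr2 mulrCA mulrA ler_pM2r ?(mulrC K)// lt_def an0.
Qed.

(** The matrix inequality [X^2 <= K X] for [X = M^* M], in the form that lowers the degree in [X]
    under a trace. *)
Lemma nsq_gram_mul p q r (M : 'M[C]_(p, q)) (K : R) (A : 'M[C]_(q, r)) :
  0 <= K -> opbound M K -> nsq (adjmx M *m M *m A) <= K * nsq (M *m A).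
Proof. by move=> K0 MK; rewrite -mulmxA; apply/opbound_mx/opbound_adj. Qed.

Lemma mxpow_sub n (A B : 'M[C]_n) k :
  mxpow A k.+1 - mxpow B k.+1 =
  \sum_(j < k.+1) mxpow A (k - j) *m (A - B) *m mxpow B j.
Proof.
elim: k => [|k IH]; first by rewrite big_ord1 subnn !mxpowS !mxpow0 mul1mx !mulmx1.
rewrite big_ord_recr /= subnn mxpow0 mul1mx.
rewrite (eq_bigr (fun j : 'I_k.+1 => A *m (mxpow A (k - j) *m (A - B) *m mxpow B j))).
  by rewrite -mulmx_sumr -IH mulmxBr mulmxBl -!mxpowS addrA subrK.
by move=> j _; rewrite subSn -1?ltnS// mxpowS !mulmxA.
Qed.

End HilbertSchmidt.

(** * Spectral estimates for Hermitian matrices *)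

Section Spectral.
Context {R : realType}.
Local Notation C := R[i].
Variable n : nat.
Implicit Types (D Y Z : 'M[C]_n).

Definition rdiag (l : 'I_n -> R) : 'M[C]_n := diag_mx (\row_i (l i)%:C%C).

Lemma hermmx_spectral Y : hermmx Y -> exists (U : 'M[C]_n) (l : 'I_n -> R),
  [/\ adjmx U *m U = 1%:M, U *m adjmx U = 1%:M & Y = adjmx U *m rdiag l *m U].
Proof.
move=> hY.
have Yh : Y \is hermsymmx.
  apply/is_hermitianmxP; rewrite expr0 scale1r -[LHS]hY.
  by apply/matrixP => i j; rewrite !mxE.
have Yr := hermitian_spectral_diag_real Yh.
have := orthomx_spectralP (hermitian_normalmx Yh).
set U := spectralmx Y => YE.
have UU : U \is unitarymx by exact: spectral_unitarymx.
have adjU : invmx U = adjmx U.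
  by rewrite invmx_unitary//; apply/matrixP => i j; rewrite !mxE.
have Uu := unitarymx_unit UU.
exists U, (fun i => complex.Re (spectral_diag Y 0 i)); split.
- by rewrite -adjU mulVmx.
- by rewrite -adjU mulmxV.
- rewrite -adjU {1}YE; congr (_ *m diag_mx _ *m _).
  apply/rowP => i; rewrite !mxE; apply/esym/RRe_real.
  by move/mxOverP : Yr; apply.
Qed.

Lemma rdiag_pow l k : mxpow (rdiag l) k = rdiag (fun i => l i ^+ k).
Proof.
elim: k => [|k IH].
  rewrite mxpow0 /rdiag -diag_const_mx; congr diag_mx.
  by apply/rowP => i; rewrite !mxE.
rewrite mxpowS IH /rdiag mulmx_diag; congr diag_mx.
by apply/rowP => i; rewrite !mxE exprS rmorphM.
Qed.

Lemma unitary_conj_pow (U D : 'M[C]_n) k : U *m adjmx U = 1%:M -> adjmx U *m U = 1%:M ->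
  mxpow (adjmx U *m D *m U) k = adjmx U *m mxpow D k *m U.
Proof.
move=> U1 U2; elim: k => [|k IH]; first by rewrite !mxpow0 mulmx1.
rewrite !mxpowS IH !mulmxA; congr (_ *m _ *m _).
by rewrite -mulmxA U1 mulmx1.
Qed.

Lemma mulmx_rdiagE p l (A : 'M[C]_(p, n)) i j : (A *m rdiag l) i j = A i j * (l j)%:C%C.
Proof. by rewrite mul_mx_diag !mxE. Qed.

Lemma nsq_rdiag_mul q l (A : 'M[C]_(n, q)) :
  nsq (rdiag l *m A) = \sum_i \sum_j l i ^+ 2 * (complex.Re (A i j) ^+ 2 + complex.Im (A i j) ^+ 2).
Proof.
apply: eq_bigr => i _; apply: eq_bigr => j _.
by rewrite mul_diag_mx !mxE cReM cImM /= !mul0r subr0 addr0 !exprMn mulrDr.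
Qed.

(** The left side is at most the larger of [|a|] and [|b|] to the power [2 N]. *)
Lemma powers_mix (a b : R) j k N : (j + k = N + N)%N ->
  a ^+ j * b ^+ k <= (a ^+ N) ^+ 2 + (b ^+ N) ^+ 2.
Proof.
move=> jk.
apply: (@le_trans _ _ (`|a| ^+ j * `|b| ^+ k)).
  by apply: le_trans (ler_norm _) _; rewrite normrM !normrX.
have E (x : R) : (x ^+ N) ^+ 2 = `|x| ^+ (j + k).
  by rewrite jk -[LHS]real_normK ?num_real// normrX -exprM muln2 addnn.
rewrite !E !exprD.
have [ab|/ltW ab] := leP `|a| `|b|.
  apply: (@le_trans _ _ (`|b| ^+ j * `|b| ^+ k)).
    by rewrite ler_wpM2r ?exprn_ge0// lerXn2r ?nnegrE.
  by rewrite lerDr mulr_ge0 ?exprn_ge0.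
apply: (@le_trans _ _ (`|a| ^+ j * `|a| ^+ k)).
  by rewrite ler_wpM2l ?exprn_ge0// lerXn2r ?nnegrE.
by rewrite lerDl mulr_ge0 ?exprn_ge0.
Qed.

(* In eigenbases of Y and Z, with E the matrix of D in these bases, both sides are
   weighted sums of the |E a b|^2, and the weights compare by [powers_mix]. *)
Lemma retr_mixed_powers D Y Z j k N : hermmx D -> hermmx Y -> hermmx Z ->
  (j + k = N + N)%N ->
  retr (D *m mxpow Y j *m D *m mxpow Z k) <= nsq (mxpow Y N *m D) + nsq (mxpow Z N *m D).
Proof.
move=> hD hY hZ jk.
have [U [l [U1 U2 YE]]] := hermmx_spectral hY.
have [V [r [V1 V2 ZE]]] := hermmx_spectral hZ.
pose E := V *m D *m adjmx U.
have aE : adjmx E = U *m D *m adjmx V by rewrite /E !adjmx_mul adjmxK hD mulmxA.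
have -> : nsq (mxpow Y N *m D) = \sum_i \sum_j (l i ^+ N) ^+ 2 *
    (complex.Re (E j i) ^+ 2 + complex.Im (E j i) ^+ 2).
  rewrite {1}YE unitary_conj_pow// rdiag_pow -!mulmxA nsq_isometry ?adjmxK//.
  rewrite -nsq_adj adjmx_mul -(@nsq_isometry _ _ _ _ V)// mulmxA adjmx_mul hD mulmxA.
  rewrite -/E -nsq_adj adjmx_mul adjmxK nsq_rdiag_mul.
  apply: eq_bigr => i _; apply: eq_bigr => b _.
  by rewrite adjmxE cReJ cImJ sqrrN.
have -> : nsq (mxpow Z N *m D) = \sum_i \sum_j (r j ^+ N) ^+ 2 *
    (complex.Re (E j i) ^+ 2 + complex.Im (E j i) ^+ 2).
  rewrite {1}ZE unitary_conj_pow// rdiag_pow -!mulmxA nsq_isometry ?adjmxK//.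
  rewrite -nsq_adj adjmx_mul -(@nsq_isometry _ _ _ _ U)// adjmx_mul hD !mulmxA -aE.
  rewrite -nsq_adj adjmx_mul adjmxK nsq_rdiag_mul exchange_big/=.
  by rewrite adjmxK.
have -> : retr (D *m mxpow Y j *m D *m mxpow Z k) = \sum_i \sum_b (l i ^+ j * r b ^+ k) *
    (complex.Re (E b i) ^+ 2 + complex.Im (E b i) ^+ 2).
  rewrite YE ZE !unitary_conj_pow// !rdiag_pow.
  rewrite !mulmxA retr_mulC !mulmxA.
  rewrite -/E -(mulmxA (E *m _) U) -(mulmxA (E *m _) (U *m D)) -aE retrE exchange_big/=.
  apply: eq_bigr => b _; rewrite -mulmxA mxE cRe_sum; apply: eq_bigr => i _.
  rewrite !mulmx_rdiagE adjmxE !(cReM, cImM, cReJ, cImJ) /=.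
  ring.
rewrite -big_split/=; apply: ler_sum => i _; rewrite -big_split/=.
apply: ler_sum => b _; rewrite -mulrDl; apply: ler_wpM2r.
  by rewrite addr_ge0// sqr_ge0.
exact: powers_mix.
Qed.

(** Telescoping the odd power [2 N + 1] gives [2 N + 1] products whose two exponents add up to the
    even number [2 N], so each of them falls under [retr_mixed_powers]. *)
Lemma retr_diff_odd_powers Y Z N : hermmx Y -> hermmx Z ->
  retr ((Y - Z) *m (mxpow Y (N + N).+1 - mxpow Z (N + N).+1)) <=
  (N + N).+1%:R * (nsq (mxpow Y N *m (Y - Z)) + nsq (mxpow Z N *m (Y - Z))).
Proof.
move=> hY hZ; rewrite mxpow_sub mulmx_sumr retr_sum.
set q := nsq _ + nsq _.
have -> : (N + N).+1%:R * q = \sum_(j < (N + N).+1) q.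
  by rewrite sumr_const card_ord mulr_natl.
apply: ler_sum => j _; rewrite !mulmxA.
apply: retr_mixed_powers => //; first exact: hermmxB.
by rewrite subnK// -ltnS.
Qed.

(** From trace moments to the operator norm: [nsq (mxpow Y N.+1)] is the sum of [(l i ^+ 2) ^+ N.+1]
    over the eigenvalues [l i], so each term is at most the whole. The exponent is a successor
    because a root is taken. *)
Lemma nsq_power_small Y N (d : R) : hermmx Y -> 0 <= d ->
  nsq (mxpow Y N.+1) <= d ^+ N.+1 -> opbound Y d.
Proof.
move=> hY d0; have [U [l [U1 U2 YE]]] := hermmx_spectral hY.
rewrite {1}YE unitary_conj_pow// rdiag_pow -mulmxA nsq_isometry ?adjmxK//.
rewrite -nsq_adj adjmx_mul nsq_isometry ?adjmxK//.
rewrite nsq_adj -[rdiag _]mulmx1 nsq_rdiag_mul => Hd v.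
have ld i : l i ^+ 2 <= d.
  have : (l i ^+ 2) ^+ N.+1 <= d ^+ N.+1.
    apply: le_trans Hd; rewrite (bigD1 i)//= (bigD1 i)//= !mxE eqxx /=.
    rewrite expr0n expr1n addr0 mulr1 exprAC -addrA lerDl addr_ge0// sumr_ge0// => b _.
      by rewrite mulr_ge0 ?sqr_ge0// addr_ge0// sqr_ge0.
    by apply: sumr_ge0 => c _; rewrite mulr_ge0 ?sqr_ge0// addr_ge0// sqr_ge0.
  by rewrite ler_pXn2r ?nnegrE ?sqr_ge0.
rewrite YE -!mulmxA nsq_isometry ?adjmxK// nsq_rdiag_mul.
rewrite -(@nsq_isometry _ _ _ _ U)// /nsq mulr_sumr; apply: ler_sum => i _.
rewrite mulr_sumr; apply: ler_sum => b _; apply: ler_wpM2r => //.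
by rewrite addr_ge0// sqr_ge0.
Qed.

End Spectral.

(** * Random matrices and trace moments *)

Section BoundedMatrices.
Context {R : realType}.
Local Notation C := R[i].

Definition cbmeas {d} {U : measurableType d} (f : U -> C) : Prop :=
  bmeas (fun u => complex.Re (f u)) /\ bmeas (fun u => complex.Im (f u)).

Definition mbmeas {d} {U : measurableType d} p q (F : U -> 'M[C]_(p, q)) : Prop :=
  forall i j, cbmeas (fun u => F u i j).

Section Closure.
Context {d} {U : measurableType d}.

Lemma eq_cbmeas (f g : U -> C) : cbmeas f -> f =1 g -> cbmeas g.
Proof. by move=> bf /funext <-. Qed.

Lemma cbmeas_cst (c : C) : cbmeas (fun _ : U => c).
Proof. by split; exact: bmeas_cst. Qed.

Lemma cbmeasD (f g : U -> C) : cbmeas f -> cbmeas g -> cbmeas (fun u => f u + g u).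
Proof.
move=> [f1 f2] [g1 g2]; split.
  by apply: (eq_bmeas (bmeasD f1 g1)) => u; rewrite cReD.
by apply: (eq_bmeas (bmeasD f2 g2)) => u; rewrite cImD.
Qed.

Lemma cbmeasN (f : U -> C) : cbmeas f -> cbmeas (fun u => - f u).
Proof.
move=> [f1 f2]; split.
  by apply: (eq_bmeas (bmeasN f1)) => u; rewrite cReN.
by apply: (eq_bmeas (bmeasN f2)) => u; rewrite cImN.
Qed.

Lemma cbmeasM (f g : U -> C) : cbmeas f -> cbmeas g -> cbmeas (fun u => f u * g u).
Proof.
move=> [f1 f2] [g1 g2]; split.
  by apply: (eq_bmeas (bmeasB (bmeasM f1 g1) (bmeasM f2 g2))) => u; rewrite cReM.
by apply: (eq_bmeas (bmeasD (bmeasM f1 g2) (bmeasM f2 g1))) => u; rewrite cImM.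
Qed.

Lemma cbmeasJ (f : U -> C) : cbmeas f -> cbmeas (fun u => conjc (f u)).
Proof.
move=> [f1 f2]; split.
  by apply: (eq_bmeas f1) => u; rewrite cReJ.
by apply: (eq_bmeas (bmeasN f2)) => u; rewrite cImJ.
Qed.

Lemma cbmeas_sum (I : Type) (r : seq I) (Q : pred I) (F : I -> U -> C) :
  (forall i, Q i -> cbmeas (F i)) -> cbmeas (fun u => \sum_(i <- r | Q i) F i u).
Proof.
move=> bF; split.
  apply: eq_bmeas (fun u => esym (cRe_sum r Q (fun i => F i u))).
  by apply: bmeas_sum => i /bF[].
apply: eq_bmeas (fun u => esym (cIm_sum r Q (fun i => F i u))).
by apply: bmeas_sum => i /bF[].
Qed.

Lemma cbmeas_prod (I : Type) (r : seq I) (Q : pred I) (F : I -> U -> C) :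
  (forall i, cbmeas (F i)) -> cbmeas (fun u => \prod_(i <- r | Q i) F i u).
Proof.
move=> bF; elim: r => [|i r IH].
  by apply: (eq_cbmeas (cbmeas_cst 1)) => u; rewrite big_nil.
case E: (Q i); last by apply: (eq_cbmeas IH) => u; rewrite big_cons E.
by apply: (eq_cbmeas (cbmeasM (bF i) IH)) => u; rewrite big_cons E.
Qed.

Lemma eq_mbmeas p q (F G : U -> 'M[C]_(p, q)) : mbmeas F -> F =1 G -> mbmeas G.
Proof. by move=> bF /funext <-. Qed.

Lemma mbmeas_cst p q (A : 'M[C]_(p, q)) : mbmeas (fun _ : U => A).
Proof. by move=> i j; exact: cbmeas_cst. Qed.

Lemma mbmeasD p q (F G : U -> 'M[C]_(p, q)) :
  mbmeas F -> mbmeas G -> mbmeas (fun u => F u + G u).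
Proof.
move=> bF bG i j; apply: (eq_cbmeas (cbmeasD (bF i j) (bG i j))) => u.
by rewrite mxE.
Qed.

Lemma mbmeasN p q (F : U -> 'M[C]_(p, q)) : mbmeas F -> mbmeas (fun u => - F u).
Proof. by move=> bF i j; apply: (eq_cbmeas (cbmeasN (bF i j))) => u; rewrite mxE. Qed.

Lemma mbmeasB p q (F G : U -> 'M[C]_(p, q)) :
  mbmeas F -> mbmeas G -> mbmeas (fun u => F u - G u).
Proof. by move=> bF bG; apply: mbmeasD => //; exact: mbmeasN. Qed.

Lemma mbmeas_mul p q r (F : U -> 'M[C]_(p, q)) (G : U -> 'M[C]_(q, r)) :
  mbmeas F -> mbmeas G -> mbmeas (fun u => F u *m G u).
Proof.
move=> bF bG i j.
apply: (@eq_cbmeas (fun u => \sum_k F u i k * G u k j)) => [|u]; last by rewrite mxE.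
by apply: cbmeas_sum => k _; apply: cbmeasM.
Qed.

Lemma mbmeas_adj p q (F : U -> 'M[C]_(p, q)) : mbmeas F -> mbmeas (fun u => adjmx (F u)).
Proof. by move=> bF i j; apply: (eq_cbmeas (cbmeasJ (bF j i))) => u; rewrite adjmxE. Qed.

Lemma mbmeas_pow n (F : U -> 'M[C]_n) k : mbmeas F -> mbmeas (fun u => mxpow (F u) k).
Proof.
by move=> bF; elim: k => [|k IH]; [exact: mbmeas_cst|exact: mbmeas_mul].
Qed.

Lemma mbmeas_sum p q (I : Type) (r : seq I) (Q : pred I) (F : I -> U -> 'M[C]_(p, q)) :
  (forall i, Q i -> mbmeas (F i)) -> mbmeas (fun u => \sum_(i <- r | Q i) F i u).
Proof.
move=> bF i j.
apply: (@eq_cbmeas (fun u => \sum_(k <- r | Q k) F k u i j)) => [|u].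
  by apply: cbmeas_sum => k Qk; exact: bF.
by rewrite summxE.
Qed.

Lemma bmeas_retr n (F : U -> 'M[C]_n) : mbmeas F -> bmeas (fun u => retr (F u)).
Proof.
move=> bF; apply: eq_bmeas (fun u => esym (retrE (F u))).
by apply: bmeas_sum => i _; exact: (bF i i).1.
Qed.

Lemma bmeas_nsq p q (F : U -> 'M[C]_(p, q)) : mbmeas F -> bmeas (fun u => nsq (F u)).
Proof.
move=> bF; apply: eq_bmeas (fun u => esym (nsq_retr (F u))).
by apply: bmeas_retr; apply: mbmeas_mul => //; exact: mbmeas_adj.
Qed.

Lemma cbmeas_det n (F : U -> 'M[C]_n) : mbmeas F -> cbmeas (fun u => \det (F u)).
Proof.
move=> bF; apply: cbmeas_sum => s _; apply: cbmeasM; first exact: cbmeas_cst.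
by apply: cbmeas_prod => i; exact: bF.
Qed.

Lemma mbmeas_adjugate n (F : U -> 'M[C]_n) : mbmeas F -> mbmeas (fun u => \adj (F u)).
Proof.
move=> bF i j.
apply: (@eq_cbmeas (fun u => cofactor (F u) j i)) => [|u]; last by rewrite mxE.
apply: cbmeasM; first exact: cbmeas_cst.
apply: cbmeas_det => k l; apply: (eq_cbmeas (bF (lift j k) (lift i l))) => u.
by rewrite !mxE.
Qed.

End Closure.

Lemma mbmeas_comp d d' (U : measurableType d) (V : measurableType d') (h : U -> V)
    p q (F : V -> 'M[C]_(p, q)) :
  measurable_fun setT h -> mbmeas F -> mbmeas (fun u => F (h u)).
Proof.
move=> mh bF i j; have [[m1 [M1 b1]] [m2 [M2 b2]]] := bF i j.
split; split.
- exact: (measurableT_comp m1 mh).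
- by exists M1.
- exact: (measurableT_comp m2 mh).
- by exists M2.
Qed.

Lemma mbmeas_fst d d' (U : measurableType d) (V : measurableType d')
    p q (F : U -> 'M[C]_(p, q)) :
  mbmeas F -> mbmeas (fun u : U * V => F u.1).
Proof. by move=> bF; exact: (mbmeas_comp measurable_fst bF). Qed.

Lemma mbmeas_snd d d' (U : measurableType d) (V : measurableType d')
    p q (F : V -> 'M[C]_(p, q)) :
  mbmeas F -> mbmeas (fun u : U * V => F u.2).
Proof. by move=> bF; exact: (mbmeas_comp measurable_snd bF). Qed.

(* The identity is a measurable map from the finer sigma-algebra to the coarser one. *)
Lemma mbmeas_finer (T : pointedType) (G H : set (set T)) p q (F : T -> 'M[C]_(p, q)) :
  <<s G>> `<=` <<s H>> ->
  mbmeas (F : g_sigma_algebraType G -> _) -> mbmeas (F : g_sigma_algebraType H -> _).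
Proof.
move=> GH bF.
apply: (@mbmeas_comp _ _ (g_sigma_algebraType H) (g_sigma_algebraType G) idfun _ _ F) => //.
by move=> _ A mA; rewrite setTI; exact: GH.
Qed.

Lemma mbmeas_ambient d (T : measurableType d) (G : set (set T)) p q (F : T -> 'M[C]_(p, q)) :
  <<s G>> `<=` measurable ->
  mbmeas (F : g_sigma_algebraType G -> _) -> mbmeas F.
Proof.
move=> GH bF.
apply: (@mbmeas_comp _ _ T (g_sigma_algebraType G) idfun _ _ F) => //.
by move=> _ A mA; rewrite setTI; exact: GH.
Qed.

End BoundedMatrices.

Section MatrixExpectation.
Context {R : realType} {d} {T : measurableType d} (P : probability T R).
Local Notation C := R[i].

Definition Emx p q (X : T -> 'M[C]_(p, q)) : 'M[C]_(p, q) :=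
  \matrix_(i, j) ((\int[P]_t complex.Re (X t i j)) +i* (\int[P]_t complex.Im (X t i j)))%C.

Lemma Rintegral_retr_mul p q (X : T -> 'M[C]_(p, q)) (A : 'M[C]_(q, p)) : mbmeas X ->
  \int[P]_t retr (X t *m A) = retr (Emx X *m A).
Proof.
move=> bX; rewrite retrE.
have E t : retr (X t *m A) = \sum_i \sum_j (complex.Re (A j i) * complex.Re (X t i j)
    - complex.Im (A j i) * complex.Im (X t i j)).
  rewrite retrE; apply: eq_bigr => i _; rewrite mxE cRe_sum.
  by apply: eq_bigr => j _; rewrite cReM ![_ * complex.Re (A _ _)]mulrC ![_ * complex.Im (A _ _)]mulrC.
have bt i j : bmeas (fun t => complex.Re (A j i) * complex.Re (X t i j)
    - complex.Im (A j i) * complex.Im (X t i j)).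
  have [b1 b2] := bX i j.
  by apply: bmeasB; apply: bmeasM => //; exact: bmeas_cst.
under eq_Rintegral do rewrite E.
rewrite bRintegral_sum; last by move=> i; exact: bmeas_sum.
apply: eq_bigr => i _; rewrite bRintegral_sum// mxE cRe_sum; apply: eq_bigr => j _.
have [b1 b2] := bX i j.
rewrite bRintegralB ?bRintegralZl//; [|by apply: bmeasM => //; exact: bmeas_cst..].
by rewrite cReM !mxE /= ![_ * complex.Re _]mulrC ![_ * complex.Im _]mulrC.
Qed.

Lemma Rintegral_retr_mull p q (X : T -> 'M[C]_(p, q)) (A : 'M[C]_(q, p)) : mbmeas X ->
  \int[P]_t retr (A *m X t) = retr (A *m Emx X).
Proof.
move=> bX; rewrite retr_mulC -Rintegral_retr_mul//.
by apply: eq_Rintegral => t _; rewrite retr_mulC.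
Qed.

(** The four-term inequality is averaged over two independent arguments. The partial integrals [B],
    [B'] of the cross term and their common mean [b0] are supplied explicitly, so that no integrals
    have to be exchanged. *)
Lemma Rintegral_sym4 (a : T -> R) (b : T -> T -> R) (B : T -> R) (b0 : R) (B' : T -> R) :
  bmeas a -> (forall s, bmeas (b s)) -> (forall s, bmeas (b^~ s)) -> bmeas B -> bmeas B' ->
  (forall s, \int[P]_t b s t = B s) -> (forall s, \int[P]_t b t s = B' s) ->
  \int[P]_s B s = b0 -> \int[P]_s B' s = b0 ->
  (forall s t, 0 <= a s + a t + b s t + b t s) -> 0 <= \int[P]_t a t + b0.
Proof.
move=> ba b1 b2 bB bB' EB EB' EB0 EB0' h.
have h1 s : 0 <= a s + \int[P]_t a t + B s + B' s.
  rewrite -EB -EB' -[a s](probability_Rintegral_cst P) -!bRintegralD//;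
    rewrite ?probability_Rintegral_cst.
  - by apply: Rintegral_ge0 => t _; exact: h.
  - by apply: bmeasD => //; apply: bmeasD => //; exact: bmeas_cst.
  - by apply: bmeasD => //; exact: bmeas_cst.
  - exact: bmeas_cst.
have : 0 <= \int[P]_s (a s + \int[P]_t a t + B s + B' s).
  by apply: Rintegral_ge0 => s _; exact: h1.
rewrite !bRintegralD//; [|try (by repeat apply: bmeasD => //; exact: bmeas_cst)..].
rewrite probability_Rintegral_cst EB0 EB0'; lra.
all: by repeat apply: bmeasD => //; exact: bmeas_cst.
Qed.

Lemma retr_gram_sqr p n (A : 'M[C]_(p, n)) (Y : 'M[C]_n) N : hermmx Y ->
  retr (adjmx A *m A *m mxpow Y (N + N)) = nsq (A *m mxpow Y N).
Proof.
move=> hY; rewrite nsq_retr adjmx_mul (hermmx_pow N hY) mxpowD.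
by rewrite !mulmxA retr_mulC !mulmxA.
Qed.

(** The hypothesis is multiplied out and sorted into the shape of [Rintegral_sym4]: terms in one
    argument, then cross terms, whose means factor when the two arguments are independent. *)
Lemma retr_symm_expand n (X X' V V' W W' : 'M[C]_n) (c : R) :
  retr ((X - X') *m (W - W')) <= c * (retr ((X + X') *m V) + retr ((X + X') *m V')) ->
  0 <= c * retr (X *m V) - retr (X *m W) + (c * retr (X' *m V') - retr (X' *m W')) +
    (c * retr (X *m V') + retr (X *m W')) + (c * retr (X' *m V) + retr (X' *m W)).
Proof.
rewrite mulmxBl 2!mulmxBr 3!retrB 2!mulmxDl 2!retrD.
move: (retr (X *m V)) (retr (X' *m V)) (retr (X *m V')) (retr (X' *m V'))
  (retr (X *m W)) (retr (X' *m W)) (retr (X *m W')) (retr (X' *m W')).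
by move=> a1 a2 a3 a4 a5 a6 a7 a8; lra.
Qed.

(* Symmetrisation with an independent copy t' of t: the integrand is
   D * (U(t)^(2N+1) - U(t')^(2N+1)) with D = X t - X t' = U t - U t'. *)
Lemma centered_gram_moment p n (A : T -> 'M[C]_(p, n)) (X : T -> 'M[C]_n)
    (Z : 'M[C]_n) (K : R) N :
  0 <= K -> mbmeas A -> (forall t, opbound (A t) K) -> hermmx Z ->
  (forall t, X t = adjmx (A t) *m A t) ->
  \int[P]_t retr ((X t - Emx X) *m mxpow (Z + X t) (N + N).+1) <=
  2 * K * (N + N).+1%:R * \int[P]_t retr ((X t + Emx X) *m mxpow (Z + X t) (N + N)).
Proof.
move=> K0 bA AK hZ XE; set c : R := 2 * K * _.
have {}bX : mbmeas X.
  by apply: (@eq_mbmeas _ _ _ _ _ (fun t => adjmx (A t) *m A t)) => //;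
    apply: mbmeas_mul => //; exact: mbmeas_adj.
have hX t : hermmx (X t) by rewrite XE; exact: hermmx_gram.
pose V t := Z + X t.
have hV t : hermmx (V t) by apply: hermmxD.
have bV : mbmeas V by apply: mbmeasD => //; exact: mbmeas_cst.
pose W1 t := mxpow (V t) (N + N).+1; pose W0 t := mxpow (V t) (N + N).
have bW1 : mbmeas W1 by exact: mbmeas_pow.
have bW0 : mbmeas W0 by exact: mbmeas_pow.
have bR (F G : T -> 'M[C]_n) : mbmeas F -> mbmeas G -> bmeas (fun t : T => retr (F t *m G t) : R).
  by move=> bF bG; apply: bmeas_retr; exact: mbmeas_mul.
have key s t : retr ((X s - X t) *m (W1 s - W1 t)) <=
    c * (retr ((X s + X t) *m W0 s) + retr ((X s + X t) *m W0 t)).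
  (* Parallelogram bound for [X s - X t], then [X^2 <= K X] in each summand: here the size [K] of a
     block enters the recursion. *)
  have side u : nsq (mxpow (V u) N *m (X s - X t)) <= 2 * K * retr ((X s + X t) *m W0 u).
    rewrite -nsq_adj adjmx_mul adjmxB !hX (hermmx_pow N (hV u)) mulmxBl.
    apply: le_trans (nsqB_le _ _) _.
    rewrite mulmxDl retrD !XE !retr_gram_sqr//.
    by rewrite mulrDr -!(mulrA 2) lerD// ler_wpM2l//; exact: nsq_gram_mul.
  have D : X s - X t = V s - V t by rewrite /V opprD addrACA subrr add0r.
  have := retr_diff_odd_powers N (hV s) (hV t); rewrite -D => h.
  apply: le_trans h _; rewrite /c [_ * (N + N).+1%:R]mulrC -mulrA ler_wpM2l//.
  by rewrite mulrDr lerD// side.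
have bc F : bmeas F -> bmeas (fun t : T => c * F t : R).
  by move=> bF; apply: bmeasM => //; exact: bmeas_cst.
have cM (M : 'M[C]_n) : mbmeas (fun _ : T => M) by exact: mbmeas_cst.
have bR1 (M : 'M[C]_n) (F : T -> 'M[C]_n) : mbmeas F -> bmeas (fun t : T => retr (M *m F t) : R) by move=> bF; exact: bR.
have bR2 (M : 'M[C]_n) (F : T -> 'M[C]_n) : mbmeas F -> bmeas (fun t : T => retr (F t *m M) : R) by move=> bF; exact: bR.
have : 0 <= \int[P]_t (c * retr (X t *m W0 t) - retr (X t *m W1 t)) +
    (c * retr (Emx X *m Emx W0) + retr (Emx X *m Emx W1)).
  apply: (@Rintegral_sym4 _ (fun s t => c * retr (X s *m W0 t) + retr (X s *m W1 t))
    (fun s => c * retr (X s *m Emx W0) + retr (X s *m Emx W1)) _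
    (fun s => c * retr (Emx X *m W0 s) + retr (Emx X *m W1 s))).
  - by apply: bmeasB; [apply/bc/bR|exact: bR].
  - by move=> s; apply: bmeasD; [apply/bc/bR1|exact: bR1].
  - by move=> s; apply: bmeasD; [apply/bc/bR2|exact: bR2].
  - by apply: bmeasD; [apply/bc/bR2|exact: bR2].
  - by apply: bmeasD; [apply/bc/bR1|exact: bR1].
  - move=> s; rewrite bRintegralD ?bRintegralZl ?Rintegral_retr_mull//; [exact: bR1|apply/bc; exact: bR1|exact: bR1].
  - move=> s; rewrite bRintegralD ?bRintegralZl ?Rintegral_retr_mul//; [exact: bR2|apply/bc; exact: bR2|exact: bR2].
  - rewrite bRintegralD ?bRintegralZl ?Rintegral_retr_mul//; [exact: bR2|apply/bc; exact: bR2|exact: bR2].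
  - rewrite bRintegralD ?bRintegralZl ?Rintegral_retr_mull//; [exact: bR1|apply/bc; exact: bR1|exact: bR1].
  - by move=> s t; exact: (retr_symm_expand (key s t)).
have -> : \int[P]_t retr ((X t - Emx X) *m W1 t) =
    \int[P]_t retr (X t *m W1 t) - retr (Emx X *m Emx W1).
  rewrite -Rintegral_retr_mull// -bRintegralB; [|exact: bR|exact: bR1].
  by apply: eq_Rintegral => t _; rewrite mulmxBl retrB.
have -> : \int[P]_t retr ((X t + Emx X) *m W0 t) =
    \int[P]_t retr (X t *m W0 t) + retr (Emx X *m Emx W0).
  rewrite -Rintegral_retr_mull// -bRintegralD; [|exact: bR|exact: bR1].
  by apply: eq_Rintegral => t _; rewrite mulmxDl retrD.
rewrite bRintegralB ?bRintegralZl; [lra|exact: bR|exact/bc/bR|exact: bR].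
Qed.

End MatrixExpectation.

(** * Independent blocks and the moment recursion *)

Section IndependentFamily.
Context {R : realType} {d} {T : measurableType d} (P : probability T R).
Context {I : finType} (G : I -> set (set T)).
Hypothesis Gs : forall i, sigma_algebra setT (G i).
Hypothesis Gm : forall i, G i `<=` measurable.
Hypothesis Gind : mindep P G.

Definition joinG (J : {set I}) : set (set T) := [set A | exists2 j, j \in J & G j A].

Lemma g_sigma_id i : <<s G i>> = G i.
Proof. exact: sigma_algebra_id. Qed.

Lemma sigma_sub_measurable (H : set (set T)) : H `<=` measurable -> <<s H>> `<=` measurable.
Proof. by move=> Hm; apply: smallest_sub => //; exact: sigma_algebra_measurable. Qed.

Lemma joinG_measurable J : <<s joinG J>> `<=` measurable.
Proof. by apply: sigma_sub_measurable => A [j _]; exact: Gm. Qed.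

Lemma G_joinG (J : {set I}) (j : I) : j \in J -> <<s G j>> `<=` <<s joinG J>>.
Proof. by move=> jJ; apply: sub_sigma_algebra2 => A GA; exists j. Qed.

Lemma family_decouple_le (J : {set I}) (i : I)
    (f g : g_sigma_algebraType (G i) * g_sigma_algebraType (joinG J) -> R) :
  i \notin J -> bmeas f -> bmeas g ->
  (forall t2 : T, \int[P]_t1 f (t1, t2) <= \int[P]_t1 g (t1, t2)) ->
  \int[P]_t f (t, t) <= \int[P]_t g (t, t).
Proof.
move=> iJ; apply: decouple_le.
- exact: sigma_sub_measurable.
- exact: joinG_measurable.
- by rewrite g_sigma_id; exact: mindep_group.
Qed.

Section MatrixMoments.
Local Notation C := R[i].
Variables (n : nat) (p : I -> nat) (A : forall i, T -> 'M[C]_(p i, n)) (K : R) (Q : 'M[C]_n).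
Hypothesis bA : forall i, mbmeas (A i : g_sigma_algebraType (G i) -> _).
Hypothesis K0 : 0 <= K.
Hypothesis AK : forall i t, opbound (A i t) K.

Variables (X : I -> T -> 'M[C]_n) (Y : T -> 'M[C]_n).
Hypothesis XE : forall i t, X i t = adjmx (A i t) *m A i t.
Hypothesis YE : forall t, Y t = \sum_i X i t - Q.

Hypothesis hQ : hermmx Q.
Hypothesis QQ : Q *m Q = Q.
Hypothesis EX : \sum_i Emx P (X i) = Q.

Let hX i t : hermmx (X i t). Proof. by rewrite XE; exact: hermmx_gram. Qed.
Let hY t : hermmx (Y t).
Proof. by rewrite YE; apply: hermmxB => //; apply: hermmx_sum => i; exact: hX. Qed.
Let bXG i : mbmeas (X i : g_sigma_algebraType (G i) -> _).
Proof.
apply: (@eq_mbmeas _ _ (g_sigma_algebraType (G i)) _ _ (fun t => adjmx (A i t) *m A i t)).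
  by apply: mbmeas_mul; [apply: mbmeas_adj; exact: bA|exact: bA].
by move=> t; rewrite XE.
Qed.
Let bX i : mbmeas (X i).
Proof. by apply: mbmeas_ambient (@bXG i); rewrite g_sigma_id; exact: Gm. Qed.
Let bAT i : mbmeas (A i).
Proof. by apply: mbmeas_ambient (@bA i); rewrite g_sigma_id; exact: Gm. Qed.
Let bY : mbmeas Y.
Proof.
apply: (@eq_mbmeas _ _ _ _ _ (fun t => \sum_i X i t - Q)) => //.
by apply: mbmeasB; [apply: mbmeas_sum => i _; exact: bX|exact: mbmeas_cst].
Qed.

(** [Z] stands for the other blocks. With [Z] frozen, block [i] is symmetrised by
    [centered_gram_moment]; [family_decouple_le] then averages over [Z]. *)
Lemma gram_moment_leave_one_out (J : {set I}) i (Z : T -> 'M[C]_n) N : i \notin J ->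
  (forall t, hermmx (Z t)) -> mbmeas (Z : g_sigma_algebraType (joinG J) -> _) ->
  \int[P]_t retr ((X i t - Emx P (X i)) *m mxpow (Z t + X i t) (N + N).+1) <=
  2 * K * (N + N).+1%:R *
    \int[P]_t retr ((X i t + Emx P (X i)) *m mxpow (Z t + X i t) (N + N)).
Proof.
move=> iJ hZ bZ; set c : R := 2 * K * _.
pose UU := (g_sigma_algebraType (G i) * g_sigma_algebraType (joinG J))%type.
have bX1 : mbmeas (fun u : UU => X i u.1).
  exact: (@mbmeas_fst _ _ _ (g_sigma_algebraType (G i)) (g_sigma_algebraType (joinG J)) _ _ _ (@bXG i)).
have bZ2 : mbmeas (fun u : UU => Z u.2).
  exact: (@mbmeas_snd _ _ _ (g_sigma_algebraType (G i)) (g_sigma_algebraType (joinG J)) _ _ _ bZ).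
pose f (u : UU) := retr ((X i u.1 - Emx P (X i)) *m mxpow (Z u.2 + X i u.1) (N + N).+1).
pose g (u : UU) := c * retr ((X i u.1 + Emx P (X i)) *m mxpow (Z u.2 + X i u.1) (N + N)).
have bf : bmeas f.
  apply: bmeas_retr; apply: mbmeas_mul; first by apply: mbmeasB => //; exact: mbmeas_cst.
  by apply: mbmeas_pow; exact: mbmeasD.
have bg : bmeas g.
  apply: bmeasM; first exact: bmeas_cst.
  apply: bmeas_retr; apply: mbmeas_mul; first by apply: mbmeasD => //; exact: mbmeas_cst.
  by apply: mbmeas_pow; exact: mbmeasD.
have bVZ (W : T -> 'M[C]_n) : mbmeas W -> bmeas (fun t =>
    retr ((X i t + Emx P (X i)) *m mxpow (W t + X i t) (N + N))).
  move=> bW; apply: bmeas_retr; apply: mbmeas_mul; first by apply: mbmeasD => //; exact: mbmeas_cst.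
  by apply: mbmeas_pow; exact: mbmeasD.
have bZT : mbmeas Z by apply: mbmeas_ambient bZ; exact: joinG_measurable.
have h t2 : \int[P]_t1 f (t1, t2) <= \int[P]_t1 g (t1, t2).
  rewrite /g bRintegralZl; last by apply: (bVZ (fun=> Z t2)); exact: mbmeas_cst.
  exact: (@centered_gram_moment _ _ _ P _ _ (A i) (X i) (Z t2) K N K0 (bAT (i:=i)) (AK i) (hZ t2) (XE i)).
apply: le_trans (family_decouple_le iJ bf bg h) _.
by rewrite /g bRintegralZl//; exact: bVZ.
Qed.

Lemma gram_moment_step i N :
  \int[P]_t retr ((X i t - Emx P (X i)) *m mxpow (Y t) (N + N).+1) <=
  2 * K * (N + N).+1%:R * \int[P]_t retr ((X i t + Emx P (X i)) *m mxpow (Y t) (N + N)).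
Proof.
pose J := [set~ i]%SET.
have iJ : i \notin J by rewrite finset.in_setC finset.in_set1 eqxx.
pose Z (t : T) := \sum_(j in J) X j t - Q.
have hZ t : hermmx (Z t) by apply: hermmxB => //; apply: hermmx_sum => j; exact: hX.
have ZE : (fun t => Z t + X i t) = Y.
  apply/funext => t; rewrite [LHS]addrC /Z [LHS]addrA YE [in RHS](bigD1 i)//=.
  congr (_ + _ - _); apply: eq_bigl => j.
  by rewrite finset.in_setC finset.in_set1.
have bZ : mbmeas (Z : g_sigma_algebraType (joinG J) -> _).
  apply: mbmeasB; last exact: mbmeas_cst.
  by apply: mbmeas_sum => j jJ; exact: (mbmeas_finer (G_joinG jJ) (@bXG j)).
pose F (V : T -> 'M[C]_n) := \int[P]_t retr ((X i t - Emx P (X i)) *m mxpow (V t) (N + N).+1) <=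
  2 * K * (N + N).+1%:R * \int[P]_t retr ((X i t + Emx P (X i)) *m mxpow (V t) (N + N)).
have h : F (fun t => Z t + X i t) := gram_moment_leave_one_out N iJ hZ bZ.
by rewrite ZE in h.
Qed.

(** Summing the one-block estimates over [i] turns [X i + E X i] into [Y + 2 Q]. Now [tr Y^(2N+1)]
    is at most half of [tr Y^(2N+2) + tr Y^(2N)], and [tr (Q Y^(2N))] at most [tr Y^(2N)]:
    altogether [k] times the new moment, absorbed on the left, and [5 k] times the old one. *)
Lemma gram_moment_recursion N (k : R) : 0 <= k -> (N + N).+1%:R * K <= k ->
  (1 - k) * \int[P]_t nsq (mxpow (Y t) N.+1) <= 5 * k * \int[P]_t nsq (mxpow (Y t) N).
Proof.
move=> k0 Nk.
have bYp N' : mbmeas (fun t => mxpow (Y t) N') by exact: mbmeas_pow.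
have step1 : \int[P]_t nsq (mxpow (Y t) N.+1) =
    \sum_i \int[P]_t retr ((X i t - Emx P (X i)) *m mxpow (Y t) (N + N).+1).
  rewrite -bRintegral_sum; last first.
    move=> i; apply: bmeas_retr; apply: mbmeas_mul => //.
    by apply: mbmeasB => //; exact: mbmeas_cst.
  apply: eq_Rintegral => t _.
  rewrite -retr_sum -mulmx_suml sumrB EX -YE -mxpowS.
  rewrite nsq_retr (hermmx_pow N.+1 (hY t)) -mxpowD.
  by rewrite addSn addnS.
have sumX t : \sum_i (X i t + Emx P (X i)) = Y t + (Q + Q).
  by rewrite big_split/= EX YE addrA subrK.
have step2 : \sum_i \int[P]_t retr ((X i t + Emx P (X i)) *m mxpow (Y t) (N + N)) <=
   2^-1 * (\int[P]_t nsq (mxpow (Y t) N.+1) + \int[P]_t nsq (mxpow (Y t) N)) +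
   2 * \int[P]_t nsq (mxpow (Y t) N).
  rewrite -bRintegral_sum; last first.
    move=> i; apply: bmeas_retr; apply: mbmeas_mul => //.
    by apply: mbmeasD => //; exact: mbmeas_cst.
  have b1 : bmeas (fun t => nsq (mxpow (Y t) N.+1)) by exact: bmeas_nsq.
  have b0 : bmeas (fun t => nsq (mxpow (Y t) N)) by exact: bmeas_nsq.
  have bc c F : bmeas F -> bmeas (fun t : T => c * F t : R).
    by move=> bF; apply: bmeasM => //; exact: bmeas_cst.
  rewrite [leRHS](_ : _ = \int[P]_t (2^-1 * (nsq (mxpow (Y t) N.+1) + nsq (mxpow (Y t) N))
     + 2 * nsq (mxpow (Y t) N))); last first.
    rewrite bRintegralD; [|by apply: bc; exact: bmeasD|exact: bc].
    by rewrite (bRintegralZl P 2 b0) (bRintegralZl P 2^-1 (bmeasD b1 b0)) (bRintegralD P b1 b0).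
  apply: le_bRintegral.
  - apply: bmeas_sum => i _; apply: bmeas_retr; apply: mbmeas_mul => //.
    by apply: mbmeasD => //; exact: mbmeas_cst.
  - by apply: bmeasD; [by apply: bc; exact: bmeasD|exact: bc].
  move=> t; rewrite -retr_sum -mulmx_suml sumX mulmxDl retrD mulmxDl retrD.
  have E1 : retr (Y t *m mxpow (Y t) (N + N)) = rdot (mxpow (Y t) N) (mxpow (Y t) N.+1).
    by rewrite rdotE (hermmx_pow N (hY t)) -mxpowD addnS.
  have E2 : retr (Q *m mxpow (Y t) (N + N)) = nsq (Q *m mxpow (Y t) N).
    by rewrite -retr_gram_sqr// hQ QQ.
  have E3 : nsq (Q *m mxpow (Y t) N) <= nsq (mxpow (Y t) N).
    set M := mxpow _ _; have := nsq_ge0 (M - Q *m M).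
    have -> : nsq (M - Q *m M) = nsq M - nsq (Q *m M).
      rewrite nsqB; have -> : rdot M (Q *m M) = nsq (Q *m M); last by ring.
      by rewrite -rdot_nsq rdotMl mulmxA hQ QQ.
    by rewrite subr_ge0.
  rewrite E1 E2; have := rdot_le_avg (mxpow (Y t) N) (mxpow (Y t) N.+1).
  move: (rdot _ _) (nsq (mxpow (Y t) N.+1)) (nsq (mxpow (Y t) N)) (nsq _) E3 => a1 a2 a3 a4 E3.
  lra.
have a0 N' : 0 <= \int[P]_t nsq (mxpow (Y t) N') by apply: Rintegral_ge0 => t _; exact: nsq_ge0.
have : \int[P]_t nsq (mxpow (Y t) N.+1) <= 2 * k *
   (2^-1 * (\int[P]_t nsq (mxpow (Y t) N.+1) + \int[P]_t nsq (mxpow (Y t) N)) +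
   2 * \int[P]_t nsq (mxpow (Y t) N)).
  rewrite {1}step1.
  apply: (@le_trans _ _ (2 * K * (N + N).+1%:R * (\sum_i \int[P]_t retr ((X i t + Emx P (X i)) *m mxpow (Y t) (N + N))))).
    by rewrite mulr_sumr; apply: ler_sum => i _; exact: gram_moment_step.
  apply: (@le_trans _ _ (2 * K * (N + N).+1%:R * 
   (2^-1 * (\int[P]_t nsq (mxpow (Y t) N.+1) + \int[P]_t nsq (mxpow (Y t) N)) +
   2 * \int[P]_t nsq (mxpow (Y t) N)))).
    by rewrite ler_wpM2l// mulr_ge0// mulr_ge0.
  rewrite ler_wpM2r//.
    by rewrite addr_ge0// mulr_ge0// ?addr_ge0// invr_ge0.
  by rewrite -mulrA ler_wpM2l// mulrC.
move: (a0 N.+1) (a0 N).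
move: (\int[P]_t nsq (mxpow (Y t) N.+1)) (\int[P]_t nsq (mxpow (Y t) N)) => a b *.
lra.
Qed.

(** The dimension enters only through the zeroth moment [tr 1 = n]. *)
Lemma gram_moment N (k : R) : 0 <= k < 1 -> (N + N)%:R * K <= k ->
  \int[P]_t nsq (mxpow (Y t) N) <= (5 * k / (1 - k)) ^+ N * n%:R.
Proof.
move=> /andP[k0 k1]; elim: N => [|N IH] Nk.
  rewrite expr0 mul1r -[leRHS](probability_Rintegral_cst P).
  rewrite le_eqVlt; apply/orP; left; apply/eqP; apply: eq_Rintegral => t _.
  rewrite mxpow0 nsq_retr adjmx1 mul1mx retrE (eq_bigr (fun=> 1)).
    by rewrite sumr_const card_ord.
  by move=> i _; rewrite mxE eqxx.
have k10 : 0 < 1 - k by rewrite subr_gt0.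
have Nk' : (N + N).+1%:R * K <= k.
  by apply: le_trans Nk; rewrite ler_wpM2r// ler_nat addSn addnS.
have Nk'' : (N + N)%:R * K <= k.
  by apply: le_trans Nk; rewrite ler_wpM2r// ler_nat addSn addnS leqW.
have := gram_moment_recursion k0 Nk'.
rewrite mulrC -ler_pdivlMr// => /le_trans; apply.
have c0 : 0 <= 5 * k / (1 - k) by rewrite divr_ge0 ?mulr_ge0// ltW.
by rewrite exprS -(mulrA (5 * k / _)) mulrAC; apply: ler_wpM2l => //; exact: IH.
Qed.

End MatrixMoments.
End IndependentFamily.

(** * Pinelis' inequality *)

Section HyperbolicCosine.
Context {R : realType}.
Implicit Types (x y a b : R).

Definition coshR x : R := (expR x + expR (- x)) / 2.

Lemma coshR_ge0 x : 0 <= coshR x.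
Proof. by rewrite divr_ge0// addr_ge0 ?expR_ge0. Qed.

Lemma coshR_expR x : expR x <= 2 * coshR x.
Proof. by rewrite /coshR mulrC divfK// lerDl expR_ge0. Qed.

Lemma coshR0 : coshR 0 = 1.
Proof. by rewrite /coshR oppr0 expR0; lra. Qed.

(** By induction; the defect of a step is [th (1 - th) (a - b) (a^n - b^n)], which is
    nonnegative. *)
Lemma expr_convex (th a b : R) n : 0 <= th <= 1 -> 0 <= a -> 0 <= b ->
  (th * a + (1 - th) * b) ^+ n <= th * a ^+ n + (1 - th) * b ^+ n.
Proof.
move=> /andP[t0 t1] a0 b0; elim: n => [|n IH]; first by rewrite !expr0; lra.
rewrite !exprS; apply: le_trans (ler_wpM2l _ IH) _.
  by rewrite addr_ge0// mulr_ge0// subr_ge0.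
have h : 0 <= (a - b) * (a ^+ n - b ^+ n).
  have [ab|/ltW ab] := leP a b.
    by rewrite -mulrNN mulr_ge0// opprB subr_ge0// lerXn2r.
  by rewrite mulr_ge0// subr_ge0// lerXn2r.
have : 0 <= th * (1 - th) * ((a - b) * (a ^+ n - b ^+ n)).
  by rewrite mulr_ge0// mulr_ge0// subr_ge0.
rewrite -subr_ge0 => /le_trans; apply; rewrite le_eqVlt; apply/orP; left; apply/eqP.
by move: (a ^+ n) (b ^+ n) => A B; ring.
Qed.

(* cosh (sqrt z) is a power series in z with nonnegative coefficients, hence convex. *)
Lemma coshR_sqrt_convex (th r x y : R) : 0 <= th <= 1 ->
  r ^+ 2 = th * x ^+ 2 + (1 - th) * y ^+ 2 ->
  coshR r <= th * coshR x + (1 - th) * coshR y.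
Proof.
move=> t01 rE; rewrite /coshR.
suff : expR r + expR (- r) <=
    th * (expR x + expR (- x)) + (1 - th) * (expR y + expR (- y)) by lra.
pose u (z : R) n := series (exp_coeff z) n + series (exp_coeff (- z)) n.
have cu z : u z @ \oo --> expR z + expR (- z).
  by apply: cvgD; exact: is_cvg_series_exp_coeff.
have c2 : (fun n => th * u x n + (1 - th) * u y n) @ \oo -->
    th * (expR x + expR (- x)) + (1 - th) * (expR y + expR (- y)).
  by apply: cvgD; apply: cvgMl_tmp; exact: cu.
apply: (ler_cvg_to (cu r) c2).
apply: nearW => n; rewrite /u /series /= -!big_split/= !mulr_sumr -big_split/=.
apply: ler_sum => k _; rewrite /exp_coeff /= -!mulrDl !mulrA -mulrDl.
apply: ler_wpM2r; first by rewrite invr_ge0.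
have S (z : R) : z ^+ k + (- z) ^+ k = if odd k then 0 else 2 * (z ^+ 2) ^+ k./2.
  rewrite exprNn -signr_odd; case: ifP => ok; first by rewrite expr1 mulN1r subrr.
  by rewrite expr0 mul1r -exprM mul2n -[in LHS](odd_double_half k) ok add0n mulr_natl.
rewrite !S; case: ifP => _; first by rewrite !mulr0 addr0.
rewrite rE; have := expr_convex k./2 t01 (sqr_ge0 x) (sqr_ge0 y).
by move: (_ ^+ k./2) (_ ^+ k./2) (_ ^+ k./2) => c1 c3 c4; lra.
Qed.

(** By inversion of [expR (- b) >= 1 - b]. The quadratic majorants keep the second moment of a small
    random summand; the Gaussian ones below allow summands of any size. *)
Lemma expR_sub_le_quadratic (b : R) : 0 <= b <= 2^-1 -> expR b - b <= 1 + 2 * b ^+ 2.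
Proof.
move=> /andP[b0 b1]; have := expR_ge1Dx (- b) => h.
have b2 : 0 < 1 - b by lra.
have e1 : expR b <= (1 - b)^-1.
  by rewrite -[expR b]invrK -expRN lef_pV2 ?posrE// expR_gt0.
have : (1 - b)^-1 <= 1 + b + 2 * b ^+ 2.
  rewrite -[leLHS]mul1r ler_pdivrMr//.
  rewrite -subr_ge0; have -> : (1 + b + 2 * b ^+ 2) * (1 - b) - 1 = b ^+ 2 * (1 - 2 * b) by ring.
  by rewrite mulr_ge0 ?sqr_ge0//; lra.
lra.
Qed.

Lemma expRN_add_le_quadratic (b : R) : 0 <= b -> expR (- b) + b <= 1 + 2 * b ^+ 2.
Proof.
move=> b0; have h := expR_ge1Dx b.
have b2 : 0 < 1 + b by lra.
have e1 : expR (- b) <= (1 + b)^-1 by rewrite expRN lef_pV2 ?posrE ?expR_gt0.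
have : (1 + b)^-1 <= 1 - b + 2 * b ^+ 2.
  rewrite -[leLHS]mul1r ler_pdivrMr//.
  rewrite -subr_ge0; have -> : (1 - b + 2 * b ^+ 2) * (1 + b) - 1 = b ^+ 2 * (1 + 2 * b) by ring.
  by rewrite mulr_ge0 ?sqr_ge0//; lra.
lra.
Qed.

Lemma expR_sub_le_gaussian (b : R) : 0 <= b -> expR b - b <= expR (2 * b ^+ 2).
Proof.
move=> b0; have [b1|b1] := leP b 2^-1.
  apply: le_trans (expR_sub_le_quadratic _) (expR_ge1Dx _); by rewrite b0.
(* For [b > 1/2] the exponents already compare: [b <= 2 b^2]. *)
apply: (@le_trans _ _ (expR b)); first by lra.
rewrite ler_expR expr2 mulrA -[leLHS]mul1r ler_wpM2r//; lra.
Qed.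

Lemma expRN_add_le_gaussian (b : R) : 0 <= b -> expR (- b) + b <= expR (2 * b ^+ 2).
Proof. by move=> b0; apply: le_trans (expRN_add_le_quadratic b0) (expR_ge1Dx _). Qed.

Section EuclideanNorm.
Context {K : finType}.
Implicit Types u v w : K -> R.

Definition vdot u v : R := \sum_k u k * v k.
Definition vnorm v : R := Num.sqrt (\sum_k v k ^+ 2).

Lemma vnorm_ge0 v : 0 <= vnorm v. Proof. exact: sqrtr_ge0. Qed.

Lemma sqr_vnorm v : vnorm v ^+ 2 = \sum_k v k ^+ 2.
Proof. by rewrite sqr_sqrtr// sumr_ge0// => k _; exact: sqr_ge0. Qed.

Lemma sqr_vnormD u v : vnorm (fun k => u k + v k) ^+ 2 =
  vnorm u ^+ 2 + 2 * vdot u v + vnorm v ^+ 2.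
Proof.
rewrite !sqr_vnorm /vdot mulr_sumr -!big_split; apply: eq_bigr => k _ /=; ring.
Qed.

Lemma vdot_cauchy u v : `|vdot u v| <= vnorm u * vnorm v.
Proof.
have h (t : R) : 0 <= vnorm u ^+ 2 + 2 * (t * vdot u v) + t ^+ 2 * vnorm v ^+ 2.
  have -> : t * vdot u v = vdot u (fun k => t * v k).
    by rewrite /vdot mulr_sumr; apply: eq_bigr => k _; ring.
  have -> : t ^+ 2 * vnorm v ^+ 2 = vnorm (fun k => t * v k) ^+ 2.
    by rewrite !sqr_vnorm mulr_sumr; apply: eq_bigr => k _; rewrite exprMn.
  by rewrite -sqr_vnormD sqr_ge0.
have u0 := vnorm_ge0 u; have v0 := vnorm_ge0 v.
have [vn0|vn0] := eqVneq (vnorm v) 0.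
  have [->|d0] := eqVneq (vdot u v) 0; first by rewrite normr0 mulr_ge0.
  have := h (- (vnorm u ^+ 2 + 1) / (2 * vdot u v)).
  rewrite vn0 expr0n mulr0 addr0.
  have -> : 2 * (- (vnorm u ^+ 2 + 1) / (2 * vdot u v) * vdot u v) = - (vnorm u ^+ 2 + 1) by field.
  lra.
have v1 : 0 < vnorm v by rewrite lt_def vn0.
have := h (- vdot u v / vnorm v ^+ 2).
have -> : vnorm u ^+ 2 + 2 * (- vdot u v / vnorm v ^+ 2 * vdot u v) +
    (- vdot u v / vnorm v ^+ 2) ^+ 2 * vnorm v ^+ 2 =
    ((vnorm u * vnorm v) ^+ 2 - vdot u v ^+ 2) / vnorm v ^+ 2 by field.
rewrite pmulr_lge0 ?invr_gt0 ?exprn_gt0// subr_ge0 -[vdot u v ^+ 2]real_normK ?num_real//.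
by rewrite ler_pXn2r// nnegrE ?mulr_ge0.
Qed.

(* Pointwise form of Pinelis' inequality; the factor of [vdot u w] depends on u
   only, so that this term vanishes upon averaging over a centered w. *)
Lemma coshR_vnormD u w (q : R) :
  expR (vnorm w) - vnorm w <= q -> expR (- vnorm w) + vnorm w <= q ->
  coshR (vnorm (fun k => u k + w k)) <=
  q * coshR (vnorm u) + (expR (vnorm u) - expR (- vnorm u)) / 2 / vnorm u * vdot u w.
Proof.
have u0 := vnorm_ge0 u; have w0 := vnorm_ge0 w.
have rE := sqr_vnormD u w; have sE := vdot_cauchy u w.
set r := vnorm (fun k => _) in rE *; move: rE sE u0 w0.
have : 0 <= r by exact: vnorm_ge0.
move: r (vnorm u) (vnorm w) (vdot u w) => r a b s r0 rE sE a0 b0 q1 q2.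
have [az|anz] := eqVneq a 0.
  have sz : s = 0 by apply/eqP; rewrite -normr_le0 (le_trans sE)// az mul0r.
  have -> : r = b.
    apply/eqP; rewrite -(@eqrXn2 _ 2)// rE az sz; apply/eqP; ring.
  by rewrite az sz mulr0 addr0 coshR0 mulr1 /coshR; lra.
have [bz|bnz] := eqVneq b 0.
  have sz : s = 0 by apply/eqP; rewrite -normr_le0 (le_trans sE)// bz mulr0.
  have -> : r = a.
    apply/eqP; rewrite -(@eqrXn2 _ 2)// rE bz sz; apply/eqP; ring.
  rewrite sz mulr0 addr0 -[leLHS]mul1r; apply: ler_wpM2r; first exact: coshR_ge0.
  by move: q1; rewrite bz expR0 subr0.
have ap : 0 < a by rewrite lt_def anz.
have bp : 0 < b by rewrite lt_def bnz.
(* The cosine of the angle between [u] and [w]: then [r^2] is the mean of [(a + b)^2] and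
   [(a - b)^2] with weights [(1 + e) / 2] and [(1 - e) / 2], the situation of
   [coshR_sqrt_convex]. *)
pose e := s / (a * b).
have e1 : -1 <= e <= 1.
  have : `|e| <= 1.
    rewrite normrM normfV ler_pdivrMr ?normr_gt0 ?mulf_neq0//.
    by rewrite mul1r [`|a * b|]ger0_norm ?mulr_ge0// ltW.
  by rewrite ler_norml.
have seE : s = e * (a * b) by rewrite /e divfK// mulf_neq0.
have := @coshR_sqrt_convex ((1 + e) / 2) r (a + b) (a - b).
case/andP: (e1) => em e2.
have -> : 0 <= (1 + e) / 2 <= 1 by lra.
move=> /(_ isT); rewrite rE seE => /(_ _)/le_trans; apply; first by field.
rewrite /coshR opprD opprB (addrC b (- a)) !expRD.
have -> : (expR a - expR (- a)) / 2 / a * (e * (a * b)) =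
    (expR a - expR (- a)) / 2 * e * b by field.
have A0 := expR_gt0 a; have A0' := expR_gt0 (- a).
move: (expR a) (expR (- a)) (expR b) (expR (- b)) A0 A0' q1 q2 => A A' B B' A0 A0' q1 q2.
rewrite -subr_ge0.
(* The difference of the two sides, as a nonnegative combination of the defects in [q1] and [q2]. *)
have -> : q * ((A + A') / 2) + (A - A') / 2 * e * b -
  ((1 + e) / 2 * ((A * B + A' * B') / 2) + (1 - (1 + e) / 2) * ((A * B' + A' * B) / 2)) =
  4^-1 * (A * ((1 + e) * (q - (B - b)) + (1 - e) * (q - (B' + b))) +
  A' * ((1 - e) * (q - (B - b)) + (1 + e) * (q - (B' + b)))) by field.
have x1 : 0 <= 1 + e by lra.
have x2 : 0 <= 1 - e by lra.
have y1 : 0 <= q - (B - b) by lra.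
have y2 : 0 <= q - (B' + b) by lra.
have z1 := mulr_ge0 x1 y1; have z2 := mulr_ge0 x2 y1.
have z3 := mulr_ge0 x1 y2; have z4 := mulr_ge0 x2 y2.
apply: mulr_ge0; first by rewrite invr_ge0.
by apply: addr_ge0; apply: mulr_ge0; solve [exact: ltW | exact: addr_ge0].
Qed.

End EuclideanNorm.
End HyperbolicCosine.

(** * Tail of a sum of independent centered vectors *)

Section VectorConcentration.
Context {R : realType}.

Lemma bmeas_sqrt d (U : measurableType d) (f : U -> R) :
  bmeas f -> bmeas (fun u => Num.sqrt (f u)).
Proof.
move=> [mf [M fM]]; split.
  apply: (measurableT_comp _ mf); apply: continuous_measurable_fun.
  exact: sqrt_continuous.
exists (Num.sqrt M) => u; rewrite ger0_norm ?sqrtr_ge0// ler_wsqrtr//.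
exact: le_trans (ler_norm _) (fM u).
Qed.

Lemma bmeas_vnorm d (U : measurableType d) (K : finType) (W : U -> K -> R) :
  (forall k, bmeas (fun u => W u k)) -> bmeas (fun u => vnorm (W u)).
Proof.
move=> bW; apply: bmeas_sqrt; apply: bmeas_sum => k _.
by apply: (eq_bmeas (bmeasM (bW k) (bW k))) => u; rewrite expr2.
Qed.

Lemma bmeas_coshR d (U : measurableType d) (f : U -> R) :
  bmeas f -> bmeas (fun u => coshR (f u)).
Proof.
move=> bf; have h c := bmeas_expR_scale c bf.
apply: (eq_bmeas (bmeasM (bmeasD (h 1) (h (-1))) (bmeas_cst 2^-1))) => u.
by rewrite mul1r mulN1r.
Qed.

Lemma bmeas_finer (T : pointedType) (G H : set (set T)) (F : T -> R) :
  <<s G>> `<=` <<s H>> ->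
  bmeas (F : g_sigma_algebraType G -> _) -> bmeas (F : g_sigma_algebraType H -> _).
Proof.
move=> GH [mF bF]; split => //.
apply: (@measurable_comp _ _ _ (g_sigma_algebraType H) (g_sigma_algebraType G) _ setT F _ idfun) => //.
by move=> _ A mA; rewrite setTI; exact: GH.
Qed.

Lemma bmeas_ambient d (T : measurableType d) (G : set (set T)) (F : T -> R) :
  <<s G>> `<=` measurable ->
  bmeas (F : g_sigma_algebraType G -> _) -> bmeas F.
Proof.
move=> GH [mF bF]; split => //.
apply: (@measurable_comp _ _ _ T (g_sigma_algebraType G) _ setT F _ idfun) => //.
by move=> _ A mA; rewrite setTI; exact: GH.
Qed.

Context {d} {T : measurableType d} (P : probability T R).
Context {I : finType} (G : I -> set (set T)).
Hypothesis Gs : forall i, sigma_algebra setT (G i).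
Hypothesis Gm : forall i, G i `<=` measurable.
Hypothesis Gind : mindep P G.
Context {K : finType} (W : I -> T -> K -> R) (q : I -> T -> R).
Hypothesis bW : forall i k, bmeas ((fun t => W i t k) : g_sigma_algebraType (G i) -> R).
Hypothesis bq : forall i, bmeas (q i).
Hypothesis EW : forall i k, \int[P]_t W i t k = 0.
Hypothesis Wq1 : forall i t, expR (vnorm (W i t)) - vnorm (W i t) <= q i t.
Hypothesis Wq2 : forall i t, expR (- vnorm (W i t)) + vnorm (W i t) <= q i t.

Let Eq0 i : 0 <= \int[P]_t q i t.
Proof.
apply: Rintegral_ge0 => t _; apply: le_trans (Wq2 i t).
by rewrite addr_ge0 ?expR_ge0// vnorm_ge0.
Qed.

Let bWT i k : bmeas (fun t => W i t k).
Proof. by apply: bmeas_ambient (@bW i k); rewrite g_sigma_id//; exact: Gm. Qed.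

(** Summands are removed one at a time: with the others frozen, [coshR_vnormD] applies and its
    linear term has mean zero, so each summand costs a factor [E q i]. *)
Lemma pinelis_seq (r : seq I) : uniq r ->
  \int[P]_t coshR (vnorm (fun k => \sum_(i <- r) W i t k)) <=
  \prod_(i <- r) \int[P]_t q i t.
Proof.
elim: r => [_|i r IH /= /andP[ir ur]].
  rewrite big_nil -[leRHS](probability_Rintegral_cst P).
  rewrite le_eqVlt; apply/orP; left; apply/eqP; apply: eq_Rintegral => t _.
  rewrite /vnorm big1 ?sqrtr0 ?coshR0// => k _.
  by rewrite big_nil expr0n.
rewrite big_cons; apply: le_trans (ler_wpM2l (Eq0 i) (IH ur)).
pose J := [set j in r]%SET.
have iJ : i \notin J by rewrite finset.inE.
pose S (t : T) k := \sum_(j <- r) W j t k.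
have bS k : bmeas ((fun t => S t k) : g_sigma_algebraType (joinG G J) -> R).
  apply: (@eq_bmeas _ _ (g_sigma_algebraType (joinG G J)) (fun t => \sum_(j <- r | j \in J) W j t k)).
    by apply: bmeas_sum => j jJ; exact: (bmeas_finer (G_joinG jJ) (@bW j k)).
  by move=> t; rewrite /S big_seq_cond [RHS]big_seq_cond; apply: eq_bigl => j; rewrite finset.inE andbb andbT.
have bST k : bmeas (fun t => S t k).
  by apply: bmeas_ambient (bS k); exact: joinG_measurable.
pose UU := (g_sigma_algebraType (G i) * g_sigma_algebraType (joinG G J))%type.
pose f (u : UU) := coshR (vnorm (fun k => S u.2 k + W i u.1 k)).
(* Constant in the first argument: [q i] is already averaged here. *)
pose g (u : UU) := (\int[P]_t q i t) * coshR (vnorm (S u.2)).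
have b2 k : bmeas (fun u : UU => S u.2 k).
  have [m1 [M hM]] := bS k; split; last by exists M.
  exact: (measurableT_comp m1 measurable_snd).
have b1 k : bmeas (fun u : UU => W i u.1 k).
  have [m1 [M hM]] := @bW i k; split; last by exists M.
  exact: (measurableT_comp m1 measurable_fst).
have bf : bmeas f by apply: bmeas_coshR; apply: bmeas_vnorm => k; exact: bmeasD.
have bg : bmeas g.
  by apply: bmeasM; [exact: bmeas_cst|apply: bmeas_coshR; exact: bmeas_vnorm].
have h (t2 : T) : \int[P]_t1 f (t1, t2) <= \int[P]_t1 g (t1, t2).
  pose c := (expR (vnorm (S t2)) - expR (- vnorm (S t2))) / 2 / vnorm (S t2).
  have bd : bmeas (fun t : T => vdot (S t2) (W i t)).
    by apply: bmeas_sum => k _; apply: bmeasM => //; exact: bmeas_cst.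
  apply: (@le_trans _ _ (\int[P]_t (coshR (vnorm (S t2)) * q i t + c * vdot (S t2) (W i t)))).
    apply: le_bRintegral.
    - apply: bmeas_coshR; apply: bmeas_vnorm => k; exact: (bmeasD (bmeas_cst (S t2 k)) (@bWT i k)).
    - by apply: bmeasD; apply: bmeasM => //; exact: bmeas_cst.
    - by move=> t; rewrite mulrC; apply: coshR_vnormD.
  rewrite bRintegralD; [|by apply: bmeasM => //; exact: bmeas_cst..].
  rewrite (bRintegralZl P _ (bq i)) (bRintegralZl P _ bd) /vdot bRintegral_sum; last first.
    by move=> k; apply: bmeasM => //; exact: bmeas_cst.
  rewrite big1 ?mulr0 ?addr0; last by move=> k _; rewrite bRintegralZl// EW mulr0.
  have -> : \int[P]_t1 g (t1, t2) = (\int[P]_t q i t) * coshR (vnorm (S t2)).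
    exact: (probability_Rintegral_cst P ((\int[P]_t q i t) * coshR (vnorm (S t2)))).
  by rewrite mulrC.
have bCS : bmeas (fun t : T => coshR (vnorm (S t))) by apply: bmeas_coshR; exact: bmeas_vnorm.
rewrite -[leRHS](bRintegralZl P _ bCS).
apply: le_trans (@family_decouple_le _ _ _ P _ G Gs Gm Gind J i f g iJ bf bg h).
rewrite le_eqVlt; apply/orP; left; apply/eqP; apply: eq_Rintegral => t _.
have -> : (fun k => \sum_(j <- i :: r) W j t k) = (fun k => S t k + W i t k).
  by apply/funext => k; rewrite big_cons addrC.
by [].
Qed.

Lemma pinelis : 
  \int[P]_t coshR (vnorm (fun k => \sum_i W i t k)) <= \prod_i \int[P]_t q i t.
Proof. exact: pinelis_seq (index_enum_uniq I). Qed.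

Lemma pinelis_tail (a Q : R) : \prod_i \int[P]_t q i t <= Q ->
  fine (P [set t | a <= vnorm (fun k => \sum_i W i t k)]) <= 2 * expR (- a) * Q.
Proof.
move=> hQ.
have bV : bmeas (fun t => vnorm (fun k => \sum_i W i t k)).
  by apply: bmeas_vnorm => k; apply: bmeas_sum.
have bC := bmeas_coshR bV.
have ea : 0 < expR a / 2 by rewrite divr_gt0 ?expR_gt0.
apply: (@le_trans _ _ ((expR a / 2)^-1 * \int[P]_t coshR (vnorm (fun k => \sum_i W i t k)))).
  apply: bmarkov => //; first exact: measurable_superlevel.
    by move=> t; exact: coshR_ge0.
  move=> t /= at_; rewrite ler_pdivrMr// mulrC.
  by apply: le_trans (coshR_expR _); rewrite ler_expR.
rewrite invf_div expRN; apply: ler_wpM2l; first by rewrite divr_ge0 ?expR_ge0.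
exact: le_trans pinelis hQ.
Qed.

End VectorConcentration.

(** * Recovery from a dual certificate *)

Section Recovery.
Context {R : realType}.
Local Notation C := R[i].

(** Serves for [|A_S u|^2 <= (1/2 + 1) |u|^2]; the factor 3/2 is relaxed to the square 4 to fit
    [opbound_n2]. *)
Lemma frame_upper_arith (a b x y z : R) : a <= z * x -> b <= z * y ->
  x <= 2^-1 * z -> y <= z -> 0 <= z -> a + b <= 2 ^+ 2 * z ^+ 2.
Proof.
move=> az bz xz yz z0; have h1 := ler_wpM2l z0 xz; have h2 := ler_wpM2l z0 yz.
have z2 := mulr_ge0 z0 z0; have e1 : z * (2^-1 * z) = 2^-1 * (z * z) by ring.
rewrite e1 in h1; rewrite !expr2; move: (z * z) h1 h2 z2 => zz h1 h2 z2; lra.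
Qed.

Lemma cabs_ge0 (z : C) : 0 <= cabs z. Proof. exact: sqrtr_ge0. Qed.

Lemma sqr_cabs (z : C) : cabs z ^+ 2 = complex.Re z ^+ 2 + complex.Im z ^+ 2.
Proof. by rewrite sqr_sqrtr// addr_ge0// sqr_ge0. Qed.

Lemma cabs0 : cabs (0 : C) = 0.
Proof. by rewrite /cabs /= !expr0n addr0 sqrtr0. Qed.

Lemma cabs_eq0 (z : C) : cabs z = 0 -> z = 0.
Proof.
move=> z0; have := sqr_cabs z; rewrite z0 expr0n => /esym/eqP.
rewrite paddr_eq0 ?sqr_ge0// !sqrf_eq0 => /andP[/eqP a /eqP b].
exact: complex_eq.
Qed.

Lemma cabsJ (z : C) : cabs (conjc z) = cabs z.
Proof. by rewrite /cabs cReJ cImJ sqrrN. Qed.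

Lemma cabsM (z w : C) : cabs (z * w) = cabs z * cabs w.
Proof.
rewrite /cabs -sqrtrM ?addr_ge0 ?sqr_ge0// cReM cImM; congr Num.sqrt; ring.
Qed.

Lemma Re_conjM_le (z w : C) :
  complex.Re z * complex.Re w + complex.Im z * complex.Im w <= cabs z * cabs w.
Proof.
have h : (complex.Re z * complex.Re w + complex.Im z * complex.Im w) ^+ 2 <=
    (cabs z * cabs w) ^+ 2.
  rewrite exprMn !sqr_cabs -subr_ge0.
  have -> : (complex.Re z ^+ 2 + complex.Im z ^+ 2) * (complex.Re w ^+ 2 + complex.Im w ^+ 2) -
    (complex.Re z * complex.Re w + complex.Im z * complex.Im w) ^+ 2 =
    (complex.Re z * complex.Im w - complex.Im z * complex.Re w) ^+ 2 by ring.
  exact: sqr_ge0.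
apply: le_trans (ler_norm _) _; rewrite -(@ler_pXn2r _ 2)// ?nnegrE ?mulr_ge0 ?cabs_ge0//.
by rewrite real_normK ?num_real.
Qed.

Lemma csgn_re (x : C) : complex.Re (csgn x) = complex.Re x / cabs x.
Proof. by rewrite /csgn cReM /= mulr0 subr0. Qed.

Lemma csgn_im (x : C) : complex.Im (csgn x) = complex.Im x / cabs x.
Proof. by rewrite /csgn cImM /= mulr0 add0r. Qed.

Lemma csgn0 : csgn (0 : C) = 0.
Proof. by rewrite /csgn mul0r. Qed.

Lemma cabs_csgn_le1 (x : C) : cabs (csgn x) ^+ 2 <= 1.
Proof.
have [x0|x0] := eqVneq (cabs x) 0.
  by rewrite (cabs_eq0 x0) csgn0 cabs0 expr0n ler01.
rewrite sqr_cabs csgn_re csgn_im !exprMn -mulrDl -sqr_cabs exprVn divff//.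
by rewrite expf_neq0.
Qed.

(** The sign is a subgradient of the modulus, also at [0], where [csgn] is [0]. *)
Lemma cabs_add_csgn (x v : C) : cabs x + (complex.Re (csgn x) * complex.Re v +
  complex.Im (csgn x) * complex.Im v) <= cabs (x + v).
Proof.
have [x0|x0] := eqVneq (cabs x) 0.
  rewrite (cabs_eq0 x0) csgn0 cabs0 add0r /= !mul0r !addr0; exact: cabs_ge0.
have xp : 0 < cabs x by rewrite lt_def x0 cabs_ge0.
rewrite -(ler_pM2l xp) csgn_re csgn_im.
apply: le_trans (Re_conjM_le x (x + v)); rewrite cReD cImD.
rewrite le_eqVlt; apply/orP; left; apply/eqP.
rewrite mulrDr -expr2 sqr_cabs; field.
by [].
Qed.

Definition n2 p q (M : 'M[C]_(p, q)) : R := Num.sqrt (nsq M).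

Lemma n2_ge0 p q (M : 'M[C]_(p, q)) : 0 <= n2 M. Proof. exact: sqrtr_ge0. Qed.

Lemma sqr_n2 p q (M : 'M[C]_(p, q)) : n2 M ^+ 2 = nsq M.
Proof. by rewrite sqr_sqrtr// nsq_ge0. Qed.

Lemma norm2E n (v : 'cV[C]_n) : norm2 v = n2 v.
Proof.
congr Num.sqrt; apply: eq_bigr => i _; rewrite big_ord1 sqr_cabs.
by [].
Qed.

Lemma rdot_le_n2 p q (M N : 'M[C]_(p, q)) : rdot M N <= n2 M * n2 N.
Proof.
apply: le_trans (ler_norm _) _; rewrite -(@ler_pXn2r _ 2)// ?nnegrE ?mulr_ge0 ?n2_ge0//.
by rewrite real_normK ?num_real// exprMn !sqr_n2 rdot_cauchy.
Qed.

Lemma n2D p q (M N : 'M[C]_(p, q)) : n2 (M + N) <= n2 M + n2 N.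
Proof.
rewrite -(@ler_pXn2r _ 2)// ?nnegrE ?addr_ge0 ?n2_ge0// sqr_n2 nsqD sqrrD !sqr_n2.
by have := rdot_le_n2 M N; rewrite lerD2r lerD2l mulr2n; lra.
Qed.

Lemma n2N p q (M : 'M[C]_(p, q)) : n2 (- M) = n2 M.
Proof. by rewrite /n2 -rdot_nsq rdotNl rdotNr opprK rdot_nsq. Qed.

Lemma n2_0 p q : n2 (0 : 'M[C]_(p, q)) = 0.
Proof.
rewrite /n2 /nsq big1 ?sqrtr0// => i _; rewrite big1// => j _.
by rewrite mxE /= expr0n addr0.
Qed.

Lemma n2_sum p q (I : Type) (r : seq I) (Q : pred I) (F : I -> 'M[C]_(p, q)) :
  n2 (\sum_(i <- r | Q i) F i) <= \sum_(i <- r | Q i) n2 (F i).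
Proof.
elim/big_rec2: _ => [|i y1 y2 _ h].
  by rewrite n2_0.
by apply: le_trans (n2D _ _) _; rewrite lerD2l.
Qed.

Lemma nsq_eq0 p q (M : 'M[C]_(p, q)) : nsq M = 0 -> M = 0.
Proof.
move=> M0; apply/matrixP => i j; rewrite mxE; apply: cabs_eq0; apply/eqP.
rewrite -sqrf_eq0 sqr_cabs eq_le addr_ge0 ?sqr_ge0// andbT -M0 /nsq.
rewrite (bigD1 i)//= (bigD1 j)//= -addrA lerDl addr_ge0//.
  by apply: sumr_ge0 => k _; rewrite addr_ge0// sqr_ge0.
by apply: sumr_ge0 => k _; apply: sumr_ge0 => l _; rewrite addr_ge0// sqr_ge0.
Qed.

Lemma nsqZc p q (c : C) (M : 'M[C]_(p, q)) : nsq (c *: M) = cabs c ^+ 2 * nsq M.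
Proof.
rewrite sqr_cabs /nsq mulr_sumr; apply: eq_bigr => i _; rewrite mulr_sumr.
by apply: eq_bigr => j _; rewrite mxE cReM cImM; ring.
Qed.

Lemma n2Zc p q (c : C) (M : 'M[C]_(p, q)) : n2 (c *: M) = cabs c * n2 M.
Proof. by rewrite /n2 nsqZc sqrtrM ?sqr_ge0// sqrtr_sqr ger0_norm ?cabs_ge0. Qed.

Lemma opbound_n2 p q r (M : 'M[C]_(p, q)) (a : R) (N : 'M[C]_(q, r)) :
  0 <= a -> opbound M (a ^+ 2) -> n2 (M *m N) <= a * n2 N.
Proof.
move=> a0 Ma; rewrite -(@ler_pXn2r _ 2)// ?nnegrE ?mulr_ge0 ?n2_ge0//.
by rewrite exprMn !sqr_n2; exact: opbound_mx.
Qed.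

Section Support.
Variables (n : nat) (S : {set 'I_n}).

(** Restriction to [S] as a projection, so that Gram matrices keep the format [n x n] whatever the
    size of [S]. *)
Definition projS : 'M[C]_n := rdiag (fun i => (i \in S)%:R).

Lemma projSE q (M : 'M[C]_(n, q)) i j : (projS *m M) i j = if i \in S then M i j else 0.
Proof. by rewrite mul_diag_mx !mxE; case: (i \in S); rewrite ?mul1r ?mul0r. Qed.

Lemma projS_herm : hermmx projS.
Proof.
apply/matrixP => i j; rewrite adjmxE !mxE eq_sym; case: eqP => [->|_].
  by rewrite !mulr1n /= oppr0.
by rewrite !mulr0n conjc0.
Qed.

Lemma projS_idem : projS *m projS = projS.
Proof.
apply/matrixP => i j; rewrite projSE; case: ifP => // iS.
by rewrite !mxE iS /= mul0rn.
Qed.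

Lemma nsq_projS q (M : 'M[C]_(n, q)) : nsq (projS *m M) <= nsq M.
Proof.
apply: ler_sum => i _; apply: ler_sum => j _; rewrite projSE; case: ifP => // _.
by rewrite /= expr0n addr0 addr_ge0// sqr_ge0.
Qed.

Variables (N : nat) (A : 'M[C]_(N, n)).
Definition gramS : 'M[C]_n := projS *m (adjmx A *m A) *m projS.
(* Invertible completion of A_S^* A_S, by the identity off S *)
Definition frameS : 'M[C]_n := 1%:M + (gramS - projS).
Local Notation G := frameS.
Local Notation H := (adjmx A *m A).

Hypothesis Ybound : opbound (gramS - projS) ((2^-1) ^+ 2).

Lemma gramS_herm : hermmx gramS.
Proof. by rewrite /hermmx /gramS !adjmx_mul projS_herm adjmxK !mulmxA. Qed.

Let half0 : 0 <= 2^-1 :> R. Proof. by rewrite invr_ge0. Qed.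

Let hY : hermmx (gramS - projS).
Proof. by apply: hermmxB; [exact: gramS_herm|exact: projS_herm]. Qed.

Let hG : hermmx G.
Proof. by apply: hermmxD => //; exact: adjmx1. Qed.

(** [Ybound] puts [G] within 1/2 of the identity in operator norm, so [G] loses at most half of
    [|w|]. *)
Lemma n2_le_frame q (w : 'M[C]_(n, q)) : n2 w <= 2 * n2 (G *m w).
Proof.
have := n2D (G *m w) (- ((gramS - projS) *m w)).
rewrite n2N {1}/frameS mulmxDl mul1mx addrK.
have := opbound_n2 w half0 Ybound.
by move: (n2 (_ *m w)) (n2 (w + _)) => a b; lra.
Qed.

Lemma frame_unit : G \in unitmx.
Proof.
rewrite -row_free_unit -kermx_eq0; apply/eqP.
(* [kermx] is the left kernel; as [G] is Hermitian, its adjoint consists of right kernel vectors, to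
   which [n2_le_frame] applies. *)
have GK : G *m adjmx (kermx G) = 0.
  transitivity (adjmx (kermx G *m G)); first by rewrite (adjmx_mul (kermx G) G) hG.
  by rewrite mulmx_ker; apply/matrixP => i j; rewrite adjmxE !mxE rmorph0.
have := n2_le_frame (adjmx (kermx G)); rewrite GK n2_0 mulr0 => h.
have : nsq (kermx G) = 0.
  apply/eqP; rewrite -nsq_adj -sqr_n2 sqrf_eq0; apply/eqP/le_anti.
  by rewrite h n2_ge0.
exact: nsq_eq0.
Qed.

Lemma n2_inv_frame q (w : 'M[C]_(n, q)) : n2 (invmx G *m w) <= 2 * n2 w.
Proof. by have := n2_le_frame (invmx G *m w); rewrite mulKVmx// frame_unit. Qed.

Lemma gramS_frame q (w : 'M[C]_(n, q)) : projS *m w = w -> gramS *m w = G *m w.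
Proof. by move=> Qw; rewrite /frameS mulmxDl mulmxBl Qw mul1mx addrC subrK. Qed.

(** [G] is block diagonal for [S] and its complement, with the identity off [S], and so is its
    inverse. *)
Lemma inv_frame_supp q (w : 'M[C]_(n, q)) :
  projS *m w = w -> projS *m (invmx G *m w) = invmx G *m w.
Proof.
move=> Qw; set u := invmx G *m w.
have Gu : G *m u = w by rewrite /u mulKVmx// frame_unit.
have QG : projS *m G = gramS.
  by rewrite /frameS mulmxDr mulmx1 mulmxBr projS_idem /gramS !mulmxA projS_idem addrC subrK.
have : G *m u = gramS *m u by rewrite -QG -mulmxA Gu.
rewrite {1}/frameS mulmxDl mul1mx mulmxBl addrA => /eqP.
by rewrite subr_eq addrC => /eqP/addrI.
Qed.

Variables (sg : 'cV[C]_n).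
Hypothesis sgS : projS *m sg = sg.

Let w := invmx G *m sg.
Let h := A *m w.

Let Qw : projS *m w = w. Proof. exact: inv_frame_supp. Qed.

Let gw : gramS *m w = sg.
Proof. by rewrite gramS_frame// mulKVmx// frame_unit. Qed.

(** [|h|^2 = <w, gramS w> = <w, sg>], at most [2 |sg|^2] by [n2_inv_frame]. *)
Lemma n2_certificate : n2 h <= 2 * n2 sg.
Proof.
have hE : nsq h = rdot w sg.
  transitivity (rdot w (gramS *m w)); last by rewrite gw.
  rewrite /gramS -!mulmxA Qw -{1}projS_herm -rdotMl Qw -rdotMl.
  by rewrite rdot_nsq.
have : n2 h ^+ 2 <= (2 * n2 sg) ^+ 2.
  rewrite sqr_n2 hE; apply: le_trans (rdot_le_n2 _ _) _.
  apply: le_trans (ler_wpM2r (n2_ge0 _) (n2_inv_frame sg)) _.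
  rewrite exprMn expr2 mulrA; have := sqr_ge0 (n2 sg); move: (n2 sg) => a; nra.
by rewrite ler_pXn2r// nnegrE ?mulr_ge0 ?n2_ge0.
Qed.

Lemma certificate_on_S i : i \in S -> (adjmx A *m h) i 0 = sg i 0.
Proof.
by move=> iS; have /matrixP/(_ i 0) := gw; rewrite /gramS -!mulmxA projSE iS Qw => ->.
Qed.

(** The part of [v] on [S] is recovered up to a factor 2 from its image under [gramS], which is
    [A_S^* A v] minus the contribution of the coordinates off [S]; for the part off [S] the
    Euclidean norm is below the [l^1] norm. *)
Lemma n2_gram_split (v : 'cV[C]_n) (b : R) : 0 <= b ->
  (forall j, j \notin S -> n2 (projS *m H *m (delta_mx j 0 : 'cV[C]_n)) <= b) ->
  n2 v <= 4 * n2 (A *m v) + (2 * b + 1) * \sum_(j | j \notin S) cabs (v j 0).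
Proof.
move=> b0 Hb; set t := \sum_(j | _) _.
have vE : v = projS *m v + \sum_(j | j \notin S) v j 0 *: delta_mx j 0.
  apply/matrixP => i k; rewrite mxE projSE summxE !ord1.
  case: ifP => iS.
    rewrite big1 ?addr0// => j jS; rewrite !mxE; case: eqP => [ij|]; last by rewrite mulr0.
    by rewrite -ij iS in jS.
  rewrite add0r (bigD1 i) ?iS//= big1 ?addr0; first by rewrite !mxE !eqxx mulr1.
  move=> j /andP[_ ji]; rewrite !mxE eq_sym (negbTE ji) /= mulr0.
  by [].
set v2 := \sum_(j | _) _ *: _ in vE.
have d1 j : n2 (delta_mx j 0 : 'cV[C]_n) = 1.
  rewrite /n2 /nsq (bigD1 j)//= big_ord1 !mxE !eqxx /= expr1n expr0n addr0 big1 ?addr0 ?sqrtr1//.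
  by move=> i ij; rewrite big_ord1 !mxE (negbTE ij) /= expr0n addr0.
have v2t : n2 v2 <= t.
  apply: le_trans (n2_sum _ _ _) _; apply: ler_sum => j _.
  by rewrite n2Zc d1 mulr1.
have Hv2 : n2 (projS *m H *m v2) <= b * t.
  rewrite mulmx_sumr mulr_sumr; apply: le_trans (n2_sum _ _ _) _.
  apply: ler_sum => j jS; rewrite -scalemxAr n2Zc mulrC.
  by apply: ler_wpM2r; [exact: cabs_ge0|exact: Hb].
have AQ : opbound (A *m projS) (2 ^+ 2).
  move=> u; rewrite -rdot_nsq rdotMl adjmx_mul projS_herm.
  have -> : projS *m adjmx A *m (A *m projS *m u) = (gramS - projS) *m u + projS *m u.
    by rewrite -mulmxDl subrK /gramS !mulmxA.
  rewrite rdotDr -sqr_n2.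
  have l1 := rdot_le_n2 u ((gramS - projS) *m u).
  have l2 := rdot_le_n2 u (projS *m u).
  have l3 : n2 ((gramS - projS) *m u) <= 2^-1 * n2 u.
    exact: opbound_n2 Ybound.
  have l4 : n2 (projS *m u) <= n2 u by apply: ler_wsqrtr; exact: nsq_projS.
  have u0 := n2_ge0 u.
  exact: (frame_upper_arith l1 l2 l3 l4 u0).
have Qv : n2 (projS *m v) <= 4 * n2 (A *m v) + 2 * (b * t).
  apply: le_trans (n2_le_frame _) _.
  rewrite -gramS_frame; last by rewrite mulmxA projS_idem.
  have -> : gramS *m (projS *m v) = projS *m adjmx A *m (A *m v) - projS *m H *m v2.
    rewrite /gramS !mulmxA -(mulmxA _ projS projS) projS_idem -!mulmxA -mulmxBr -mulmxBr -mulmxBr.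
    by congr (_ *m (_ *m (_ *m _))); rewrite [in RHS]vE addrK.
  have := n2D (projS *m adjmx A *m (A *m v)) (- (projS *m H *m v2)).
  rewrite n2N.
  have : n2 (projS *m adjmx A *m (A *m v)) <= 2 * n2 (A *m v).
    apply: opbound_n2 => //.
    have := opbound_adj _ AQ; rewrite adjmx_mul projS_herm; apply.
    by rewrite exprn_ge0.
  by move: (n2 _) (n2 _) (n2 _) (n2 _) Hv2 => *; lra.
have := n2D (projS *m v) v2; rewrite -vE.
move: (n2 _) (n2 _) (n2 _) (n2 _) Qv v2t => *; lra.
Qed.

(** The certificate cleared of its denominator, since [\adj G] is [\det G] times the inverse of
    [G]. *)
Lemma det_certificate j :
  (H *m projS *m \adj G *m sg) j 0 = \det G * (adjmx A *m h) j 0.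
Proof.
have -> : \adj G = \det G *: invmx G.
  by rewrite /invmx frame_unit scalerA divrr ?scale1r// -unitmxE frame_unit.
rewrite -scalemxAr -scalemxAl mxE; congr (_ * _).
by rewrite -!mulmxA -/w inv_frame_supp.
Qed.

(** With [v = z - x] and [t] its [l^1] mass off [S], minimality gives [t <= - <sg, v>]. The
    certificate [u = A^* h] equals [sg] on [S] and is at most 3/4 off it, so [t / 4 <= - <u, v> = -
    <h, A v> <= 4 |sg| eta]. Then [n2_gram_split] with [b = 1/8] yields
    [4 * 2 eta + (5/4) 16 |sg| eta]. *)
Lemma recovery (x z : 'cV[C]_n) (noise : 'cV[C]_N) (eta : R) :
  0 <= eta -> projS *m x = x -> sg = map_mx (@csgn R) x ->
  (forall j, j \notin S -> nsq (projS *m H *m (delta_mx j 0 : 'cV[C]_n)) <= (8^-1) ^+ 2) ->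
  (forall j, j \notin S ->
    cabs ((H *m projS *m \adj G *m sg) j 0) <= 3 / 4 * cabs (\det G)) ->
  n2 noise <= eta -> n2 (A *m x + noise - A *m z) <= eta -> norm1 z <= norm1 x ->
  n2 (x - z) <= (8 + 20 * n2 sg) * eta.
Proof.
move=> eta0 Qx sgE Hb Hu Hnoise Hz zx.
pose v := z - x.
have Av : n2 (A *m v) <= 2 * eta.
  have -> : A *m v = noise + - (A *m x + noise - A *m z).
    by rewrite [_ *m x + noise]addrC -addrA opprD addrA subrr add0r opprB /v mulmxBr.
  by apply: le_trans (n2D _ _) _; rewrite n2N; lra.
set t := \sum_(j | j \notin S) cabs (v j 0).
have tE : t = \sum_i if i \notin S then cabs (v i 0) else 0 by rewrite /t big_mkcond.
have t0 : 0 <= t by apply: sumr_ge0 => j _; exact: cabs_ge0.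
pose u := adjmx A *m h.
have uj j : j \notin S -> cabs (u j 0) <= 3 / 4.
  move=> jS; have := Hu j jS; rewrite det_certificate -/u.
  have d0 : 0 < cabs (\det G).
    rewrite lt_def cabs_ge0 andbT; apply/eqP => /cabs_eq0 d0.
    by have := frame_unit; rewrite unitmxE d0 unitr0.
  by rewrite cabsM mulrC ler_pM2r.
have rdotc (a c : 'cV[C]_n) : rdot a c = \sum_i (complex.Re (a i 0) * complex.Re (c i 0)
    + complex.Im (a i 0) * complex.Im (c i 0)).
  by apply: eq_bigr => i _; rewrite big_ord1.
have off (a : 'cV[C]_n) i : projS *m a = a -> i \notin S -> a i 0 = 0.
  by move=> <- iS; rewrite projSE (negbTE iS).
(* Coordinatewise: the subgradient inequality on [S]; off [S], where [x] vanishes, all of [|v_i|] is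
   gained. *)
have cone : t <= - rdot sg v.
  suff h1 : norm1 x + rdot sg v + t <= norm1 z by move: (le_trans h1 zx); lra.
  rewrite rdotc tE /norm1 -!big_split/=; apply: ler_sum => i _.
  have zi : z i 0 = x i 0 + v i 0 by rewrite /v !mxE addrCA subrr addr0.
  rewrite zi sgE mxE; case: ifP => iS; last by rewrite addr0; exact: cabs_add_csgn.
  rewrite (off x)// csgn0 cabs0 /= !mul0r !add0r.
  by [].
have ut : - rdot u v <= 2 * n2 sg * (2 * eta).
  rewrite /u rdotMl adjmxK -rdotNr; apply: le_trans (rdot_le_n2 _ _) _.
  by apply: ler_pM; rewrite ?n2N//; [exact: n2_ge0|exact: n2_ge0|exact: n2_certificate].
have uv : - rdot sg v <= - rdot u v + 3 / 4 * t.
  suff : rdot u v <= rdot sg v + 3 / 4 * t by move: (rdot u v) (rdot sg v) => *; lra.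
  rewrite !rdotc tE mulr_sumr -big_split/=; apply: ler_sum => i _.
  case: ifP => iS.
    rewrite (off sg)// /= !mul0r !addr0 ?add0r.
    apply: le_trans (Re_conjM_le _ _) _; apply: ler_wpM2r; first exact: cabs_ge0.
    exact: uj.
  by move/negbFE: iS => iS; rewrite /u certificate_on_S// mulr0 addr0.
have tle : t <= 16 * n2 sg * eta by move: cone ut uv; move: (rdot _ _) (rdot _ _) (n2 sg) => *; lra.
rewrite -n2N opprB -/v.
have b0 : 0 <= 8^-1 :> R by rewrite invr_ge0.
apply: le_trans (n2_gram_split v b0 _) _.
  move=> j jS; rewrite -(@ler_pXn2r _ 2)// ?nnegrE ?n2_ge0// sqr_n2; exact: Hb.
rewrite -/t; have := n2_ge0 sg; move: (n2 (A *m v)) (n2 sg) Av tle => a c Av tle c0.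
have := ler_wpM2l (_ : 0 <= 2 * 8^-1 + 1 :> R) tle => /(_ _).
have -> : 0 <= 2 * 8^-1 + 1 :> R by lra.
move=> /(_ isT); nra.
Qed.

End Support.
End Recovery.

(** * Deviation bounds for the blocks and the signs *)

Section ExponentialBounds.
Context {R : realType}.

(** By the quadratic majorant at 1/2. A coarse bound is enough: later only [e <= 199/20] and
    [e <= 6] matter. *)
Lemma expR1_le4 : expR 1 <= 4 :> R.
Proof.
have h : expR (2^-1) <= 2 :> R.
  have h01 : 0 <= (2^-1 : R) <= 2^-1 by lra.
  have := expR_sub_le_quadratic h01; rewrite (_ : (2^-1) ^+ 2 = 4^-1 :> R); last by field.
  lra.
have -> : expR 1 = expR 2^-1 * expR 2^-1 :> R by rewrite -expRD; congr expR; field.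
by apply: (le_trans (ler_pM _ _ h h)); rewrite ?expR_ge0//; lra.
Qed.

Lemma prod_le_expR (I : finType) (a : I -> R) (c b : R) :
  0 <= c -> (forall i, 0 <= a i) -> \sum_i a i <= b ->
  \prod_i (1 + c * a i) <= expR (c * b).
Proof.
move=> c0 a0 ab; apply: (@le_trans _ _ (expR (\sum_i c * a i))).
  rewrite expR_sum; apply: ler_prod => i _.
  by rewrite addr_ge0 ?mulr_ge0//= expR_ge1Dx.
by rewrite ler_expR -mulr_sumr ler_wpM2l.
Qed.

End ExponentialBounds.

Section GramConcentration.
Context {R : realType} {d} {T : measurableType d} (P : probability T R).
Context {I : finType} (G : I -> set (set T)).
Hypothesis Gs : forall i, sigma_algebra setT (G i).
Hypothesis Gm : forall i, G i `<=` measurable.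
Hypothesis Gind : mindep P G.
Local Notation C := R[i].
Variables (n : nat) (S : {set 'I_n}) (p : I -> nat).
Variables (A : forall i, T -> 'M[C]_(p i, n)) (H : I -> T -> 'M[C]_n) (K L : R).
Hypothesis bA : forall i, mbmeas (A i : g_sigma_algebraType (G i) -> _).
Hypothesis bH : forall i, mbmeas (H i : g_sigma_algebraType (G i) -> _).
Hypothesis K0 : 0 <= K.
Hypothesis AK : forall i t, opbound (A i t) K.
Hypothesis AH : forall i t, adjmx (A i t) *m A i t = H i t *m projS S.
Hypothesis HK : forall i t j, nsq (col j (H i t)) <= K ^+ 2.
Hypothesis EH : \sum_i Emx P (H i) = projS S.
Hypothesis VH : forall j, j \notin S -> \sum_i \int[P]_t nsq (col j (H i t)) <= K.
Hypothesis L1 : 1 <= L.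
Hypothesis KL : 889 * K * L ^+ 2 <= 1.

Let bHT i : mbmeas (H i).
Proof. by apply: mbmeas_ambient (@bH i); rewrite g_sigma_id//; exact: Gm. Qed.

Lemma mulmx_projSE q (M : 'M[C]_(q, n)) i j :
  (M *m projS S) i j = if j \in S then M i j else 0.
Proof. by rewrite mulmx_rdiagE; case: (j \in S); rewrite ?mulr1 ?mulr0. Qed.

Let EX : \sum_i Emx P (fun t => H i t *m projS S) = projS S.
Proof.
have -> : \sum_i Emx P (fun t => H i t *m projS S) = (\sum_i Emx P (H i)) *m projS S.
  rewrite mulmx_suml; apply: eq_bigr => i _; apply/matrixP => a b.
  rewrite mulmx_projSE !mxE; case: ifP => bS.
    by congr (_ +i* _)%C; apply: eq_Rintegral => t _; rewrite mulmx_projSE bS.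
  apply: complex_eq => /=; rewrite -[RHS](probability_Rintegral_cst P);
    by apply: eq_Rintegral => t _; rewrite mulmx_projSE bS.
by rewrite EH projS_idem.
Qed.

Let bY : mbmeas (fun t => (\sum_i H i t) *m projS S - projS S).
Proof.
apply: mbmeasB; last exact: mbmeas_cst.
apply: mbmeas_mul; last exact: mbmeas_cst.
by apply: mbmeas_sum => i _; exact: bHT.
Qed.

(** At [k = 1/200] the moment is at most [n (5/199)^N], and Markov's inequality multiplies it by
    [4^N]; since [20/199] is below [1/e], about [L] steps of the recursion give [e^-L]. *)
Lemma gram_deviation (N : nat) : L <= N%:R -> N%:R <= L + 1 ->
  fine (P [set t | (4^-1) ^+ N <= nsq (mxpow ((\sum_i H i t) *m projS S - projS S) N)])
    <= n%:R * expR (- L).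
Proof.
move=> LN NL; set Y := fun t => (\sum_i H i t) *m projS S - projS S.
have L0 : 0 < L by exact: lt_le_trans ltr01 L1.
have L1' := L1.
(* [2 N <= 2 (L + 1) <= 4 L] and [L <= L^2], so the bound is [4 / 889]. *)
have NK : (N + N)%:R * K <= 200^-1.
  have h1 : (N + N)%:R * K <= 4 * L * K.
    by rewrite ler_wpM2r// natrD; lra.
  apply: le_trans h1 _.
  have h2 : L * K <= L ^+ 2 * K by rewrite ler_wpM2r// expr2 ler_peMr// ltW.
  have : 889 * (L ^+ 2 * K) <= 1 by rewrite [L ^+ 2 * K]mulrC mulrA.
  by move: h2; rewrite -mulrA; move: (L * K) (L ^+ 2 * K) => *; lra.
have k01 : 0 <= (200^-1 : R) < 1 by lra.
have bN : bmeas (fun t => nsq (mxpow (Y t) N)) by apply: bmeas_nsq; exact: mbmeas_pow.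
have := @gram_moment _ _ _ P _ G Gs Gm Gind n p A K (projS S) bA K0 AK
  (fun i t => H i t *m projS S) Y.
move=> /(_ (fun i t => esym (AH i t))) h.
have {h} := h (fun t => _) (projS_herm S) (projS_idem S) EX N 200^-1 k01 NK.
have YE t : Y t = \sum_i H i t *m projS S - projS S by rewrite /Y mulmx_suml.
move=> /(_ YE) mom.
have a0 : 0 < (4^-1 : R) ^+ N by rewrite exprn_gt0// invr_gt0.
apply: le_trans (bmarkov P (measurable_superlevel _ bN) bN (fun t => nsq_ge0 _) a0 (fun t => id)) _.
apply: le_trans (ler_wpM2l _ mom) _; first by rewrite invr_ge0 ltW.
rewrite -exprVn invrK mulrA -exprMn mulrC ler_wpM2l//.
apply: (@le_trans _ _ (expR (-1) ^+ N)).
  have -> : 4 * (5 / 200 / (1 - 200^-1)) = 20 / 199 :> R by field.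
  rewrite lerXn2r ?nnegrE ?expR_ge0 ?divr_ge0//.
  rewrite expRN -[leLHS]invrK lef_pV2 ?posrE ?expR_gt0 ?invr_gt0 ?divr_gt0//.
  by apply: le_trans expR1_le4 _; rewrite invf_div; lra.
by rewrite -expRM_natl ler_expR mulrN mulr1; lra.
Qed.

(** A single block need not be centered, since isotropy holds only on average; each is centered
    separately, and the means cancel in the sum because column [j] of [projS S] vanishes. *)
Lemma row_deviation j : j \notin S ->
  fine (P [set t | (64 * L)^-1 <= nsq (col j (\sum_i H i t))]) <= 2 * expR (- L).
Proof.
move=> jS; have L0 : 0 < L by exact: lt_le_trans ltr01 L1.
have L1' := L1.
pose s := Num.sqrt L.
have s0 : 0 < s by rewrite sqrtr_gt0.
have sL : s ^+ 2 = L by rewrite sqr_sqrtr// ltW.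
(* Parameter of the exponential moment: it turns the length [1 / (8 sqrt L)] into [2 L] and costs
   the exponent [2 la^2 K = 512 L (K L^2) <= L], which leaves [e^(-2L) e^L]. *)
pose la := 16 * L * s.
have la0 : 0 <= la by rewrite !mulr_ge0// ltW.
(* The complex column becomes a real vector; the boolean selects real or imaginary part. *)
pose f (kb : 'I_n * bool) i t := if kb.2 then complex.Re (H i t kb.1 j) else complex.Im (H i t kb.1 j).
pose W i t (kb : 'I_n * bool) := la * (f kb i t - \int[P]_t' f kb i t').
have bf i kb : bmeas ((f kb i) : g_sigma_algebraType (G i) -> R).
  by have [b1 b2] := @bH i kb.1 j; rewrite /f; case: kb.2.
have bfT i kb : bmeas (f kb i).
  by have [b1 b2] := @bHT i kb.1 j; rewrite /f; case: kb.2.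
have sumK (F : 'I_n * bool -> R) : \sum_kb F kb = \sum_k (F (k, true) + F (k, false)).
  rewrite (eq_bigr (fun kb => F (kb.1, kb.2))); last by case.
  by rewrite -(pair_bigA _ (fun k b => F (k, b))); apply: eq_bigr => k _; rewrite big_bool.
have nsqcol (M : 'M[C]_n) : nsq (col j M) =
    \sum_kb (if kb.2 then complex.Re (M kb.1 j) else complex.Im (M kb.1 j)) ^+ 2.
  by rewrite sumK; apply: eq_bigr => k _; rewrite big_ord1 !mxE.
have nsqf i t : nsq (col j (H i t)) = \sum_kb f kb i t ^+ 2 by rewrite nsqcol.
have bf2 i kb : bmeas (fun t => f kb i t ^+ 2).
  by apply: (eq_bmeas (bmeasM (bfT i kb) (bfT i kb))) => t; rewrite expr2.
have var i kb : \int[P]_t (f kb i t - \int[P]_t' f kb i t') ^+ 2 =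
    \int[P]_t (f kb i t ^+ 2) - (\int[P]_t f kb i t) ^+ 2.
  set m := \int[P]_t f kb i t.
  have E t : (f kb i t - m) ^+ 2 = f kb i t ^+ 2 + ((- 2 * m) * f kb i t + m ^+ 2).
    by move: (f kb i t) => y; ring.
  under eq_Rintegral do rewrite E.
  rewrite bRintegralD//; last first.
    by apply: bmeasD; [apply: bmeasM => //; exact: bmeas_cst|exact: bmeas_cst].
  rewrite bRintegralD; [|by apply: bmeasM => //; exact: bmeas_cst|exact: bmeas_cst].
  rewrite bRintegralZl// probability_Rintegral_cst -/m; ring.
have bdev i kb : bmeas (fun t => (f kb i t - \int[P]_t' f kb i t') ^+ 2).
  apply: (eq_bmeas (bmeasM (bmeasB (bfT i kb) (bmeas_cst _)) (bmeasB (bfT i kb) (bmeas_cst (\int[P]_t' f kb i t'))))) => t.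
  by rewrite expr2.
have mean_sqr i kb : (\int[P]_t f kb i t) ^+ 2 <= \int[P]_t (f kb i t ^+ 2).
  rewrite -subr_ge0 -var; apply: Rintegral_ge0 => t _; exact: sqr_ge0.
have Wn i t : vnorm (W i t) ^+ 2 =
    la ^+ 2 * \sum_kb (f kb i t - \int[P]_t' f kb i t') ^+ 2.
  by rewrite sqr_vnorm mulr_sumr; apply: eq_bigr => kb _; rewrite exprMn.
have la2 : la ^+ 2 = 256 * L ^+ 3 by rewrite /la !exprMn sL; ring.
have mean_nsq i : \sum_kb \int[P]_t (f kb i t ^+ 2) = \int[P]_t nsq (col j (H i t)).
  by rewrite -bRintegral_sum//; apply: eq_Rintegral => t _; rewrite nsqf.
have bcol i : bmeas (fun t => nsq (col j (H i t))).
  by apply: bmeas_nsq => a b; apply: (eq_cbmeas (@bHT i a j)) => t; rewrite mxE.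
have dev4 i t : \sum_kb (f kb i t - \int[P]_t' f kb i t') ^+ 2 <= 4 * K ^+ 2.
  apply: (@le_trans _ _ (2 * nsq (col j (H i t)) + 2 * \int[P]_t nsq (col j (H i t)))).
    rewrite nsqf -mean_nsq !mulr_sumr -big_split/=; apply: ler_sum => kb _.
    apply: (@le_trans _ _ (2 * f kb i t ^+ 2 + 2 * (\int[P]_t' f kb i t') ^+ 2)).
      move: (f kb i t) (\int[P]_t' f kb i t') => y m; have := sqr_ge0 (y + m).
      by rewrite sqrrD sqrrB; lra.
    by rewrite lerD2l ler_wpM2l.
  have h1 := HK i t j.
  have : \int[P]_t nsq (col j (H i t)) <= K ^+ 2.
    rewrite -[leRHS](probability_Rintegral_cst P); apply: le_bRintegral => //.
    exact: bmeas_cst.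
  by move: h1; move: (nsq _) (\int[P]_t nsq _) => *; lra.
have KL2 : K * L ^+ 2 <= 889^-1.
  by have := KL; rewrite -mulrA; move: (K * L ^+ 2) => y; lra.
(* [la^2 * 4 K^2 = 1024 L^3 K^2 <= 1024 (K L^2)^2], at most 1/4 as [K L^2 <= 1/889 < 1/64]. This is
   the range of [expR_sub_le_quadratic]. *)
have Wh i t : 0 <= vnorm (W i t) <= 2^-1.
  rewrite vnorm_ge0/= -(@ler_pXn2r _ 2)// ?nnegrE ?vnorm_ge0// ?invr_ge0// Wn la2.
  apply: (@le_trans _ _ (256 * L ^+ 3 * (4 * K ^+ 2))).
    apply: ler_wpM2l (dev4 i t); apply: mulr_ge0; first by rewrite ler0n.
    by apply: exprn_ge0; exact: ltW.
  have : (K * L ^+ 2) ^+ 2 <= 64^-1 * 64^-1.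
    have k0 := mulr_ge0 K0 (sqr_ge0 L); rewrite expr2; apply: ler_pM => //;
      by apply: le_trans KL2 _; lra.
  have : L ^+ 3 * K ^+ 2 <= (K * L ^+ 2) ^+ 2.
    rewrite exprMn mulrC -exprM ler_wpM2l ?sqr_ge0// ler_weXn2l//.
  have -> : (2^-1 : R) ^+ 2 = 4^-1 by field.
  have -> : 256 * L ^+ 3 * (4 * K ^+ 2) = 1024 * (L ^+ 3 * K ^+ 2) by ring.
  by move: (L ^+ 3 * K ^+ 2) ((K * L ^+ 2) ^+ 2) => *; lra.
pose q i t := 1 + 2 * vnorm (W i t) ^+ 2.
have bq i : bmeas (q i).
  apply: bmeasD; first exact: bmeas_cst.
  apply: bmeasM; first exact: bmeas_cst.
  apply: (@eq_bmeas _ _ _ (fun t => la ^+ 2 * \sum_kb (f kb i t - \int[P]_t' f kb i t') ^+ 2)).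
    apply: bmeasM; first exact: bmeas_cst.
    by apply: bmeas_sum.
  by move=> t; rewrite Wn.
have bW i k : bmeas ((fun t => W i t k) : g_sigma_algebraType (G i) -> R).
  apply: bmeasM; first exact: bmeas_cst.
  by apply: bmeasB => //; exact: bmeas_cst.
have EW i k : \int[P]_t W i t k = 0.
  rewrite /W bRintegralZl; last by apply: bmeasB => //; exact: bmeas_cst.
  rewrite bRintegralB//; last exact: bmeas_cst.
  by rewrite probability_Rintegral_cst subrr mulr0.
have Wq1 i t : expR (vnorm (W i t)) - vnorm (W i t) <= q i t by exact: expR_sub_le_quadratic.
have Wq2 i t : expR (- vnorm (W i t)) + vnorm (W i t) <= q i t.
  by apply: expRN_add_le_quadratic; exact: vnorm_ge0.
have prodq : \prod_i \int[P]_t q i t <= expR L.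
  apply: (@le_trans _ _ (\prod_i (1 + (2 * la ^+ 2) * \int[P]_t nsq (col j (H i t))))).
    apply: ler_prod => i _; rewrite Rintegral_ge0/=; last first.
      by move=> t _; rewrite addr_ge0// mulr_ge0// sqr_ge0.
    have bs : bmeas (fun t => \sum_kb (f kb i t - \int[P]_t' f kb i t') ^+ 2) by exact: bmeas_sum.
    have qE t : q i t = 1 + 2 * la ^+ 2 * \sum_kb (f kb i t - \int[P]_t' f kb i t') ^+ 2.
      by rewrite /q Wn mulrA.
    under eq_Rintegral do rewrite qE.
    rewrite bRintegralD; [|exact: bmeas_cst|by apply: bmeasM => //; exact: bmeas_cst].
    rewrite probability_Rintegral_cst lerD2l bRintegralZl//; apply: ler_wpM2l.
      by apply: mulr_ge0; [rewrite ler0n|exact: sqr_ge0].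
    rewrite bRintegral_sum// -mean_nsq; apply: ler_sum => kb _.
    by rewrite var gerBl sqr_ge0.
  apply: le_trans (prod_le_expR _ _ (VH jS)) _.
  - by rewrite mulr_ge0// sqr_ge0.
  - by move=> i; apply: Rintegral_ge0 => t _; exact: nsq_ge0.
  rewrite ler_expR la2.
  have -> : 2 * (256 * L ^+ 3) * K = 512 * L * (K * L ^+ 2) by ring.
  have := ler_wpM2l (ltW L0) KL2; rewrite -(mulrA 512).
  by have := L0; move: (L * (K * L ^+ 2)) => y; lra.
apply: le_trans (_ : _ <= 2 * expR (- (2 * L)) * expR L) _; last first.
  by rewrite -mulrA -expRD ler_wpM2l// ler_expR; lra.
apply: le_trans (pinelis_tail Gs Gm Gind bW bq EW Wq1 Wq2 (2 * L) prodq).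
have EHj kb : \sum_i \int[P]_t f kb i t = 0.
  have /matrixP/(_ kb.1 j) := EH; rewrite summxE => E.
  have S0 : projS S kb.1 j = 0 :> C.
    rewrite !mxE; case: eqP => [->|_]; last by rewrite mulr0n.
    by rewrite (negbTE jS) mulr1n.
  rewrite S0 in E; rewrite /f; case: kb.2.
    have := congr1 (@complex.Re R) E; rewrite cRe_sum /= => E2; apply: etrans E2.
    by apply: eq_bigr => i _; rewrite mxE.
  have := congr1 (@complex.Im R) E; rewrite cIm_sum /= => E2; apply: etrans E2.
  by apply: eq_bigr => i _; rewrite mxE.
have SW t : vnorm (fun k => \sum_i W i t k) ^+ 2 = la ^+ 2 * nsq (col j (\sum_i H i t)).
  rewrite sqr_vnorm nsqcol mulr_sumr; apply: eq_bigr => kb _.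
  rewrite -mulr_sumr exprMn sumrB EHj subr0; congr (_ * _ ^+ 2).
  by rewrite /f summxE; case: kb.2; rewrite ?cRe_sum ?cIm_sum.
rewrite le_eqVlt; apply/orP; left; apply/eqP; congr (fine (P _)).
have L3 : 0 < 256 * L ^+ 3 by rewrite mulr_gt0 ?ltr0n ?exprn_gt0.
have lE : (2 * L) ^+ 2 = 256 * L ^+ 3 * (64 * L)^-1.
  have E : 64 * L * (64 * L)^-1 = 1 by rewrite mulfV// gt_eqF// mulr_gt0 ?ltr0n.
  transitivity ((2 * L) ^+ 2 * (64 * L * (64 * L)^-1)); first by rewrite E mulr1.
  by move: (_^-1) => y; ring.
have L20 : 0 <= 2 * L by lra.
apply/seteqP; split => t /=.
  move=> h; rewrite -(@ler_pXn2r _ 2 isT (2 * L)) ?nnegrE ?vnorm_ge0 ?L20// SW la2 lE.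
  by rewrite ler_pM2l.
by rewrite -(@ler_pXn2r _ 2 isT (2 * L)) ?nnegrE ?vnorm_ge0 ?L20// SW la2 lE ler_pM2l.
Qed.

End GramConcentration.

(** * Random signs with coefficients independent of them *)

Section SignConcentration.
Context {R : realType} {d} {T : measurableType d} (P : probability T R).
Local Notation C := R[i].
Context {I : finType} (xi : I -> T -> C) (Gx : I -> set (set T)).
Hypothesis Gxs : forall i, sigma_algebra setT (Gx i).
Hypothesis Gxm : forall i, Gx i `<=` measurable.
Hypothesis Gxind : mindep P Gx.
Hypothesis bxi : forall i, cbmeas (xi i : g_sigma_algebraType (Gx i) -> C).
Hypothesis xi1 : forall i t, cabs (xi i t) ^+ 2 <= 1.
Hypothesis Exi : forall i, \int[P]_t complex.Re (xi i t) = 0 /\ \int[P]_t complex.Im (xi i t) = 0.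

Lemma cabs_le1 i t : cabs (xi i t) <= 1.
Proof.
by rewrite -(@ler_pXn2r _ 2 isT) ?nnegrE ?cabs_ge0// expr1n.
Qed.

Lemma cbmeas_ambient (G : set (set T)) (F : T -> C) : <<s G>> `<=` measurable ->
  cbmeas (F : g_sigma_algebraType G -> _) -> cbmeas F.
Proof. by move=> h [b1 b2]; split; [exact: (bmeas_ambient h b1)|exact: (bmeas_ambient h b2)]. Qed.

Let bxiT i : cbmeas (xi i).
Proof. by apply: cbmeas_ambient (@bxi i); rewrite g_sigma_id//; exact: Gxm. Qed.

(** The exponent [2 mu^2 D^2 / (16 L) - (3/4) mu D] is minimal at [mu = 3 L / D], with value
    [(9/8 - 9/4) L]. The scaled summands may exceed 1/2, hence the Gaussian majorants. *)
Lemma sign_sum_tail (rho : I -> C) (D L : R) : 0 < D -> 1 <= L ->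
  \sum_i cabs (rho i) ^+ 2 <= D ^+ 2 / (16 * L) ->
  fine (P [set t | 3 / 4 * D <= cabs (\sum_i rho i * xi i t)]) <= 2 * expR (- L).
Proof.
move=> D0 L1 hrho; have L0 : 0 < L by exact: lt_le_trans ltr01 L1.
pose mu := 3 * L / D.
have mu0 : 0 < mu by rewrite divr_gt0// mulr_gt0.
pose W i t (b : bool) := mu * (if b then complex.Re (rho i * xi i t) else complex.Im (rho i * xi i t)).
have Wn2 i t : vnorm (W i t) ^+ 2 = (mu * cabs (rho i * xi i t)) ^+ 2.
  by rewrite sqr_vnorm big_bool /= !exprMn sqr_cabs mulrDr.
have Wn i t : vnorm (W i t) = mu * cabs (rho i * xi i t).
  apply/eqP; rewrite -(@eqrXn2 _ 2)// ?Wn2 ?vnorm_ge0//.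
  by rewrite mulr_ge0 ?cabs_ge0// ltW.
have Wle i t : vnorm (W i t) <= mu * cabs (rho i).
  rewrite Wn ler_pM2l// cabsM -[leRHS]mulr1; apply: ler_wpM2l; first exact: cabs_ge0.
  exact: cabs_le1.
pose q i (t : T) := expR (2 * (mu * cabs (rho i)) ^+ 2).
have qle i t : expR (2 * vnorm (W i t) ^+ 2) <= q i t.
  rewrite ler_expR ler_pM2l//; apply: lerXn2r; rewrite ?nnegrE ?vnorm_ge0//.
  by rewrite mulr_ge0 ?cabs_ge0// ltW.
have bW i k : bmeas ((fun t => W i t k) : g_sigma_algebraType (Gx i) -> R).
  have [b1 b2] := cbmeasM (cbmeas_cst (rho i)) (@bxi i).
  by apply: bmeasM; [exact: bmeas_cst|case: k].
have bq i : bmeas (q i) by exact: bmeas_cst.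
have EW i k : \int[P]_t W i t k = 0.
  have [x1 x2] := @bxiT i.
  have [e1 e2] := Exi i.
  have [m1 m2] := cbmeasM (cbmeas_cst (rho i)) (@bxiT i).
  rewrite /W bRintegralZl; last by case: k.
  case: k.
    under eq_Rintegral do rewrite cReM.
    rewrite bRintegralB; [|by apply: bmeasM => //; exact: bmeas_cst..].
    by rewrite !bRintegralZl// e1 e2 !mulr0 subr0 mulr0.
  under eq_Rintegral do rewrite cImM.
  rewrite bRintegralD; [|by apply: bmeasM => //; exact: bmeas_cst..].
  by rewrite !bRintegralZl// e1 e2 !mulr0 addr0 mulr0.
have Wq1 i t : expR (vnorm (W i t)) - vnorm (W i t) <= q i t.
  by apply: le_trans (qle i t); apply: expR_sub_le_gaussian; exact: vnorm_ge0.
have Wq2 i t : expR (- vnorm (W i t)) + vnorm (W i t) <= q i t.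
  by apply: le_trans (qle i t); apply: expRN_add_le_gaussian; exact: vnorm_ge0.
have prodq : \prod_i \int[P]_t q i t <= expR (9 / 8 * L).
  rewrite (eq_bigr (fun i => expR (2 * (mu * cabs (rho i)) ^+ 2))); last first.
    by move=> i _; exact: probability_Rintegral_cst.
  rewrite -expR_sum ler_expR.
  have -> : \sum_i 2 * (mu * cabs (rho i)) ^+ 2 = 2 * mu ^+ 2 * \sum_i cabs (rho i) ^+ 2.
    by rewrite mulr_sumr; apply: eq_bigr => i _; rewrite exprMn mulrA.
  apply: le_trans (ler_wpM2l _ hrho) _; first by rewrite mulr_ge0 ?sqr_ge0.
  rewrite le_eqVlt; apply/orP; left; apply/eqP; rewrite /mu; field.
  by rewrite !gt_eqF.
apply: (@le_trans _ _ (2 * expR (- (9 / 4 * L)) * expR (9 / 8 * L))); last first.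
  by rewrite -mulrA -expRD ler_pM2l// ler_expR; lra.
apply: le_trans (pinelis_tail Gxs Gxm Gxind bW bq EW Wq1 Wq2 (9 / 4 * L) prodq).
have SW t : vnorm (fun k => \sum_i W i t k) = mu * cabs (\sum_i rho i * xi i t).
  apply/eqP; rewrite -(@eqrXn2 _ 2)// ?vnorm_ge0//; last by rewrite mulr_ge0 ?cabs_ge0// ltW.
  rewrite sqr_vnorm big_bool /W /= -!mulr_sumr -cRe_sum -cIm_sum !exprMn sqr_cabs mulrDr.
  by [].
rewrite le_eqVlt; apply/orP; left; apply/eqP; congr (fine (P _)).
have E : 9 / 4 * L = mu * (3 / 4 * D) by rewrite /mu; field; rewrite gt_eqF.
by apply/seteqP; split => t /=; rewrite SW E ler_pM2l.
Qed.

Variables (G2 : bool -> set (set T)).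
Hypothesis G2s : forall b, sigma_algebra setT (G2 b).
Hypothesis G2m : forall b, G2 b `<=` measurable.
Hypothesis G2ind : mindep P G2.
Hypothesis bxi2 : forall i, cbmeas (xi i : g_sigma_algebraType (G2 false) -> C).
Let J := [set true]%SET.
Variables (rho : T -> I -> C) (D : T -> R) (good : set T) (L : R).
Hypothesis mgood : <<s joinG G2 J>> good.
Hypothesis brho : forall i, cbmeas ((fun t => rho t i) : g_sigma_algebraType (joinG G2 J) -> C).
Hypothesis bD : bmeas (D : g_sigma_algebraType (joinG G2 J) -> R).
Hypothesis L1 : 1 <= L.
Hypothesis goodD : forall t, good t -> 0 < D t.
Hypothesis goodrho : forall t, good t -> \sum_i cabs (rho t i) ^+ 2 <= D t ^+ 2 / (16 * L).

Lemma sign_sum_tail_random :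
  measurable [set t | good t /\ 3 / 4 * D t <= cabs (\sum_i rho t i * xi i t)] /\
  fine (P [set t | good t /\ 3 / 4 * D t <= cabs (\sum_i rho t i * xi i t)]) <= 2 * expR (- L).
Proof.
pose UU := (g_sigma_algebraType (G2 false) * g_sigma_algebraType (joinG G2 J))%type.
(* The signs read the first coordinate, everything else the second; the diagonal gives back the
   event of the statement. *)
pose bad : set UU := [set u | good u.2 /\ 3 / 4 * D u.2 <= cabs (\sum_i rho u.2 i * xi i u.1)].
have iJ : false \notin J by rewrite finset.in_set1.
have bfst (f : g_sigma_algebraType (G2 false) -> R) : bmeas f -> bmeas (fun u : UU => f u.1).
  by move=> [mf [M hM]]; split; [exact: (measurableT_comp mf measurable_fst)|exists M].
have bsnd (f : g_sigma_algebraType (joinG G2 J) -> R) : bmeas f -> bmeas (fun u : UU => f u.2).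
  by move=> [mf [M hM]]; split; [exact: (measurableT_comp mf measurable_snd)|exists M].
have bsum : cbmeas (fun u : UU => \sum_i rho u.2 i * xi i u.1).
  apply: cbmeas_sum => i _; apply: cbmeasM.
    by have [b1 b2] := brho i; split; [exact: (bsnd _ b1)|exact: (bsnd _ b2)].
  by have [b1 b2] := bxi2 i; split; [exact: (bfst _ b1)|exact: (bfst _ b2)].
have babs : bmeas (fun u : UU => cabs (\sum_i rho u.2 i * xi i u.1)).
  apply: bmeas_sqrt; have [b1 b2] := bsum.
  by apply: (eq_bmeas (bmeasD (bmeasM b1 b1) (bmeasM b2 b2))) => u; rewrite !expr2.
have mbad : measurable bad.
  have -> : bad = (snd @^-1` good) `&` [set u : UU | 0 <= cabs (\sum_i rho u.2 i * xi i u.1) - 3 / 4 * D u.2].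
    by apply/seteqP; split => u /=; rewrite subr_ge0.
  apply: measurableI.
    rewrite -[X in measurable X]setTI.
    exact: (@measurable_snd _ _ (g_sigma_algebraType (G2 false)) (g_sigma_algebraType (joinG G2 J))).
  apply: measurable_superlevel; apply: bmeasB => //.
  by apply: bmeasM; [exact: bmeas_cst|exact: bsnd].
have bf : bmeas (\1_bad : UU -> R) by exact: bmeas_indic.
have bg : bmeas (fun _ : UU => 2 * expR (- L)) by exact: bmeas_cst.
have mTgood : measurable good by exact: (joinG_measurable G2m mgood).
have slice t2 : \int[P]_t1 (\1_bad (t1, t2) : R) <= 2 * expR (- L).
  have [gt2|ngt2] := pselect (good t2); last first.
    rewrite (_ : \int[P]_t1 _ = 0) ?mulr_ge0 ?expR_ge0//.
    rewrite -[RHS](probability_Rintegral_cst P); apply: eq_Rintegral => t _.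
    by rewrite indicE memNset// => -[].
  apply: le_trans (sign_sum_tail (goodD gt2) L1 (goodrho gt2)).
  rewrite -Rintegral_indic; last first.
    apply: measurable_superlevel; apply: bmeas_sqrt.
    have [b1 b2] : cbmeas (fun t : T => \sum_i rho t2 i * xi i t).
      by apply: cbmeas_sum => i _; apply: cbmeasM; [exact: cbmeas_cst|exact: bxiT].
    by apply: (eq_bmeas (bmeasD (bmeasM b1 b1) (bmeasM b2 b2))) => u; rewrite !expr2.
  rewrite le_eqVlt; apply/orP; left; apply/eqP; apply: eq_Rintegral => t _.
  rewrite !indicE; congr (nat_of_bool _)%:R; apply/idP/idP; rewrite !inE /bad /=.
    by move=> [].
  by [].
have mT : measurable [set t : T | bad (t, t)].
  have mid1 : measurable_fun setT (idfun : T -> g_sigma_algebraType (G2 false)).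
    by move=> _ B mB; rewrite setTI; apply: (G2m (b := false)); rewrite -g_sigma_id.
  have mid2 : measurable_fun setT (idfun : T -> g_sigma_algebraType (joinG G2 J)).
    by move=> _ B mB; rewrite setTI; exact: (joinG_measurable G2m mB).
  rewrite -[X in measurable X]setTI.
  exact: (measurable_fun_pair mid1 mid2).
split; first exact: mT.
have cI : \int[P]_t (2 * expR (- L)) = 2 * expR (- L) by exact: probability_Rintegral_cst.
have slice' t2 : \int[P]_t1 (\1_bad (t1, t2) : R) <= \int[P]_t (2 * expR (- L)).
  by rewrite cI; exact: slice.
have := @family_decouple_le _ _ _ P _ G2 G2s G2m G2ind J false _ _ iJ bf bg slice'.
rewrite cI; apply: le_trans.
rewrite -(Rintegral_indic P mT) le_eqVlt; apply/orP; left; apply/eqP.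
by apply: eq_Rintegral => t _; rewrite !indicE; congr (nat_of_bool _)%:R.
Qed.

End SignConcentration.

(** * Truncation of the blocks *)

Section ComplexMeasurable.
Context {R : realType} {d} {U : measurableType d}.
Local Notation C := R[i].

Lemma cmeasurable_cst (c : C) : cmeasurable (fun _ : U => c).
Proof. by split; exact: measurable_cst. Qed.

Lemma cmeasurableD (f g : U -> C) :
  cmeasurable f -> cmeasurable g -> cmeasurable (fun u => f u + g u).
Proof.
move=> [f1 f2] [g1 g2]; split.
  apply: (eq_measurable_fun (fun u => complex.Re (f u) + complex.Re (g u))).
    by move=> u _; rewrite cReD.
  exact: measurable_funD.
apply: (eq_measurable_fun (fun u => complex.Im (f u) + complex.Im (g u))).
  by move=> u _; rewrite cImD.
exact: measurable_funD.
Qed.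

Lemma cmeasurableM (f g : U -> C) :
  cmeasurable f -> cmeasurable g -> cmeasurable (fun u => f u * g u).
Proof.
move=> [f1 f2] [g1 g2]; split.
  apply: (eq_measurable_fun (fun u => complex.Re (f u) * complex.Re (g u)
      - complex.Im (f u) * complex.Im (g u))).
    by move=> u _; rewrite cReM.
  by apply: measurable_funB; exact: measurable_funM.
apply: (eq_measurable_fun (fun u => complex.Re (f u) * complex.Im (g u)
    + complex.Im (f u) * complex.Re (g u))).
  by move=> u _; rewrite cImM.
by apply: measurable_funD; exact: measurable_funM.
Qed.

Lemma cmeasurableJ (f : U -> C) : cmeasurable f -> cmeasurable (fun u => conjc (f u)).
Proof.
move=> [f1 f2]; split.
  by apply: (eq_measurable_fun (fun u => complex.Re (f u))) => [u _|//]; rewrite cReJ.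
apply: (eq_measurable_fun (fun u => - complex.Im (f u))).
  by move=> u _; rewrite cImJ.
exact: measurableT_comp.
Qed.

Lemma cmeasurable_sum (I : Type) (r : seq I) (F : I -> U -> C) :
  (forall i, cmeasurable (F i)) -> cmeasurable (fun u => \sum_(i <- r) F i u).
Proof.
move=> mF; elim: r => [|i r IH].
  suff -> : (fun u : U => \sum_(j <- [::]) F j u) = (fun=> 0) by exact: cmeasurable_cst.
  by apply/funext => u; rewrite big_nil.
suff -> : (fun u : U => \sum_(j <- i :: r) F j u) = (fun u => F i u + \sum_(j <- r) F j u).
  exact: cmeasurableD.
by apply/funext => u; rewrite big_cons.
Qed.

Lemma measurable_cabs (f : U -> C) : cmeasurable f -> measurable_fun setT (fun u => cabs (f u)).
Proof.
move=> [f1 f2]; apply: (@measurableT_comp _ _ _ _ _ _ (@Num.sqrt R)).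
  by apply: continuous_measurable_fun; exact: sqrt_continuous.
by apply: measurable_funD; exact: measurable_funX.
Qed.

Lemma cbmeas_bounded (f : U -> C) (M : R) :
  cmeasurable f -> (forall u, cabs (f u) <= M) -> cbmeas f.
Proof.
move=> [f1 f2] fM; split; split => //; exists M => u; apply: le_trans (fM u);
  rewrite -(@ler_pXn2r _ 2 isT) ?nnegrE ?cabs_ge0// sqr_cabs real_normK ?num_real//.
- by rewrite lerDl sqr_ge0.
- by rewrite lerDr sqr_ge0.
Qed.

End ComplexMeasurable.

Section Truncation.
Context {R : realType}.
Local Notation C := R[i].
Variables (n : nat) (S : {set 'I_n}) (Theta : R) (m : nat).
Hypothesis T0 : 0 < Theta.
Hypothesis m0 : (0 < m)%N.

Section OneBlock.
Variable p : nat.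
Implicit Types M : 'M[C]_(p, n).

Definition tame M : bool := infnorm (adjmx M *m colS S M) <= Theta.

(** The test looks at one block only, so truncation preserves the independence of the blocks. *)
Definition tameB M : 'M[C]_(p, n) := if tame M then M else 0.

(* Summed over the blocks, [scaledBlock^* scaledBlock] gives A_S^* A_S and
   [halfGram] the rows of A^* A indexed by S. *)
Definition scaledBlock M : 'M[C]_(p, n) :=
  (Num.sqrt (m%:R : R))^-1%:C%C *: (tameB M *m projS S).

Definition halfGram M : 'M[C]_n :=
  (m%:R^-1)%:C%C *: (projS S *m (adjmx (tameB M) *m tameB M)).

Lemma tameB_row M j : \sum_(k in S) cabs ((adjmx (tameB M) *m tameB M) j k) <= Theta.
Proof.
rewrite /tameB; case: ifP => [ok|_]; last first.
  rewrite big1 ?ltW// => k _; rewrite mulmx0 mxE; exact: cabs0.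
apply: le_trans ok; rewrite big_enum_val.
rewrite /infnorm.
apply: le_trans (le_bigmax _ (fun i => \sum_(k < #|S|) cabs ((adjmx M *m colS S M) i k)) j).
rewrite le_eqVlt; apply/orP; left; apply/eqP; apply: eq_bigr => k _.
congr cabs; rewrite !mxE; apply: eq_bigr => a _.
by rewrite !mxE.
Qed.

Let g M := adjmx (tameB M) *m tameB M.

Let g_sym M i k : cabs (g M i k) = cabs (g M k i).
Proof.
have hg : adjmx (g M) = g M by exact: hermmx_gram.
by rewrite -[in LHS]hg adjmxE cabsJ.
Qed.

(** Schur test for the Hermitian matrix [g M] restricted to [S]: as [|w_i| |w_k|] is at most half of
    [|w_i|^2 + |w_k|^2], symmetry reduces the quadratic form to row sums. *)
Lemma tameB_opbound M : opbound (tameB M *m projS S) Theta.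
Proof.
move=> v; rewrite -rdot_nsq rdotMl adjmx_mul projS_herm.
have -> : projS S *m adjmx (tameB M) *m (tameB M *m projS S *m v) =
    projS S *m (g M *m (projS S *m v)) by rewrite /g !mulmxA.
have -> : rdot v (projS S *m (g M *m (projS S *m v))) =
    rdot (projS S *m v) (g M *m (projS S *m v)).
  by rewrite rdotMl projS_herm.
set w := projS S *m v.
have wS i : i \notin S -> w i 0 = 0 by move=> iS; rewrite projSE (negbTE iS).
have gw i : (g M *m w) i 0 = \sum_k g M i k * w k 0 by rewrite mxE.
have step : rdot w (g M *m w) <= \sum_(i in S) \sum_(k in S)
    cabs (g M i k) * (2^-1 * (cabs (w i 0) ^+ 2 + cabs (w k 0) ^+ 2)).
  rewrite /rdot (bigID (mem S))/= [X in _ + X]big1 ?addr0; last first.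
    by move=> i iS; rewrite big_ord1 wS//= !mul0r addr0.
  apply: ler_sum => i iS; rewrite big_ord1.
  apply: le_trans (_ : \sum_(k in S) (complex.Re (w i 0) * complex.Re (g M i k * w k 0) +
     complex.Im (w i 0) * complex.Im (g M i k * w k 0)) <= _).
    rewrite gw cRe_sum cIm_sum !mulr_sumr -big_split/= (bigID (mem S))/=.
    rewrite [X in _ + X]big1 ?addr0// => k kS.
    by rewrite (wS k kS) mulr0 /= !mulr0 addr0.
  apply: ler_sum => k kS; apply: le_trans (Re_conjM_le _ _) _.
  rewrite cabsM mulrCA; apply: ler_wpM2l; first exact: cabs_ge0.
  have := sqr_ge0 (cabs (w i 0) - cabs (w k 0)); rewrite sqrrB.
  by move: (cabs (w i 0)) (cabs (w k 0)) => a b; lra.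
apply: le_trans step _.
have -> : \sum_(i in S) \sum_(k in S)
    cabs (g M i k) * (2^-1 * (cabs (w i 0) ^+ 2 + cabs (w k 0) ^+ 2)) =
    \sum_(i in S) \sum_(k in S) cabs (g M i k) * cabs (w i 0) ^+ 2.
  transitivity (2^-1 * (\sum_(i in S) \sum_(k in S) cabs (g M i k) * cabs (w i 0) ^+ 2) +
    2^-1 * (\sum_(i in S) \sum_(k in S) cabs (g M i k) * cabs (w k 0) ^+ 2)).
    rewrite !mulr_sumr -big_split; apply: eq_bigr => i _ /=.
    by rewrite !mulr_sumr -big_split; apply: eq_bigr => k _ /=; ring.
  have -> : \sum_(i in S) \sum_(k in S) cabs (g M i k) * cabs (w k 0) ^+ 2 =
     \sum_(i in S) \sum_(k in S) cabs (g M i k) * cabs (w i 0) ^+ 2.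
    rewrite exchange_big; apply: eq_bigr => i _; apply: eq_bigr => k _.
    by rewrite g_sym.
  by move: (\sum_(i in S) _) => a; lra.
apply: (@le_trans _ _ (\sum_(i in S) Theta * cabs (w i 0) ^+ 2)).
  apply: ler_sum => i _; rewrite -mulr_suml; apply: ler_wpM2r; first exact: sqr_ge0.
  exact: tameB_row.
rewrite -mulr_sumr ler_pM2l//; apply: le_trans (nsq_projS S v); rewrite -/w.
rewrite /nsq [leRHS](bigID (mem S))/= -[leLHS]addr0; apply: lerD.
  by apply: ler_sum => i _; rewrite big_ord1 sqr_cabs.
by apply: sumr_ge0 => i _; apply: sumr_ge0 => k _; rewrite addr_ge0// sqr_ge0.
Qed.

Let mR0 : 0 < m%:R :> R. Proof. by rewrite ltr0n. Qed.

Let sqrtm : (Num.sqrt (m%:R : R))^-1 ^+ 2 = m%:R^-1.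
Proof. by rewrite exprVn sqr_sqrtr// ler0n. Qed.

Lemma scaledBlock_opbound M : opbound (scaledBlock M) (Theta / m%:R).
Proof.
move=> v; rewrite /scaledBlock -scalemxAl nsqZ sqrtm mulrAC mulrC ler_pM2r ?invr_gt0//.
exact: tameB_opbound.
Qed.

Lemma scaledBlock_gram M : adjmx (scaledBlock M) *m scaledBlock M = halfGram M *m projS S.
Proof.
rewrite /scaledBlock /halfGram adjmxZ -!scalemxAl -scalemxAr scalerA -rmorphM /=.
by rewrite -expr2 sqrtm adjmx_mul projS_herm !mulmxA.
Qed.

Lemma nsq_col_halfGram M j : nsq (col j (halfGram M)) =
  (m%:R^-1) ^+ 2 * \sum_(k in S) cabs (g M k j) ^+ 2.
Proof.
have -> : col j (halfGram M) = (m%:R^-1)%:C%C *: (projS S *m col j (g M)).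
  by apply/matrixP => a b; rewrite !mxE /halfGram; congr (_ * _); apply: eq_bigr => c _; rewrite !mxE.
rewrite nsqZ; congr (_ * _); rewrite /nsq [RHS]big_mkcond; apply: eq_bigr => k _.
rewrite big_ord1 projSE; case: ifP => _; last by rewrite /= expr0n addr0.
by rewrite mxE sqr_cabs.
Qed.

(** A sum of squares is at most the largest modulus times the sum of the moduli. The bound by
    [Theta] covers all rows of [B^* B_S], also those off [S], and Hermitian symmetry turns rows into
    columns. *)
Lemma halfGram_col M j : nsq (col j (halfGram M)) <= (Theta / m%:R) ^+ 2.
Proof.
rewrite nsq_col_halfGram mulrC exprMn; apply: ler_wpM2r; first exact: sqr_ge0.
have h : \sum_(k in S) cabs (g M k j) <= Theta.
  by under eq_bigr do rewrite g_sym; exact: tameB_row.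
have c0 k : 0 <= cabs (g M k j) by exact: cabs_ge0.
apply: (@le_trans _ _ (\sum_(k in S) Theta * cabs (g M k j))).
  apply: ler_sum => k kS; rewrite expr2; apply: ler_wpM2r => //.
  by apply: le_trans h; rewrite (bigD1 k)//= lerDl sumr_ge0.
by rewrite -mulr_sumr expr2 ler_pM2l.
Qed.

(** The column is [B_S^* b_j / m] with [B_S] of squared norm at most [Theta], which leaves
    [|b_j|^2]. Isotropy fixes its average over the blocks, so the variances add up to [Theta / m],
    against [Theta^2 / m] from [halfGram_col]. *)
Lemma halfGram_col_var M j : nsq (col j (halfGram M)) <=
  Theta / m%:R * (m%:R^-1 * nsq (col j M)).
Proof.
have -> : col j (halfGram M) = (m%:R^-1)%:C%C *: (adjmx (tameB M *m projS S) *m col j (tameB M)).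
  rewrite adjmx_mul projS_herm; apply/matrixP => a b.
  rewrite 2!mxE [in RHS]mxE; congr (_ * _).
  rewrite mulmxA; rewrite !mxE; apply: eq_bigr => c _.
  by rewrite [col _ _ _ _]mxE.
rewrite nsqZ expr2 -!mulrA mulrCA; rewrite [leRHS]mulrCA; apply: ler_wpM2l; first by rewrite invr_ge0 ltW.
rewrite mulrC [leRHS]mulrA [leRHS]mulrC.
rewrite [leRHS]mulrC -[leRHS]mulrA [X in _ <= _ * X]mulrC mulrA.
apply: ler_wpM2r; first by rewrite invr_ge0 ltW.
apply: le_trans (opbound_mx _ (opbound_adj (ltW T0) (@tameB_opbound M))) _.
rewrite ler_pM2l// /tameB; case: ifP => // _.
rewrite (_ : col j 0 = 0); first by rewrite -sqr_n2 n2_0 expr0n nsq_ge0.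
by apply/matrixP => a b; rewrite !mxE.
Qed.

Lemma cabs_le_n2_col q (M : 'M[C]_(q, n)) i j : cabs (M i j) <= n2 (col j M).
Proof.
rewrite -(@ler_pXn2r _ 2 isT) ?nnegrE ?cabs_ge0 ?n2_ge0// sqr_n2 sqr_cabs.
rewrite /nsq (bigD1 i)//= big_ord1 mxE lerDl.
by apply: sumr_ge0 => k _; apply: sumr_ge0 => l _; rewrite addr_ge0// sqr_ge0.
Qed.

Section BlockMeasurability.
Context {d} {U : measurableType d} (b : U -> 'M[C]_(p, n)).
Hypothesis mb : forall i j, cmeasurable (fun u => b u i j).

Lemma measurable_tame : measurable [set u | tame (b u)].
Proof.
have mi : measurable_fun setT (fun u => infnorm (adjmx (b u) *m colS S (b u))).
  rewrite /infnorm.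
  have mrow i : measurable_fun setT (fun u => \sum_(k < #|S|) cabs ((adjmx (b u) *m colS S (b u)) i k)).
    apply: measurable_sum => k; apply: measurable_cabs.
    have -> : (fun u => (adjmx (b u) *m colS S (b u)) i k) =
      (fun u => \sum_a conjc (b u a i) * b u a (enum_val k)).
      by apply/funext => u; rewrite mxE; apply: eq_bigr => a _; rewrite adjmxE mxE.
    apply: cmeasurable_sum => a; apply: cmeasurableM; last exact: mb.
    exact/cmeasurableJ/mb.
  elim: (index_enum _) => [|i r IH].
    suff -> : (fun u => \big[Num.max/0]_(i <- [::]) \sum_(k < #|S|)
        cabs ((adjmx (b u) *m colS S (b u)) i k)) = (fun=> 0) by exact: measurable_cst.
    by apply/funext => u; rewrite big_nil.
  apply: (eq_measurable_fun (fun u => Num.max (\sum_(k < #|S|)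
        cabs ((adjmx (b u) *m colS S (b u)) i k)) (\big[Num.max/0]_(i <- r) \sum_(k < #|S|)
        cabs ((adjmx (b u) *m colS S (b u)) i k)))).
    by move=> u _; rewrite big_cons.
  exact: measurable_maxr.
have -> : [set u | tame (b u)] = (fun u => infnorm (adjmx (b u) *m colS S (b u))) @^-1` `]-oo, Theta]%classic.
  by apply/seteqP; split => u /=; rewrite in_itv.
by rewrite -[X in measurable X]setTI; exact: mi.
Qed.

Lemma cmeasurable_tameB i j : cmeasurable (fun u => tameB (b u) i j).
Proof.
have -> : (fun u => tameB (b u) i j) =
    (fun u => (\1_[set u | tame (b u)] u : R)%:C%C * b u i j).
  apply/funext => u; rewrite /tameB indicE; case: ifP => h.
    by rewrite mem_set// mul1r.
  by rewrite memNset ?mul0r ?mxE//= h.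
apply: cmeasurableM => //; split => /=; last exact: measurable_cst.
by apply: measurable_indic; exact: measurable_tame.
Qed.

Lemma mbmeas_scaledBlock : mbmeas (fun u => scaledBlock (b u)).
Proof.
move=> i j; apply: (@cbmeas_bounded _ _ _ _ (Num.sqrt (Theta / m%:R))).
  have -> : (fun u => scaledBlock (b u) i j) =
    (fun u => (Num.sqrt (m%:R : R))^-1%:C%C * (if j \in S then tameB (b u) i j else 0)).
    by apply/funext => u; rewrite mxE mulmx_projSE.
  apply: cmeasurableM; first exact: cmeasurable_cst.
  by case E: (j \in S); [exact: cmeasurable_tameB|exact: cmeasurable_cst].
move=> u; apply: le_trans (cabs_le_n2_col _ _ _) _; apply: ler_wsqrtr.
rewrite colE; apply: le_trans (scaledBlock_opbound _ _) _.
rewrite /nsq (bigD1 j)//= big_ord1 !mxE !eqxx /= expr1n expr0n addr0 big1 ?addr0 ?mulr1//.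
by move=> k kj; rewrite big_ord1 !mxE (negbTE kj) /= expr0n addr0.
Qed.

Lemma mbmeas_halfGram : mbmeas (fun u => halfGram (b u)).
Proof.
move=> i j; apply: (@cbmeas_bounded _ _ _ _ (Theta / m%:R)).
  have -> : (fun u => halfGram (b u) i j) =
    (fun u => (m%:R^-1)%:C%C * ((i \in S)%:R * \sum_a conjc (tameB (b u) a i) * tameB (b u) a j)).
    apply/funext => u; rewrite mxE projSE; congr (_ * _).
    case: (i \in S); rewrite ?mul0r// mul1r mxE.
    by apply: eq_bigr => a _; rewrite adjmxE.
  apply: cmeasurableM; first exact: cmeasurable_cst.
  apply: cmeasurableM; first exact: cmeasurable_cst.
  apply: cmeasurable_sum => a; apply: cmeasurableM; last exact: cmeasurable_tameB.
  by apply: cmeasurableJ; exact: cmeasurable_tameB.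
move=> u; apply: le_trans (cabs_le_n2_col _ _ _) _.
have K0 : 0 <= Theta / m%:R by rewrite divr_ge0 ?ler0n// ltW.
by rewrite -(@ler_pXn2r _ 2 isT) ?nnegrE ?n2_ge0// sqr_n2; exact: halfGram_col.
Qed.

End BlockMeasurability.
End OneBlock.

Lemma sensing_gram (p : 'I_m -> nat) (B : forall l, 'M[C]_(p l, n)) :
  (forall l, tame (B l)) ->
  projS S *m (adjmx (sensing B) *m sensing B) = \sum_l halfGram (B l).
Proof.
move=> tB; rewrite /sensing adjmxZ -scalemxAl -!scalemxAr scalerA -rmorphM /= -expr2.
rewrite exprVn sqr_sqrtr ?ler0n//.
have -> : adjmx (\mxcol_(l < m) B l) = \mxrow_(l < m) adjmx (B l).
  apply/matrixP => i j; rewrite adjmxE.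
  by rewrite !mxE.
rewrite mul_mxrow_mxcol mulmx_sumr scaler_sumr; apply: eq_bigr => l _.
by rewrite /halfGram /tameB tB.
Qed.

End Truncation.

(** * Random signs are centered *)

Section RandomSigns.
Context {R : realType}.
Local Notation C := R[i].
Local Notation leb := (@lebesgue_measure R).

(** [acos] gives the angle on the upper half and [2 pi - acos] on the lower one, where the real part
    is not 1 and the angle stays below [2 pi]. *)
Lemma circle_angle (z : C) : complex.Re z ^+ 2 + complex.Im z ^+ 2 = 1 ->
  exists th : R, 0 <= th < 2 * pi /\ z = (cos th +i* sin th)%C.
Proof.
case: z => a b /= ab1.
have a1 : -1 <= a <= 1.
  rewrite -ler_norml -(@ler_pXn2r _ 2 isT) ?nnegrE// real_normK ?num_real// expr1n.
  by have := sqr_ge0 b; lra.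
have ain : a \in `[(-1), 1] by rewrite in_itv.
have sa : sin (acos a) = Num.sqrt (b ^+ 2).
  by rewrite sin_acos//; congr Num.sqrt; lra.
have pi0 := pi_gt0 R.
have [b0|b0] := leP 0 b.
  exists (acos a); split; last by rewrite acosK// sa sqrtr_sqr ger0_norm.
  by have := acos_ge0 a1; have := acos_lepi a1; lra.
exists (2 * pi - acos a); split.
  have : 0 < acos a.
    apply: acos_gt0; rewrite (andP a1).1/= lt_def (andP a1).2 andbT eq_sym.
    apply/eqP => a1'; move: ab1; rewrite a1' expr1n => h.
    have : b ^+ 2 = 0 by lra.
    by move/eqP; rewrite sqrf_eq0 => /eqP b00; rewrite b00 ltxx in b0.
  by have := acos_lepi a1; lra.
have e2 : 2 * pi = pi *+ 2 :> R by rewrite mulr_natl.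
rewrite cosB sinB e2 cos2pi sin2pi !mul0r mul1r addr0 sub0r acosK// sa.
by rewrite sqrtr_sqr ltr0_norm// mul1r opprK.
Qed.

(** [uniform_prob] lives on the closed interval; the endpoint [2 pi] is a null set. *)
Lemma uniform_prob_arc (pp : (0 : R) < 2 * pi) (U : set R) : measurable U ->
  uniform_prob pp U = (leb (U `&` [set th | (0 <= th < 2 * pi)%R]) * ((2 * pi)^-1)%:E)%E.
Proof.
move=> mU; rewrite /uniform_prob integral_uniform_pdf.
have mI : measurable (U `&` `[0, 2 * pi]%classic) by exact: measurableI.
rewrite (eq_integral (fun=> ((2 * pi)^-1)%:E)); last first.
  move=> x; rewrite inE => -[_] /=; rewrite in_itv/= /uniform_pdf => ->.
  by rewrite subr0.
rewrite integral_cst// muleC; congr (_ * _)%E.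
have mJ : measurable [set th : R | 0 <= th < 2 * pi].
  have -> : [set th : R | 0 <= th < 2 * pi] = `[0, 2 * pi[%classic.
    by apply/seteqP; split => x /=; rewrite in_itv.
  exact: measurable_itv.
apply/eqP; rewrite eq_le; apply/andP; split; last first.
  apply: le_measure; rewrite ?inE//; first exact: measurableI.
  by move=> x [Ux /= /andP[x0 xp]]; split => //=; rewrite in_itv/= x0 ltW.
apply: (@le_trans _ _ (leb ((U `&` [set th : R | 0 <= th < 2 * pi]) `|` [set 2 * pi]))).
  apply: le_measure; rewrite ?inE//.
    by apply: measurableU => //; exact: measurableI.
  move=> x [Ux /=]; rewrite in_itv/= => /andP[x0]; rewrite le_eqVlt => /predU1P[->|xp].
    by right.
  by left; split => //=; rewrite x0.
apply: le_trans (measureU2 _ _ _) _ => //; first exact: measurableI.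
by rewrite [X in (_ + X)%E](_ : _ = 0%E) ?adde0//; exact: lebesgue_measure_set1.
Qed.

(** The added 1 makes the integrand nonnegative; [h] contributes nothing since its primitive [F]
    agrees at both ends. *)
Lemma integral_uniform_trig (pp : (0 : R) < 2 * pi) (h F : R -> R) :
  continuous h -> (forall x, -1 <= h x) -> (forall x : R, is_derive x 1 F (h x)) ->
  F (2 * pi) = F 0 ->
  (\int[uniform_prob pp]_x (1 + h x)%:E = 1)%E.
Proof.
move=> ch h1 dF F0.
have c1h : continuous (fun x => 1 + h x) by move=> x; apply: cvgD; [exact: cvg_cst|exact: ch].
rewrite integral_uniform; last 2 first.
- by apply/measurable_EFinP; exact: continuous_measurable_fun.
- by move=> x; rewrite lee_fin; have := h1 x; lra.
pose G x := x + F x.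
have dG (x : R) : is_derive x 1 G (1 + h x) by exact: is_deriveD.
have cG x : {for x, continuous G}.
  by apply: differentiable_continuous; apply/derivable1_diffP; exact: ex_derive.
rewrite (@continuous_FTC2 _ _ G)//.
- rewrite /G F0 -EFinB -EFinM subr0.
  have -> : 2 * pi + F 0 - (0 + F 0) = 2 * pi by ring.
  by rewrite mulVf// gt_eqF.
- exact: continuous_subspaceT.
- split.
  + by move=> x _; exact: ex_derive.
  + by apply: cvg_at_right_filter; exact: cG.
  + by apply: cvg_at_left_filter; exact: cG.
- by move=> x _; rewrite derive1E; exact: derive_val.
Qed.

Context {d} {T : measurableType d} (P : probability T R).

Lemma eq_Rintegral_null (f g : T -> R) (N : set T) : bmeas f -> bmeas g ->
  measurable N -> P N = 0%E -> (forall t, ~ N t -> f t = g t) ->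
  \int[P]_t f t = \int[P]_t g t.
Proof.
move=> [mf _] [mg _] mN N0 fg; rewrite /Rintegral; congr fine.
apply: ae_eq_integral => //; [exact/measurable_EFinP|exact/measurable_EFinP|].
exists N; split => // t /= h; apply: contrapT => nN; apply: h => _.
by rewrite fg.
Qed.

(** [unif_circle] speaks of angles only. Applied to all angles it puts [xi] on the circle almost
    surely; applied to preimages under [h] it identifies the law of [f] with that of [h] at a
    uniform angle. *)
Lemma steinhaus_component_mean (xi : T -> C) (f : T -> R) (h F : R -> R) :
  cmeasurable xi -> unif_circle P xi ->
  bmeas f -> (forall t, `|f t| <= 1) ->
  continuous h -> (forall x, `|h x| <= 1) -> (forall x : R, is_derive x 1 F (h x)) ->
  F (2 * pi) = F 0 ->
  (forall t th, xi t = (cos th +i* sin th)%C -> f t = h th) ->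
  \int[P]_t f t = 0.
Proof.
move=> [m1 m2] uxi bf f1 ch h1 dF F0 fh.
have pp : (0 : R) < 2 * pi by rewrite mulr_gt0// pi_gt0.
have [mf _] := bf.
have mh : measurable_fun setT h by exact: continuous_measurable_fun.
pose circ := [set t | complex.Re (xi t) ^+ 2 + complex.Im (xi t) ^+ 2 = 1].
have mcirc : measurable circ.
  have mr : measurable_fun setT (fun t => complex.Re (xi t) ^+ 2 + complex.Im (xi t) ^+ 2).
    by apply: measurable_funD; exact: measurable_funX.
  have -> : circ = (fun t => complex.Re (xi t) ^+ 2 + complex.Im (xi t) ^+ 2) @^-1` [set 1].
    by [].
  by rewrite -[X in measurable X]setTI; exact: mr.
have circE t : circ t <-> exists th : R, (0 <= th < 2 * pi)%R /\ xi t = (cos th +i* sin th)%C.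
  split=> [/circle_angle//|[th [_ xt]]].
  by rewrite /circ /= xt /= cos2Dsin2.
have law (D : set R) : measurable D -> P (f @^-1` D `&` circ) = uniform_prob pp (h @^-1` D).
  move=> mD; have mhD : measurable (h @^-1` D).
    by rewrite -[X in measurable X]setTI; exact: mh.
  rewrite uniform_prob_arc// -(uxi _ mhD); congr (P _).
  apply/seteqP; split => t /=.
    move=> [Dt /circE[th [thI xt]]]; exists th; split; last by [].
    by rewrite -(fh _ _ xt).
  move=> [th [Dth [thI xt]]]; split; last by apply/circE; exists th.
  by rewrite (fh _ _ xt).
have Pcirc : P (~` circ) = 0%E.
  have := law setT measurableT; rewrite !preimage_setT setTI => Pc.
  have Pc1 : P circ = 1%E.
    rewrite Pc; exact: (probability_setT (uniform_prob pp)).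
  by rewrite probability_setC// Pc1 subee.
have lawf (D : set R) : measurable D -> P (f @^-1` D) = uniform_prob pp (h @^-1` D).
  move=> mD; have mfD : measurable (f @^-1` D).
    by rewrite -[X in measurable X]setTI; exact: mf.
  have null : P (f @^-1` D `\` circ) = 0%E.
    apply: (subset_measure0 (B := ~` circ)) => //.
    - exact: measurableD.
    - exact: measurableC.
  by rewrite -law// [LHS](measureDI P mfD mcirc) [X in (X + _)%E]null add0e.
pose X : {mfun T >-> R} := mfun_Sub (mem_set mf).
have mh' : @measurable_fun _ _ (measurableTypeR R) R setT h by exact: mh.
pose Z : {RV (uniform_prob pp) >-> R} := HB.pack h (isMeasurableFun.Build _ _ (measurableTypeR R) R h mh').
have mg : measurable_fun setT (fun y : R => (`|1 + y|)%:E).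
  apply/measurable_EFinP; apply: measurableT_comp => //.
  exact: measurable_funD.
(* The transfer uses [|1 + y|], nonnegative on the whole line and equal to [1 + y] on the values
   taken. *)
have E : (\int[P]_t (`|1 + f t|)%:E = \int[uniform_prob pp]_x (`|1 + h x|)%:E)%E.
  transitivity (\int[distribution P X]_y (`|1 + y|)%:E)%E.
    by rewrite ge0_integral_distribution.
  transitivity (\int[distribution (uniform_prob pp) Z]_y (`|1 + y|)%:E)%E.
    by apply: eq_measure_integral => D mD _; exact: lawf.
  by rewrite ge0_integral_distribution.
have abs1 (y : R) : `|y| <= 1 -> `|1 + y| = 1 + y.
  by rewrite ler_norml => /andP[y1 _]; rewrite ger0_norm//; lra.
have E1 : \int[P]_t (1 + f t) = 1.
  have U1 : (\int[uniform_prob pp]_x (1 + h x)%:E = 1)%E.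
    apply: (@integral_uniform_trig pp h F) => // x.
    by have := h1 x; rewrite ler_norml => /andP[].
  have fE : (\int[P]_t (1 + f t)%:E = \int[P]_t (`|1 + f t|)%:E)%E.
    by apply: eq_integral => t _; rewrite abs1.
  have hE : (\int[uniform_prob pp]_x (`|1 + h x|)%:E = \int[uniform_prob pp]_x (1 + h x)%:E)%E.
    by apply: eq_integral => t _; rewrite abs1.
  by rewrite /Rintegral fE E hE U1.
by move: E1; rewrite bRintegralD//; [rewrite probability_Rintegral_cst; lra|exact: bmeas_cst].
Qed.

Lemma steinhaus_mean (xi : T -> C) : cmeasurable xi -> unif_circle P xi ->
  (forall t, cabs (xi t) ^+ 2 <= 1) ->
  \int[P]_t complex.Re (xi t) = 0 /\ \int[P]_t complex.Im (xi t) = 0.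
Proof.
move=> mxi uxi xi1.
have c1 t : cabs (xi t) <= 1.
  by rewrite -(@ler_pXn2r _ 2 isT) ?nnegrE ?cabs_ge0// expr1n.
have [b1 b2] := cbmeas_bounded mxi c1.
have Re1 t : `|complex.Re (xi t)| <= 1.
  apply: le_trans (c1 t); rewrite -(@ler_pXn2r _ 2 isT) ?nnegrE ?cabs_ge0//.
  by rewrite sqr_cabs real_normK ?num_real// lerDl sqr_ge0.
have Im1 t : `|complex.Im (xi t)| <= 1.
  apply: le_trans (c1 t); rewrite -(@ler_pXn2r _ 2 isT) ?nnegrE ?cabs_ge0//.
  by rewrite sqr_cabs real_normK ?num_real// lerDr sqr_ge0.
have e2 : 2 * pi = pi *+ 2 :> R by rewrite mulr_natl.
split.
- apply: (@steinhaus_component_mean xi _ cos sin) => //.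
  + exact: continuous_cos.
  + by move=> x; exact: cos_max.
  + by rewrite e2 sin2pi sin0.
  + by move=> t th ->.
- apply: (@steinhaus_component_mean xi _ sin (fun x => - cos x)) => //.
  + exact: continuous_sin.
  + by move=> x; exact: sin_max.
  + by move=> x; apply: is_derive_eq; rewrite opprK.
  + by rewrite e2 cos2pi cos0.
  + by move=> t th ->.
Qed.

Lemma rademacher_mean (xi : T -> C) : cmeasurable xi ->
  P [set t | xi t = 1] = (2^-1)%:E -> P [set t | xi t = -1] = (2^-1)%:E ->
  (forall t, cabs (xi t) ^+ 2 <= 1) ->
  \int[P]_t complex.Re (xi t) = 0 /\ \int[P]_t complex.Im (xi t) = 0.
Proof.
move=> mxi P1 P2 xi1; have [m1 m2] := mxi.
have c1 t : cabs (xi t) <= 1.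
  by rewrite -(@ler_pXn2r _ 2 isT) ?nnegrE ?cabs_ge0// expr1n.
have [b1 b2] := cbmeas_bounded mxi c1.
have mset (c : C) : measurable [set t | xi t = c].
  have -> : [set t | xi t = c] = ((fun t => complex.Re (xi t)) @^-1` [set complex.Re c]) `&`
      ((fun t => complex.Im (xi t)) @^-1` [set complex.Im c]).
    apply/seteqP; split => t /=; first by move=> ->.
    by move=> [h1 h2]; exact: complex_eq.
  by apply: measurableI; rewrite -[X in measurable X]setTI; [exact: m1|exact: m2].
pose A1 := [set t | xi t = 1]; pose A2 := [set t | xi t = -1].
have disj : A1 `&` A2 = set0.
  apply/seteqP; split => t //= -[]; rewrite /A1 /A2 /= => -> => /(congr1 (@complex.Re R)) /=.
  by lra.
pose N := ~` (A1 `|` A2).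
have mA : measurable (A1 `|` A2) by apply: measurableU; exact: mset.
have mN : measurable N by exact: measurableC.
have PN : P N = 0%E.
  have PA : P (A1 `|` A2) = 1%E.
    rewrite measureU//; [|exact: mset|exact: mset].
    transitivity ((2^-1)%:E + (2^-1)%:E : \bar R)%E; first by congr (_ + _)%E.
    by rewrite -EFinD; congr EFin; lra.
  by rewrite probability_setC// PA subee.
have out t : ~ N t -> xi t = 1 \/ xi t = -1.
  by move=> /contrapT.
split.
  rewrite (@eq_Rintegral_null _ (fun t => \1_A1 t - \1_A2 t) N)//.
  - rewrite bRintegralB; [|exact/bmeas_indic/mset|exact/bmeas_indic/mset].
    rewrite !Rintegral_indic; [|exact: mset|exact: mset].
    by rewrite P1 P2 subrr.
  - by apply: bmeasB; apply: bmeas_indic; exact: mset.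
  move=> t /out[] h; rewrite !indicE h /=.
    rewrite mem_set// memNset ?subr0//= /A2 /= h => /(congr1 (@complex.Re R)) /=; lra.
  rewrite memNset ?mem_set ?sub0r//= /A1 /= h => /(congr1 (@complex.Re R)) /=; lra.
rewrite (@eq_Rintegral_null _ (fun=> 0) N)//.
- exact: probability_Rintegral_cst.
- exact: bmeas_cst.
- by move=> t /out[] ->; rewrite /= ?oppr0.
Qed.

End RandomSigns.

(** * The good event *)

Section CertificateCoefficients.
Context {R : realType}.
Local Notation C := R[i].
Variables (n : nat) (S : {set 'I_n}).

Definition frameOf (W : 'M[C]_n) : 'M[C]_n := 1%:M + (W *m projS S - projS S).

(* For W the rows of A^* A indexed by S, this is \det times row j of
   A^* A_S (A_S^* A_S)^-1; the adjugate keeps it polynomial in the entries of A,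
   hence bounded and measurable everywhere. *)
Definition certificateRow (W : 'M[C]_n) (j : 'I_n) : 'rV[C]_n :=
  adjmx (col j W) *m \adj (frameOf W).

Variables (N : nat) (A : 'M[C]_(N, n)).
Local Notation H := (adjmx A *m A).
Local Notation W := (projS S *m H).

Lemma frameOf_gram : frameOf W = frameS S A.
Proof. by []. Qed.

Lemma certificateRowE j (sg : 'cV[C]_n) :
  (certificateRow W j *m sg) 0 0 = (H *m projS S *m \adj (frameS S A) *m sg) j 0.
Proof.
have E : adjmx (col j W) = row j (H *m projS S).
  have hW : adjmx W = H *m projS S by rewrite adjmx_mul projS_herm (hermmx_gram A).
  by apply/matrixP => a b; rewrite -hW adjmxE [in LHS]mxE [in RHS]mxE adjmxE.
by rewrite /certificateRow E frameOf_gram -!row_mul mxE.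
Qed.

Hypothesis Ybound : opbound (gramS S A - projS S) ((2^-1) ^+ 2).

Lemma det_frame_gt0 : 0 < cabs (\det (frameOf W)).
Proof.
rewrite lt_def cabs_ge0 andbT; apply/eqP => /cabs_eq0 d0.
by have := frame_unit Ybound; rewrite unitmxE -frameOf_gram d0 unitr0.
Qed.

(** [\adj G] is [\det G] times an inverse of norm at most 2; that inverse is Hermitian, so it may
    act on the column instead of the row. *)
Lemma certificateRow_nsq j :
  nsq (certificateRow W j) <= cabs (\det (frameOf W)) ^+ 2 * (4 * nsq (col j W)).
Proof.
have hG : hermmx (frameS S A).
  apply: hermmxD; first exact: adjmx1.
  by apply: hermmxB; [exact: gramS_herm|exact: projS_herm].
have uG := frame_unit Ybound.
have hI : adjmx (invmx (frameS S A)) = invmx (frameS S A).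
  have : adjmx (invmx (frameS S A)) *m frameS S A = 1%:M.
    by rewrite -[X in _ *m X]hG -adjmx_mul mulmxV// adjmx1.
  by move=> /(congr1 (mulmx^~ (invmx (frameS S A)))); rewrite mulmxK// mul1mx.
have E : \adj (frameS S A) = \det (frameS S A) *: invmx (frameS S A).
  by rewrite /invmx uG scalerA divrr ?scale1r// -unitmxE.
rewrite /certificateRow frameOf_gram E -scalemxAr nsqZc; apply: ler_wpM2l; first exact: sqr_ge0.
rewrite -nsq_adj adjmx_mul adjmxK hI -!sqr_n2.
have h := n2_inv_frame Ybound (col j W).
have -> : 4 * n2 (col j W) ^+ 2 = (2 * n2 (col j W)) ^+ 2 by ring.
by rewrite ler_pXn2r ?nnegrE ?mulr_ge0 ?n2_ge0.
Qed.

End CertificateCoefficients.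

Section TruncatedIsotropy.
Context {R : realType} {d} {T : measurableType d} (P : probability T R).
Local Notation C := R[i].
Variables (n m : nat) (p : 'I_m -> nat) (B : forall l : 'I_m, T -> 'M[C]_(p l, n)).
Variables (S : {set 'I_n}) (Theta : R).
Hypothesis T0 : 0 < Theta.
Hypothesis m0 : (0 < m)%N.
Hypothesis mB : forall l a b, cmeasurable (fun t => B l t a b).
Hypothesis iB : forall l (j k : 'I_n),
  P.-integrable setT (fun t => (complex.Re ((adjmx (B l t) *m B l t) j k))%:E) /\
  P.-integrable setT (fun t => (complex.Im ((adjmx (B l t) *m B l t) j k))%:E).
Hypothesis isoB : forall j k : 'I_n,
  (((m%:R : R)^-1)%:E *
    \sum_(l < m) \int[P]_t (complex.Re ((adjmx (B l t) *m B l t) j k))%:E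
    = ((j == k)%:R)%:E)%E /\
  (((m%:R : R)^-1)%:E *
    \sum_(l < m) \int[P]_t (complex.Im ((adjmx (B l t) *m B l t) j k))%:E
    = 0%:E)%E.
Hypothesis tameae : {ae P, forall t, forall l, tame S Theta (B l t)}.

Let H l t := halfGram S Theta m (B l t).

Let bH l : mbmeas (H l).
Proof. by apply: mbmeas_halfGram => //; exact: mB. Qed.

Lemma ae_eq_Rintegral (f g : T -> R) : measurable_fun setT f -> measurable_fun setT g ->
  {ae P, forall t, f t = g t} -> \int[P]_t f t = \int[P]_t g t.
Proof.
move=> mf mg fg; rewrite /Rintegral; congr fine.
apply: ae_eq_integral => //; [exact/measurable_EFinP|exact/measurable_EFinP|].
by apply: filterS fg => t ->.
Qed.

Let isoR (f : 'I_m -> T -> R) (c : R) :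
  (forall l, P.-integrable setT (fun t => (f l t)%:E)) ->
  (((m%:R : R)^-1)%:E * \sum_(l < m) \int[P]_t (f l t)%:E = c%:E)%E ->
  m%:R^-1 * \sum_l \int[P]_t f l t = c.
Proof.
move=> fi; rewrite (eq_bigr (fun l => (\int[P]_t f l t)%:E)).
  by rewrite sumEFin -EFinM => -[].
by move=> l _; rewrite /Rintegral fineK//; exact: integrable_fin_num.
Qed.

Let entry l t j k : tame S Theta (B l t) ->
  H l t j k = (m%:R^-1 * (j \in S)%:R)%:C%C * (adjmx (B l t) *m B l t) j k.
Proof.
move=> tB; rewrite /H /halfGram /tameB tB mxE projSE.
by case: (j \in S); rewrite ?mulr1// !mulr0 rmorph0 mul0r.
Qed.

Let sum_entry (re : C -> R) (j k : 'I_n) (c : R) :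
  (forall (a : R) z, re (a%:C%C * z) = a * re z) ->
  (forall l, bmeas (fun t => re (H l t j k))) ->
  (forall l, P.-integrable setT (fun t => (re ((adjmx (B l t) *m B l t) j k))%:E)) ->
  (((m%:R : R)^-1)%:E * \sum_(l < m) \int[P]_t (re ((adjmx (B l t) *m B l t) j k))%:E = c%:E)%E ->
  \sum_l \int[P]_t re (H l t j k) = (j \in S)%:R * c.
Proof.
move=> reM bre ire iso.
rewrite -(isoR ire iso) mulrA [X in X * _]mulrC mulr_sumr; apply: eq_bigr => l _.
rewrite -[RHS](RintegralZl _ measurableT (ire l)); apply: ae_eq_Rintegral.
- exact: (bre l).1.
- apply: measurable_funM => //.
  exact/measurable_EFinP/(measurable_int P)/ire.
by apply: filterS tameae => t tB; rewrite entry.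
Qed.

(** Truncation changes the blocks on a null set only, so isotropy passes to the bounded
    variables. *)
Lemma sum_Emx_halfGram : \sum_l Emx P (H l) = projS S.
Proof.
apply/matrixP => j k; rewrite summxE.
have pE : projS S j k = ((j \in S)%:R * (j == k)%:R)%:C%C :> C.
  rewrite !mxE; case: (j =P k) => [->|_]; first by rewrite mulr1.
  by rewrite mulr0.
rewrite pE; apply: complex_eq.
  rewrite cRe_sum; under eq_bigr do rewrite mxE /=.
  apply: (sum_entry (re := @complex.Re R)) => [a z|l|l|].
  - by rewrite cReM /= mul0r subr0.
  - exact: (bH l j k).1.
  - exact: (iB l j k).1.
  - exact: (isoB j k).1.
rewrite cIm_sum; under eq_bigr do rewrite mxE /=.
rewrite (sum_entry (re := @complex.Im R) (c := 0)) ?mulr0// => [a z|l|l|].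
- by rewrite cImM /= mul0r addr0.
- exact: (bH l j k).2.
- exact: (iB l j k).2.
- exact: (isoB j k).2.
Qed.

(** [halfGram_col_var] bounds by the untruncated column, whose second moments average to 1 by the
    diagonal part of isotropy. *)
Lemma sum_halfGram_var j : \sum_l \int[P]_t nsq (col j (H l t)) <= Theta / m%:R.
Proof.
have nE l t : nsq (col j (B l t)) = complex.Re ((adjmx (B l t) *m B l t) j j).
  rewrite /nsq mxE cRe_sum; apply: eq_bigr => a _.
  by rewrite big_ord1 !mxE cReM cReJ cImJ; ring.
have iso := isoR (fun l => (iB l j j).1) (isoB j j).1; rewrite eqxx in iso.
rewrite -[leRHS]mulr1 -[X in _ <= _ * X]iso mulrA mulr_sumr.
apply: ler_sum => l _; rewrite -[leRHS](RintegralZl _ measurableT (iB l j j).1).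
apply: le_Rintegral => //.
- apply: bmeas_integrable; apply: bmeas_nsq => a b.
  by apply: (eq_cbmeas (bH l a j)) => t; rewrite [in RHS]mxE.
- exact: (integrableZl measurableT (Theta / m%:R / m%:R) (iB l j j).1).
- by move=> t _; rewrite -nE -mulrA; exact: halfGram_col_var.
Qed.

End TruncatedIsotropy.

Section SigmaC.
Context {R : realType} {d} {T : measurableType d}.
Local Notation C := R[i].
Variables (K : Type) (f : K -> T -> C).

Lemma sigma_algebra_sigmaC : sigma_algebra setT (sigmaC f).
Proof. exact: smallest_sigma_algebra. Qed.

Lemma sigmaC_measurable : (forall k, cmeasurable (f k)) -> sigmaC f `<=` measurable.
Proof.
move=> mf; apply: smallest_sub; first exact: sigma_algebra_measurable.
by move=> _ [k [D [mD [->|->]]]]; rewrite -[X in measurable X]setTI;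
  [exact: (mf k).1|exact: (mf k).2].
Qed.

Lemma cmeasurable_sigmaC (G : set (set T)) k : sigmaC f `<=` <<s G>> ->
  cmeasurable (f k : g_sigma_algebraType G -> C).
Proof.
move=> fG; split => _ D mD; rewrite setTI; apply: fG; apply: sub_sigma_algebra; exists k, D.
  by split => //; left.
by split => //; right.
Qed.

End SigmaC.

Section GoodEvent.
Context {R : realType} {d} {T : measurableType d} (P : probability T R).
Local Notation C := R[i].

Lemma union_bound (I : Type) (r : seq I) (A : I -> set T) : (forall i, measurable (A i)) ->
  measurable (\big[setU/set0]_(i <- r) A i) /\
  fine (P (\big[setU/set0]_(i <- r) A i)) <= \sum_(i <- r) fine (P (A i)).
Proof.
move=> mA; elim: r => [|i r [mr IH]]; first by rewrite !big_nil measure0.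
rewrite !big_cons; have mU := measurableU _ _ (mA i) mr; split => //.
have fP (D : set T) : measurable D -> P D \is a fin_num by exact: fin_num_measure.
apply: le_trans (_ : fine (P (A i) + P (\big[setU/set0]_(j <- r) A j))%E <= _).
  by apply: fine_le; rewrite ?fin_numD ?fP//; exact: measureU2.
by rewrite fineD ?fP// lerD2l.
Qed.

Variables (n m : nat) (p : 'I_m -> nat) (B : forall l : 'I_m, T -> 'M[C]_(p l, n)).
Variables (S : {set 'I_n}) (Theta L : R) (xi : {i : 'I_n | i \in S} -> T -> C).
Hypothesis T0 : 0 < Theta.
Hypothesis m0 : (0 < m)%N.
Hypothesis mB : forall l a b, cmeasurable (fun t => B l t a b).
Hypothesis Bind : mindep P (fun l : 'I_m =>
  sigmaC (fun ab : 'I_(p l) * 'I_n => fun t => B l t ab.1 ab.2)).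
Hypothesis iB : forall l (j k : 'I_n),
  P.-integrable setT (fun t => (complex.Re ((adjmx (B l t) *m B l t) j k))%:E) /\
  P.-integrable setT (fun t => (complex.Im ((adjmx (B l t) *m B l t) j k))%:E).
Hypothesis isoB : forall j k : 'I_n,
  (((m%:R : R)^-1)%:E *
    \sum_(l < m) \int[P]_t (complex.Re ((adjmx (B l t) *m B l t) j k))%:E
    = ((j == k)%:R)%:E)%E /\
  (((m%:R : R)^-1)%:E *
    \sum_(l < m) \int[P]_t (complex.Im ((adjmx (B l t) *m B l t) j k))%:E
    = 0%:E)%E.
Hypothesis tameae : {ae P, forall t, forall l, tame S Theta (B l t)}.
Hypothesis mxi : forall i, cmeasurable (xi i).
Hypothesis xi_ind : mindep P (fun i => sigmaC (fun _ : unit => xi i)).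
Hypothesis xi1 : forall i t, cabs (xi i t) ^+ 2 <= 1.
Hypothesis Exi : forall i, \int[P]_t complex.Re (xi i t) = 0 /\ \int[P]_t complex.Im (xi i t) = 0.
Hypothesis Bxi_ind : mindep P (fun b : bool => if b
  then sigmaC (fun k : {l : 'I_m & ('I_(p l) * 'I_n)%type} =>
                 fun t => B (projT1 k) t (projT2 k).1 (projT2 k).2)
  else sigmaC xi).
Hypothesis L1 : 1 <= L.
Hypothesis KL : 889 * (Theta / m%:R) * L ^+ 2 <= 1.

Let G (l : 'I_m) := sigmaC (fun ab : 'I_(p l) * 'I_n => fun t => B l t ab.1 ab.2).
Let G2 (b : bool) := if b
  then sigmaC (fun k : {l : 'I_m & ('I_(p l) * 'I_n)%type} =>
                 fun t => B (projT1 k) t (projT2 k).1 (projT2 k).2)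
  else sigmaC xi.
Let J := [set true]%SET.

Let Gs l : sigma_algebra setT (G l). Proof. exact: sigma_algebra_sigmaC. Qed.
Let Gm l : G l `<=` measurable.
Proof. by apply: sigmaC_measurable => ab; exact: mB. Qed.
Let G2s b : sigma_algebra setT (G2 b).
Proof. by case: b; exact: sigma_algebra_sigmaC. Qed.
Let G2m b : G2 b `<=` measurable.
Proof. by case: b; apply: sigmaC_measurable => k; [exact: mB|exact: mxi]. Qed.

Let W t := \sum_l halfGram S Theta m (B l t).
Let Y t := W t *m projS S - projS S.

(** Order of the moment: the integer in [(L, L + 1]], in successor form for [nsq_power_small]. *)
Let N := (Num.truncn L).+1.

Let N_bounds : L <= N%:R /\ N%:R <= L + 1.
Proof.
have L0 : 0 <= L by apply: le_trans L1.
have /andP[h1 h2] := truncn_itv L0; rewrite /N; split; first exact: ltW.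
by rewrite -natr1 lerD2r.
Qed.

Let K0 : 0 <= Theta / m%:R. Proof. by rewrite divr_ge0 ?ler0n ?ltW. Qed.

Let mBG l a b : cmeasurable ((fun t => B l t a b) : g_sigma_algebraType (G l) -> C).
Proof.
apply: (@cmeasurable_sigmaC _ _ _ _ (fun ab : 'I_(p l) * 'I_n => fun t => B l t ab.1 ab.2) (G l) (a, b)).
exact: sub_sigma_algebra.
Qed.

Let U := g_sigma_algebraType (joinG G2 J).

Let mBU l a b : cmeasurable ((fun t => B l t a b) : U -> C).
Proof.
apply: (@cmeasurable_sigmaC _ _ _ _ (fun k : {l : 'I_m & ('I_(p l) * 'I_n)%type} =>
  fun t => B (projT1 k) t (projT2 k).1 (projT2 k).2) _ (existT _ l (a, b))).
by move=> D GD; apply: sub_sigma_algebra; exists true => //; rewrite finset.in_set1.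
Qed.

Let bHG l : mbmeas ((fun t => halfGram S Theta m (B l t)) : g_sigma_algebraType (G l) -> _).
Proof. by apply: mbmeas_halfGram => // a b; exact: mBG. Qed.

Let bW : mbmeas W.
Proof. by apply: mbmeas_sum => l _; apply: mbmeas_halfGram => // a b; exact: mB. Qed.

Let bWU : mbmeas (W : U -> _).
Proof. by apply: mbmeas_sum => l _; apply: mbmeas_halfGram => // a b; exact: mBU. Qed.

Let bYX d' (V : measurableType d') (F : V -> 'M[C]_n) : mbmeas F ->
  mbmeas (fun t => F t *m projS S - projS S).
Proof.
move=> bF; apply: mbmeasB; last exact: mbmeas_cst.
by apply: mbmeas_mul => //; exact: mbmeas_cst.
Qed.

Let bcol d' (V : measurableType d') (F : V -> 'M[C]_n) j : mbmeas F ->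
  mbmeas (fun t => col j (F t)).
Proof. by move=> bF a b; apply: (eq_cbmeas (bF a j)) => t; rewrite [in RHS]mxE. Qed.

Let bad1 := [set t | (4^-1 : R) ^+ N <= nsq (mxpow (Y t) N)].
Let bad2 j := [set t | (64 * L)^-1 <= nsq (col j (W t))].
Let allTame := [set t | forall l, tame S Theta (B l t)].
(* Depends on the blocks only, so that the signs stay independent of it *)
Let good j := (allTame `&` ~` bad1) `&` ~` bad2 j.
Let bad3 j := [set t | good j t /\ 3 / 4 * cabs (\det (frameOf S (W t))) <=
   cabs (\sum_i certificateRow S (W t) j 0 (val i) * xi i t)].

Let P1 : fine (P bad1) <= n%:R * expR (- L).
Proof.
apply: (@gram_deviation _ _ _ P _ G Gs Gm Bind n S p
  (fun l t => scaledBlock S Theta m (B l t)) (fun l t => halfGram S Theta m (B l t)) (Theta / m%:R)).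
- by move=> l; apply: mbmeas_scaledBlock => // a b; exact: mBG.
- exact: bHG.
- exact: K0.
- by move=> l t; exact: scaledBlock_opbound.
- by move=> l t; exact: scaledBlock_gram.
- exact: (sum_Emx_halfGram T0 mB iB isoB tameae).
- exact: L1.
- exact: KL.
- exact: N_bounds.1.
- exact: N_bounds.2.
Qed.

Let P2 j : j \notin S -> fine (P (bad2 j)) <= 2 * expR (- L).
Proof.
move=> jS; apply: (@row_deviation _ _ _ P _ G Gs Gm Bind n S
  (fun l t => halfGram S Theta m (B l t)) (Theta / m%:R)) => //.
- by move=> l t k; exact: halfGram_col.
- exact: (sum_Emx_halfGram T0 mB iB isoB tameae).
- by move=> k _; exact: (sum_halfGram_var S T0 m0 mB iB isoB).
Qed.

Let mTame d' (V : measurableType d') (F : forall l, V -> 'M[C]_(p l, n)) :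
  (forall l a b, cmeasurable (fun t => F l t a b)) ->
  measurable [set t | forall l, tame S Theta (F l t)].
Proof.
move=> mF; have -> : [set t | forall l, tame S Theta (F l t)] =
    \bigcap_(l in [set: 'I_m]) [set t | tame S Theta (F l t)].
  by apply/seteqP; split => t /= h l; [move=> _; exact: h|exact: h].
apply: fin_bigcap_measurable => // l _; apply: measurable_tame; exact: mF.
Qed.

Let frame_good t : allTame t -> ~ bad1 t ->
  opbound (gramS S (sensing (fun l => B l t)) - projS S) ((2^-1) ^+ 2).
Proof.
move=> tt /negP; rewrite -real_ltNge ?num_real// => nb.
have -> : (2^-1) ^+ 2 = 4^-1 :> R by rewrite exprVn; congr (_^-1); ring.
have E : gramS S (sensing (fun l => B l t)) - projS S = Y t.
  by rewrite /gramS (sensing_gram tt).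
apply: (nsq_power_small (N := Num.truncn L)).
- by apply: hermmxB; [exact: gramS_herm|exact: projS_herm].
- by rewrite invr_ge0.
- by rewrite E; exact: ltW.
Qed.

(** [certificateRow_nsq] costs a factor 4, and [4 / (64 L)] is the [1 / (16 L)] of
    [sign_sum_tail]. *)
Let good_row j t : good j t ->
  0 < cabs (\det (frameOf S (W t))) /\
  \sum_i cabs (certificateRow S (W t) j 0 (val (i : {i | i \in S}))) ^+ 2 <=
    cabs (\det (frameOf S (W t))) ^+ 2 / (16 * L).
Proof.
move=> [[tt nb1] nb2]; have ob := frame_good tt nb1.
have E : W t = projS S *m (adjmx (sensing (fun l => B l t)) *m sensing (fun l => B l t)).
  by rewrite (sensing_gram tt).
have L0 : 0 < L by exact: lt_le_trans ltr01 L1.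
rewrite E; split; first exact: det_frame_gt0.
apply: (@le_trans _ _ (nsq (certificateRow S (W t) j))).
  rewrite E /nsq big_ord1.
  rewrite (eq_bigr (fun i : {i | i \in S} => (fun i => complex.Re (certificateRow S (W t) j 0 i) ^+ 2 +
    complex.Im (certificateRow S (W t) j 0 i) ^+ 2) (val i))); last first.
    by move=> i _; rewrite sqr_cabs E.
  rewrite -E [leRHS](bigID (mem S))/= -[leLHS]addr0; apply: lerD; last first.
    by apply: sumr_ge0 => i _; rewrite addr_ge0// sqr_ge0.
  by rewrite [leRHS]big_sub.
rewrite E; apply: le_trans (certificateRow_nsq ob j) _; apply: ler_wpM2l; first exact: sqr_ge0.
move: nb2; rewrite /bad2 /= => /negP; rewrite -real_ltNge ?num_real// => nb2.
rewrite -E; apply: le_trans (_ : 4 * (64 * L)^-1 <= _).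
  by rewrite ler_pM2l// ltW.
rewrite !invfM mulrA ler_pM2r ?invr_gt0//; lra.
Qed.

Let mgood j : <<s joinG G2 J>> (good j).
Proof.
have h : measurable (good j : set U).
  apply: measurableI; first apply: measurableI.
  - exact: (mTame mBU).
  - apply: measurableC; apply: measurable_superlevel.
    by apply: bmeas_nsq; apply: mbmeas_pow; exact: bYX.
  - apply: measurableC; apply: measurable_superlevel.
    by apply: bmeas_nsq; exact: bcol.
exact: h.
Qed.

Let P3 j : measurable (bad3 j) /\ fine (P (bad3 j)) <= 2 * expR (- L).
Proof.
have bxi b i : sigmaC xi `<=` <<s G2 b>> -> cbmeas (xi i : g_sigma_algebraType (G2 b) -> C).
  move=> h; apply: (@cbmeas_bounded _ _ (g_sigma_algebraType (G2 b)) _ 1).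
    exact: cmeasurable_sigmaC.
  by move=> t; rewrite -(@ler_pXn2r _ 2 isT) ?nnegrE ?cabs_ge0// expr1n.
have bfr : mbmeas ((fun t => frameOf S (W t)) : U -> _).
  by apply: mbmeasD; [exact: mbmeas_cst|exact: bYX].
apply: (@sign_sum_tail_random _ _ _ P _ xi (fun i => sigmaC (fun _ : unit => xi i)) _ _ _ _ _ _
  G2 G2s G2m Bxi_ind _ (fun t i => certificateRow S (W t) j 0 (val i))
  (fun t => cabs (\det (frameOf S (W t)))) (good j) L (mgood j)) => //.
- by move=> i; exact: sigma_algebra_sigmaC.
- by move=> i; apply: sigmaC_measurable.
- move=> i; apply: (@cbmeas_bounded _ _ (g_sigma_algebraType (sigmaC (fun _ : unit => xi i))) _ 1).
    apply: (@cmeasurable_sigmaC _ _ _ _ (fun _ : unit => xi i) _ tt).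
    exact: sub_sigma_algebra.
  by move=> t; rewrite -(@ler_pXn2r _ 2 isT) ?nnegrE ?cabs_ge0// expr1n.
- by move=> i; apply: bxi; exact: sub_sigma_algebra.
- move=> i; have h : mbmeas ((fun t => certificateRow S (W t) j) : U -> _).
    apply: mbmeas_mul; first by apply: mbmeas_adj; exact: bcol.
    exact: mbmeas_adjugate.
  exact: h.
- have [d1 d2] := cbmeas_det bfr.
  apply: bmeas_sqrt; apply: bmeasD.
    by apply: (eq_bmeas (bmeasM d1 d1)) => t; rewrite expr2.
  by apply: (eq_bmeas (bmeasM d2 d2)) => t; rewrite expr2.
- by move=> t /good_row[].
- by move=> t /good_row[].
Qed.

(** Failure costs [n e^-L] for the Gram matrix and, for each [j] off [S], [2 e^-L] for the row and
    [2 e^-L] for the signs. The event involves blocks and signs only, so one event serves whatever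
    the noise is. *)
Lemma good_event : exists E : set T, [/\ measurable E,
  1 - 5 * n%:R * expR (- L) <= fine (P E) &
  forall t, E t -> [/\ forall l, tame S Theta (B l t),
    opbound (gramS S (sensing (fun l => B l t)) - projS S) ((2^-1) ^+ 2) &
    forall j, j \notin S ->
      nsq (col j (\sum_l halfGram S Theta m (B l t))) < (64 * L)^-1 /\
      cabs (\sum_i certificateRow S (\sum_l halfGram S Theta m (B l t)) j 0 (val i) * xi i t)
        < 3 / 4 * cabs (\det (frameOf S (\sum_l halfGram S Theta m (B l t))))]].
Proof.
have mT : measurable allTame by exact: mTame.
have m1 : measurable bad1.
  by apply: measurable_superlevel; apply: bmeas_nsq; apply: mbmeas_pow; exact: bYX.
have m2 j : measurable (bad2 j).
  by apply: measurable_superlevel; apply: bmeas_nsq; exact: bcol.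
have m3 j : measurable (bad3 j) by exact: (P3 j).1.
have PT : P (~` allTame) = 0%E.
  have [D [mD D0 hD]] := tameae.
  apply: (subset_measure0 (B := D)) => //; exact: measurableC.
pose bad j := if j \in S then set0 else bad2 j `|` bad3 j.
have mb j : measurable (bad j).
  by rewrite /bad; case: (j \in S) => //; exact: measurableU.
have Pb j : fine (P (bad j)) <= 4 * expR (- L).
  rewrite /bad; case: (boolP (j \in S)) => jS.
    by rewrite measure0 /= mulr_ge0// expR_ge0.
  have [_] := union_bound [:: true; false]
    (fun b => if b as b return measurable (if b then bad2 j else bad3 j) then m2 j else m3 j).
  rewrite !big_cons !big_nil setU0 addr0 => h; apply: le_trans h _.
  by have := P2 jS; have := (P3 j).2; lra.
have [mU PU] := union_bound (index_enum 'I_n) mb.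
set BU := \big[setU/set0]_(j <- _) bad j in mU PU.
pose V b := match b with None => ~` allTame | Some true => bad1 | Some false => BU end.
have mV b : measurable (V b).
  by case: b => [[]|] //; exact: measurableC.
have [mA PA] := union_bound [:: None; Some true; Some false] mV.
set Bad := \big[setU/set0]_(b <- _) V b in mA PA.
exists (~` Bad); split; first exact: measurableC.
- have PBad : fine (P Bad) <= 5 * n%:R * expR (- L).
    apply: le_trans PA _; rewrite !big_cons big_nil /= [P _]PT /= add0r addr0.
    have : fine (P BU) <= \sum_(j < n) 4 * expR (- L).
      by apply: le_trans PU _; apply: ler_sum => j _; exact: Pb.
    rewrite sumr_const card_ord -mulr_natl; have := P1.
    by move: (fine (P bad1)) (fine (P BU)) (expR (- L)) => a b c; lra.
  have fP : P Bad \is a fin_num by exact: fin_num_measure.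
  have -> : fine (P (~` Bad)) = 1 - fine (P Bad).
    by rewrite probability_setC// fineB.
  by rewrite lerD2l lerN2.
move=> t nb.
have [n0 n1 nU] : [/\ allTame t, ~ bad1 t & ~ BU t].
  split.
  - by apply: contrapT => h; apply: nb; rewrite /Bad !big_cons big_nil; left.
  - by move=> h; apply: nb; rewrite /Bad !big_cons big_nil; right; left.
  - by move=> h; apply: nb; rewrite /Bad !big_cons big_nil; right; right; left.
split => //; first exact: frame_good.
move=> j jS.
have nbj : ~ bad j t.
  move=> h; apply: nU; rewrite /BU (bigD1_seq j)//= ?mem_index_enum ?index_enum_uniq//.
  by left.
have [nb2 nb3] : ~ bad2 j t /\ ~ bad3 j t.
  by split=> h; apply: nbj; rewrite /bad (negbTE jS); [left|right].
split; first by rewrite real_ltNge ?num_real//; exact/negP.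
rewrite real_ltNge ?num_real//; apply/negP => h; apply: nb3; split => //.
Qed.

End GoodEvent.

(** * Choice of [L] and assembly of the recovery bound *)

Theorem mainTheorem3 (R : realType) :
  exists C1 C2 : R, 0 < C1 /\ 0 < C2 /\
  forall (d : measure_display) (T : measurableType d) (P : probability T R)
    (n m : nat) (p : 'I_m -> nat)
    (B : forall l : 'I_m, T -> 'M[R[i]]_(p l, n))
    (S : {set 'I_n}) (Theta : R)
    (real_case : bool) (x : T -> 'cV[R[i]]_n)
    (eta : R) (noise : T -> 'cV[R[i]]_(\sum_(l < m) p l)) (eps : R),
  (* dimensions *)
  (0 < n)%N -> (0 < m)%N -> (forall l, 0 < p l)%N ->
  (* B_1, ..., B_m are independent random matrices *)
  (forall l (a : 'I_(p l)) (b : 'I_n), cmeasurable (fun t => B l t a b)) ->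
  mindep P (fun l : 'I_m =>
    sigmaC (fun ab : 'I_(p l) * 'I_n => fun t => B l t ab.1 ab.2)) ->
  (* isotropy: E(A^* A) = (1/m) sum_l E(B_l^* B_l) = Id_n *)
  (forall (l : 'I_m) (j k : 'I_n),
     P.-integrable setT (fun t => (complex.Re ((adjmx (B l t) *m B l t) j k))%:E) /\
     P.-integrable setT (fun t => (complex.Im ((adjmx (B l t) *m B l t) j k))%:E)) ->
  (forall j k : 'I_n,
     (((m%:R : R)^-1)%:E *
       \sum_(l < m) \int[P]_t (complex.Re ((adjmx (B l t) *m B l t) j k))%:E
       = ((j == k)%:R)%:E)%E /\
     (((m%:R : R)^-1)%:E *
       \sum_(l < m) \int[P]_t (complex.Im ((adjmx (B l t) *m B l t) j k))%:E
       = 0%:E)%E) ->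
  (* Theta(S, F): a.s. ||B_l^* B_{l,S}||_{oo->oo} <= Theta for all l *)
  0 < Theta ->
  {ae P, forall t, forall l : 'I_m,
     infnorm (adjmx (B l t) *m colS S (B l t)) <= Theta} ->
  (* x is supported on S; x is real in the real case *)
  (forall t (i : 'I_n), i \notin S -> x t i 0 = 0) ->
  (real_case -> forall t (i : 'I_n), complex.Im (x t i 0) = 0) ->
  (* random sign assumption *)
  (forall i : 'I_n, i \in S -> cmeasurable (fun t => csgn (x t i 0))) ->
  (if real_case
   then rademacher P (fun i : {i : 'I_n | i \in S} => fun t => csgn (x t (val i) 0))
   else steinhaus P (fun i : {i : 'I_n | i \in S} => fun t => csgn (x t (val i) 0))) ->
  mindep P (fun b : bool => if b
    then sigmaC (fun k : {l : 'I_m & ('I_(p l) * 'I_n)%type} =>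
                   fun t => B (projT1 k) t (projT2 k).1 (projT2 k).2)
    else sigmaC (fun i : {i : 'I_n | i \in S} => fun t => csgn (x t (val i) 0))) ->
  (* noise *)
  0 < eta -> (forall t, norm2 (noise t) <= eta) ->
  (* probability level and number of measurements *)
  0 < eps < 1 ->
  (m%:R : R) >= 889 * Theta * (ln (6 * n%:R / eps)) ^+ 2 ->
  exists E : set T, measurable E /\ ((1 - eps)%:E <= P E)%E /\
    forall t, E t ->
      forall z : 'cV[R[i]]_n,
        qBP_minimizer (sensing (fun l => B l t))
          (sensing (fun l => B l t) *m x t + noise t) eta z ->
        norm2 (x t - z) <= (C1 + C2 * Num.sqrt (#|S|%:R)) * eta.
Proof.
(* The constants of [recovery], where [n2 sg] is at most [sqrt s]. *)
exists 8, 20; split; first by rewrite ltr0n.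
split; first by rewrite ltr0n.
move=> d T P n m p B S Theta real_case x eta noise eps n0 m0 _ mB Bind iB isoB T0 tameae
  xS _ mx signs BX_ind eta0 noise_le /andP[eps0 eps1] mL.
pose L := ln (6 * n%:R / eps).
have nR : (1 : R) <= n%:R by rewrite ler1n.
have q0 : 0 < 6 * n%:R / eps by rewrite divr_gt0// mulr_gt0//; lra.
have L1 : 1 <= L.
  rewrite -ler_expR /L lnK ?posrE//; apply: le_trans expR1_le4 _.
  by rewrite ler_pdivlMr//; lra.
have eL : expR (- L) = eps / (6 * n%:R) by rewrite expRN /L lnK ?posrE// invf_div.
have mR0 : 0 < m%:R :> R by rewrite ltr0n.
have KL : 889 * (Theta / m%:R) * L ^+ 2 <= 1.
  have -> : 889 * (Theta / m%:R) * L ^+ 2 = 889 * Theta * L ^+ 2 / m%:R by rewrite mulrA mulrAC.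
  by rewrite ler_pdivrMr// mul1r.
pose xi (i : {i : 'I_n | i \in S}) t := csgn (x t (val i) 0).
have mxi i : cmeasurable (xi i) by apply: mx; exact: valP.
have xi1 i t : cabs (xi i t) ^+ 2 <= 1 by exact: cabs_csgn_le1.
(* The two sign models are merged here: both give independence and zero means. *)
have [xi_ind Exi] : mindep P (fun i => sigmaC (fun _ : unit => xi i)) /\
    (forall i, \int[P]_t complex.Re (xi i t) = 0 /\ \int[P]_t complex.Im (xi i t) = 0).
  move: signs; case: real_case => -[ind law]; split => // i.
    by have [h1 h2] := law i; exact: rademacher_mean.
  by apply: steinhaus_mean => //; exact: law.
have [E [mE PE hE]] := good_event T0 m0 mB Bind iB isoB tameae mxi xi_ind xi1 Exi BX_ind L1 KL.
exists E; split => //; split.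
  rewrite -[leRHS]fineK ?fin_num_measure// lee_fin; apply: le_trans PE.
  (* [5 n e^-L] is [(5/6) eps]. *)
  rewrite eL lerD2l lerN2.
  rewrite mulrA ler_pdivrMr ?mulr_gt0 ?ltr0n//.
  have : 0 <= eps * n%:R by rewrite mulr_ge0 ?ler0n// ltW.
  by rewrite -mulrA [n%:R * _]mulrC [_ * (6 * _)]mulrCA; lra.
move=> t /hE[tt ob hj] z [feas zmin].
have W := sensing_gram tt.
pose sg := map_mx (@csgn R) (x t).
have xQ : projS S *m x t = x t.
  apply/matrixP => i k; rewrite projSE ord1; case: ifP => // /negbT iS.
  by rewrite xS.
have sgS : projS S *m sg = sg.
  apply/matrixP => i k; rewrite projSE ord1; case: ifP => // /negbT iS.
  by rewrite /sg mxE xS// csgn0.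
have L0 : 0 < L by exact: lt_le_trans ltr01 L1.
rewrite norm2E; apply: le_trans (_ : (8 + 20 * n2 sg) * eta <= _); last first.
  rewrite ler_pM2r// lerD2l ler_pM2l//.
  apply: ler_wsqrtr; rewrite /nsq (bigID (mem S))/= [X in _ + X]big1 ?addr0.
    rewrite -sum1_card natr_sum; apply: ler_sum => i _; rewrite big_ord1 -sqr_cabs mxE.
    exact: cabs_csgn_le1.
  move=> i iS; rewrite big_ord1 mxE xS// csgn0 /= expr0n addr0//.
apply: (recovery ob sgS (noise := noise t)) => //.
- exact: ltW.
- move=> j jS; rewrite -colE W; apply: le_trans (ltW (hj j jS).1) _.
  (* [1 / (64 L) <= (1/8)^2] since [L >= 1]. *)
  rewrite exprVn lef_pV2 ?posrE ?mulr_gt0 ?exprn_gt0//; lra.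
- move=> j jS; rewrite -certificateRowE W; have := ltW (hj j jS).2.
  have -> : \sum_i certificateRow S (\sum_l halfGram S Theta m (B l t)) j 0 (val i) * xi i t =
      (certificateRow S (\sum_l halfGram S Theta m (B l t)) j *m sg) 0 0.
    rewrite [RHS]mxE [RHS](bigID (mem S))/= [X in _ + X]big1 ?addr0; last first.
      by move=> i iS; rewrite [sg _ _]mxE xS// csgn0 mulr0.
    by rewrite [RHS]big_sub; apply: eq_bigr => i _; rewrite [sg _ _]mxE.
  by rewrite -frameOf_gram W.
- by rewrite -norm2E.
- by rewrite -norm2E.
- apply: zmin.
  have -> : sensing (fun l => B l t) *m x t + noise t - sensing (fun l => B l t) *m x t = noise t.
    by rewrite addrC addKr.
  exact: noise_le.
Qed.
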